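(* Let $\mathcal B$ be a complex Banach space and let $\mathcal G\ni f\mapsto \mathrm{Op}(f)\in\mathcal L(\mathcal B)$ be a (sequentially) continuous linear map such that (i) $\mathrm{Op}(f_1)\mathrm{Op}(f_2)=\mathrm{Op}(f_1f_2)$ for all $f_1,f_2\in\mathcal G$; (ii) $\sum_{g\in C_0^\infty(\mathbb R)}\mathcal R(\mathrm{Op}(g))$ is dense in $\mathcal B$; (iii) $\bigcap_{g\in C_0^\infty(\mathbb R)}\mathcal N(\mathrm{Op}(g))=0$. Let $P$ be the closed densely defined operator on $\mathcal B$ generated by $\mathrm{Op}$ (defined in the context). Then $\mathrm{Op}(f)=f(P)$ for all $f\in\mathcal G$.
   Context: $\mathcal R$ denotes range, $\mathcal N$ null space; the sum in (ii) is the linear span. $\mathcal G$ is the space of smooth functions $f:\mathbb R\to\mathbb C$ which, for some $R>0$, have a bounded holomorphic extension to $\{z\in\mathbb C:|z|>R\}$ (agreeing with $f$ at real $x$, $|x|>R$). For fixed $R$ let $\mathcal G_R$ be the Fréchet space of those $f\in\mathcal G$ extending to a bounded holomorphic function in $|z|>R$, with the $C^\infty$-topology of $f$ on bounded intervals together with the sup norm of the extension on $|z|>R$. $\mathcal G$ is the inductive limit of the $\mathcal G_R$ as $R\to\infty$: a sequence converges in $\mathcal G$ iff there is some $R>0$ such that it converges in $\mathcal G_R$. Note $C_0^\infty(\mathbb R)\subset\mathcal G$. Definition of $P$: for $z\in\mathbb C\setminus\mathbb R$ let $\omega_z(x)=1/(z-x)$, so $\omega_z\in\mathcal G$. The space $\mathcal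 D=\mathcal R(\mathrm{Op}(\omega_z))$ is independent of $z\in\mathbb C\setminus\mathbb R$ and dense. For $u=\mathrm{Op}(\omega_z)v\in\mathcal D$, $v\in\mathcal B$, put $Pu=\mathrm{Op}(x\,\omega_z(x))v$, where $x\,\omega_z(x)$ denotes the function $x\mapsto x/(z-x)$; this does not depend on the choice of $z,v$ representing $u$. Then $P$ with domain $\mathcal D$ is closed, $\sigma(P)\subset\mathbb R$, and the resolvent is locally temperate: for every compact $K\subset\mathbb C$ there are $C_K,N_K\ge0$ such that $\|(z-P)^{-1}\|\le C_K|\Im z|^{-N_K}$ for $z\in K\setminus\mathbb R$. Definition of $f(P)$ for $f\in\mathcal G$ and such $P$: $$f(P)=a_0\,1-\frac1\pi\int_{\mathbb C}\frac{\partial\tilde f}{\partial\bar z}(z)(z-P)^{-1}L(dz),$$ where $a_0=\lim_{|x|\to\infty}f(x)$, $L$ is Lebesgue measure, and $\tilde f$ is any bounded continuous extension of $f$ to $\mathbb C$ such that $\partial\tilde f/\partial\bar z$ has compact support and is $\mathcal O(|\Im z|^N)$ for every $N\in\mathbb N$; such an extension exists and the result does not depend on its choice. *)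

(* Defs.v *)
From HB Require Import structures.
From mathcomp Require Import all_boot all_order all_algebra.
From mathcomp Require Import complex.
From mathcomp Require Import all_classical all_reals all_analysis.

Set Implicit Arguments.
Unset Strict Implicit.
Unset Printing Implicit Defensive.

Import Order.TTheory GRing.Theory Num.Theory.
Import numFieldNormedType.Exports.

Local Open Scope classical_set_scope.
Local Open Scope complex_scope.
Local Open Scope ring_scope.

(* Norms of complex numbers and of vectors of a complex normed space live in
   R[i]; real bounds are injected by %:C and compared in the order of R[i],
   which restricts to the order of R on real values.  R[i]^o is R[i] seen as a
   normed space over itself, so that derivability of F : R[i]^o -> R[i]^o in
   direction 1 is complex differentiability. *)

Section FunctionSpace.
Variable R : realType.

Definition ReF (T : Type) (f : T -> R[i]) (x : T) : R := complex.Re (f x).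
Definition ImF (T : Type) (f : T -> R[i]) (x : T) : R := complex.Im (f x).

Definition smooth_line (f : R -> R[i]) : Prop :=
  forall (k : nat) (x : R),
    derivable (derive1n k (ReF f)) x 1 /\ derivable (derive1n k (ImF f)) x 1.

Definition line_deriv (k : nat) (f : R -> R[i]) (x : R) : R[i] :=
  derive1n k (ReF f) x +i* derive1n k (ImF f) x.

Definition test_line : set (R -> R[i]) :=
  [set f | smooth_line f /\ exists M : R, forall x, M < `|x| -> f x = 0].

Definition bounded_holo_ext (rho : R) (f : R -> R[i]) (F : R[i]^o -> R[i]^o) :=
  [/\ forall z, rho%:C < `|z| -> derivable F z 1,
      exists M : R, forall z, rho%:C < `|z| -> `|F z| <= M%:C
    & forall x : R, rho < `|x| -> F x%:C = f x].

Definition G_of (rho : R) : set (R -> R[i]) :=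
  [set f | smooth_line f /\ exists F, bounded_holo_ext rho f F].

Definition Gspace : set (R -> R[i]) :=
  [set f | exists2 rho : R, 0 < rho & G_of rho f].

Definition cvg_G_of (rho : R) (fn : nat -> R -> R[i]) (f : R -> R[i]) : Prop :=
  [/\ forall n, G_of rho (fn n),
      G_of rho f,
      forall (k : nat) (M e : R), 0 < e -> \forall n \near \oo,
        forall x, `|x| <= M -> `|line_deriv k (fn n) x - line_deriv k f x| <= e%:C
    & exists (Fn : nat -> R[i]^o -> R[i]^o) (F : R[i]^o -> R[i]^o),
        [/\ forall n, bounded_holo_ext rho (fn n) (Fn n),
            bounded_holo_ext rho f F
          & forall e : R, 0 < e -> \forall n \near \oo,
              forall z, rho%:C < `|z| -> `|Fn n z - F z| <= e%:C]].

Definition cvg_G (fn : nat -> R -> R[i]) (f : R -> R[i]) : Prop :=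
  exists2 rho : R, 0 < rho & cvg_G_of rho fn f.

Definition omega (z : R[i]) (x : R) : R[i] := (z - x%:C)^-1.
Definition xomega (z : R[i]) (x : R) : R[i] := x%:C / (z - x%:C).

(* The filter |x| -> oo on the real line. *)
Definition abs_pinfty : set_system R :=
  [set A | exists M : R, forall x, M < `|x| -> A x].

Definition lim_at_infty (f : R -> R[i]) : R[i] :=
  lim ((f : R -> R[i]^o) @ abs_pinfty).

End FunctionSpace.

Section Plane.
Variable R : realType.

(* The Lebesgue measure L(dz) on C is the product Lebesgue measure on R * R,
   C being identified with R * R by toC. *)
Local Notation R2 := (measurableTypeR R * measurableTypeR R)%type.

Definition toC (p : R * R) : R[i] := p.1 +i* p.2.

Definition lebesgue2 : {measure set R2 -> \bar R} :=
  (@lebesgue_measure R \x @lebesgue_measure R)%E.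

Definition integral2C (h : R * R -> R[i]) : R[i] :=
  (\int[lebesgue2]_p ReF h p) +i* (\int[lebesgue2]_p ImF h p).

Definition plane_deriv (v : R * R) (phi : R * R -> R[i]) (p : R * R) : R[i] :=
  'D_v (ReF phi) p +i* 'D_v (ImF phi) p.

Definition smooth_plane (phi : R * R -> R[i]) : Prop :=
  forall (vs : seq (R * R)) (p : R * R),
    let psi := foldr plane_deriv phi vs in
    differentiable (ReF psi) p /\ differentiable (ImF psi) p.

Definition test_plane : set (R * R -> R[i]) :=
  [set phi | smooth_plane phi /\
             exists M : R, forall p, M < `|p| -> phi p = 0].

Definition dbar (phi : R * R -> R[i]) (p : R * R) : R[i] :=
  2^-1 * (plane_deriv (1, 0) phi p + 'i * plane_deriv (0, 1) phi p).

(* g represents the distributional derivative of h with respect to zbar. *)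
Definition weak_dbar (h g : R[i] -> R[i]) : Prop :=
  forall phi, test_plane phi ->
    integral2C (fun p => h (toC p) * dbar phi p) =
    - integral2C (fun p => g (toC p) * phi p).

Definition measurableC (g : R[i] -> R[i]) : Prop :=
  measurable_fun [set: R2] (ReF (g \o toC)) /\
  measurable_fun [set: R2] (ImF (g \o toC)).

(* ft is an admissible extension of f and g is its zbar-derivative.  Since ft is
   only assumed continuous, the derivative is taken in the sense of
   distributions; that it is O(|Im z|^N) makes it a bounded function g. *)
Definition almost_holo_ext (f : R -> R[i]) (ft : R[i]^o -> R[i]^o)
    (g : R[i] -> R[i]) : Prop :=
  [/\ continuous ft,
      exists M : R, forall z, `|ft z| <= M%:C,
      forall x : R, ft x%:C = f x,
      weak_dbar ft g &
      [/\ measurableC g,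
          exists M : R, forall z, M%:C < `|z| -> g z = 0
        & forall N : nat, exists C : R, forall z,
            `|g z| <= (C * `|complex.Im z| ^+ N)%:C]].

End Plane.

Section Operators.
Variables (R : realType) (B : completeNormedModType R[i]).

Definition bounded_op (T : B -> B) : Prop := linear T /\ continuous T.

(* Convergence in operator norm. *)
Definition cvg_op (Tn : nat -> B -> B) (T : B -> B) : Prop :=
  forall e : R, 0 < e -> \forall n \near \oo,
    forall u, `|Tn n u - T u| <= e%:C * `|u|.

(* A simple function with values in the bounded operators is coded by the list
   of the pairs (A, T) of the terms 1_A T of which it is the sum. *)
Local Notation R2 := (measurableTypeR R * measurableTypeR R)%type.
Definition simple_op := seq (set R2 * (B -> B)).

Fixpoint simple_op_wf (s : simple_op) : Prop :=
  if s is (A, T) :: s' then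
    [/\ measurable A, (lebesgue2 R A < +oo)%E, bounded_op T & simple_op_wf s']
  else True.

Definition simple_op_val (s : simple_op) (p : R2) (u : B) : B :=
  \sum_(a <- s) (\1_(a.1) p : R)%:C *: a.2 u.

Definition simple_op_int (s : simple_op) (u : B) : B :=
  \sum_(a <- s) (fine (lebesgue2 R a.1))%:C *: a.2 u.

(* J is the Bochner integral over C of the operator-valued function F:
   simple functions s n converge to F in L^1 for the operator norm, and their
   integrals converge to J in operator norm.  The integrable function h n
   dominates the operator norm of F - s n, so that no measurability of the
   latter has to be assumed. *)
Definition bochner_integral (F : R[i] -> B -> B) (J : B -> B) : Prop :=
  exists (s : nat -> simple_op) (h : nat -> R2 -> R),
    [/\ forall n, simple_op_wf (s n),
        forall n, measurable_fun [set: R2] (h n) /\ forall p, 0 <= h n p,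
        forall n p u, `|F (toC p) u - simple_op_val (s n) p u| <= (h n p)%:C * `|u|,
        (\int[lebesgue2 R]_p (h n p)%:E)%E @[n --> \oo] --> (0 : \bar R)
      & cvg_op (fun n => simple_op_int (s n)) J].

(* An unbounded operator A on B is represented by its graph. *)
Definition is_resolvent (A : set (B * B)) (z : R[i]) (T : B -> B) : Prop :=
  [/\ bounded_op T,
      forall u, A (T u, z *: T u - u)
    & forall u w, A (u, w) -> T (z *: u - w) = u].

Definition resolvent (A : set (B * B)) (z : R[i]) : B -> B :=
  xget (fun=> 0) [set T | is_resolvent A z T].

(* T = f(A), the formula being required to hold, and its integral to exist, for
   every admissible extension of f. *)
Definition is_functional_calculus (A : set (B * B)) (f : R -> R[i])
    (T : B -> B) : Prop :=
  forall ft g, almost_holo_ext f ft g ->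
    exists2 J : B -> B,
      bochner_integral (fun z u => g z *: resolvent A z u) J
      & forall u, T u = lim_at_infty f *: u - (pi^-1)%:C *: J u.

Section Generated.
Variable Op : (R -> R[i]) -> B -> B.

Definition generated_op : set (B * B) :=
  [set p | exists (z : R[i]) (v : B), complex.Im z != 0 /\
             p = (Op (omega z) v, Op (xomega z) v)].

Definition span_of_test_ranges : set B :=
  [set u | exists (n : nat) (g : 'I_n -> R -> R[i]) (v : 'I_n -> B),
             (forall i, test_line (g i)) /\ u = \sum_i Op (g i) (v i)].

End Generated.

End Operators.

(* Main.v *)
Require Import Defs.
From HB Require Import structures.
From mathcomp Require Import all_boot all_order all_algebra.
From mathcomp Require Import complex.
From mathcomp Require Import all_classical all_reals all_analysis.
From mathcomp Require Import measurable_realfun.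
From mathcomp Require Import ring lra.

Set Implicit Arguments.
Unset Strict Implicit.
Unset Printing Implicit Defensive.

Import Order.TTheory GRing.Theory Num.Theory.
Import numFieldNormedType.Exports.

Local Open Scope classical_set_scope.
Local Open Scope complex_scope.
Local Open Scope ring_scope.

(* Cauchy-Pompeiu: testing the weak equation dbar ft = g against a cutoff of
   E_a - E_b, with E_a(z) = conj (z - a) / (|z - a|^2 + eps^2) a regularization
   of 1 / (z - a), gives pi (f a - f b) = - (H a - H b) for real a and b, where
   H(x) = int g(z) / (z - x) L(dz).  Only the difference E_a - E_b decays fast
   enough for the contribution of the cutoff to vanish.  As H tends to 0 at
   infinity, f = c - H / pi with c the limit of f at infinity.

   The factor g(z) vanishes to infinite order on the real axis, so that
   z |-> g(z) omega_z is uniformly approximated, in every seminorm of some G_R,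
   by functions of z with finitely many values.  By sequential continuity Op
   carries this over to the operator norm: the images of these step functions
   converge uniformly to g(z) (z - P)^-1 = Op (g(z) omega_z), and their
   integrals converge to Op H.  Hence Op f = c - Op H / pi. *)

(** Each real derivative of [omega z] costs one more power of 1 / |Im z|, and the flatness of [g]
    repays any number of them. The family [g z * omega z] is therefore bounded in every seminorm of
    one fixed space, that of radius M + 1 when [g] lives in |z| <= M. Since [g] is only measurable,
    closeness of z and z' says nothing about g z and g z'; the cells on which the step functions are
    constant have to control both. On the scalar side the poles a and b are real, exactly where [g]
    is flat, so the integrand of H is bounded and H makes sense at the pole. The zbar-derivative of
    a cutoff at scale n is O(1/n) on an area O(n^2): a kernel of size 1 / |z| would leave a term of
    order one, whereas E_a - E_b, of size 1 / |z|^2, leaves O(1/n). The price is that only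
    differences of values of f are obtained, so that its constant must be recovered at infinity. *)

Local Notation nc := Normc.normc.
Arguments Normc.normc : simpl never.

(** * Estimates for complex numbers *)

Section ComplexNorm.
Variable R : realType.
Implicit Types z w t u : R[i].

Lemma norm_nc z : `|z| = (nc z)%:C. Proof. by []. Qed.

Lemma nc_ge0 z : 0 <= nc z.
Proof. by case: z => a b; rewrite /Normc.normc sqrtr_ge0. Qed.

Lemma ncD z w : nc (z + w) <= nc z + nc w.
Proof. by rewrite -lecR rmorphD /= -!norm_nc ler_normD. Qed.

Lemma ncB z w : nc (z - w) <= nc z + nc w.
Proof. by rewrite -lecR rmorphD /= -!norm_nc ler_normB. Qed.

Lemma nc_distC z w : nc (z - w) = nc (w - z).
Proof. by apply: complexI; rewrite -!norm_nc distrC. Qed.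

Lemma ncX z m : nc (z ^+ m) = nc z ^+ m.
Proof. by apply: complexI; rewrite rmorphXn /= -!norm_nc normrX. Qed.

Lemma nc_real (x : R) : nc x%:C = `|x|.
Proof. by rewrite /Normc.normc /= expr0n addr0 sqrtr_sqr. Qed.

Lemma nc_nat n : nc (n%:R : R[i]) = n%:R.
Proof. by apply: complexI; rewrite -norm_nc normr_nat rmorph_nat. Qed.

Lemma ncN z : nc (- z) = nc z.
Proof. by apply: complexI; rewrite -!norm_nc normrN. Qed.

Lemma Re_nc z : `|complex.Re z| <= nc z.
Proof. by rewrite -lecR; exact: normc_ge_Re. Qed.

Lemma Im_nc z : `|complex.Im z| <= nc z.
Proof.
case: z => a b; rewrite /Normc.normc /= -sqrtr_sqr; apply: ler_wsqrtr.
by rewrite lerDr sqr_ge0.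
Qed.

Lemma nc_ReIm z : nc z <= `|complex.Re z| + `|complex.Im z|.
Proof.
case: z => a b; rewrite /Normc.normc /=.
rewrite -[leRHS]ger0_norm ?addr_ge0// -[leRHS]sqrtr_sqr; apply: ler_wsqrtr.
rewrite sqrrD !real_normK ?num_real// lerD2r lerDl mulrn_wge0// mulr_ge0.
Qed.

Lemma nc0 : nc (0 : R[i]) = 0. Proof. exact: Normc.normc0. Qed.

Lemma nc_eq0 z : nc z = 0 -> z = 0. Proof. exact: Normc.eq0_normc. Qed.

Lemma cReD z w : complex.Re (z + w) = complex.Re z + complex.Re w.
Proof. by case: z; case: w. Qed.

Lemma cImD z w : complex.Im (z + w) = complex.Im z + complex.Im w.
Proof. by case: z; case: w. Qed.

Lemma cReB z w : complex.Re (z - w) = complex.Re z - complex.Re w.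
Proof. by case: z; case: w. Qed.

Lemma cImB z w : complex.Im (z - w) = complex.Im z - complex.Im w.
Proof. by case: z; case: w. Qed.

Lemma cReMl (x : R) z : complex.Re (x%:C * z) = x * complex.Re z.
Proof. by case: z => a b /=; rewrite mul0r subr0. Qed.

Lemma cImMl (x : R) z : complex.Im (x%:C * z) = x * complex.Im z.
Proof. by case: z => a b /=; rewrite mul0r addr0. Qed.

Lemma cReM z w : complex.Re (z * w) =
  complex.Re z * complex.Re w - complex.Im z * complex.Im w.
Proof. by case: z; case: w. Qed.

Lemma cImM z w : complex.Im (z * w) =
  complex.Re z * complex.Im w + complex.Im z * complex.Re w.
Proof. by case: z; case: w. Qed.

Lemma ReIm_eq z w : complex.Re z = complex.Re w ->
  complex.Im z = complex.Im w -> z = w.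
Proof. by case: z => a b; case: w => c d /= -> ->. Qed.

End ComplexNorm.

(** * Taylor remainders for the powers of 1 / (z - w) *)

Section PowerEstimates.
Variable R : realType.
Implicit Types u v t : R[i].

(* With [u = 1/(z-w)] and [v = 1/(z-w')] one has [v - u = (w'-w) u v]. *)
Lemma pow_diff_le (r : R) u v t m : nc u <= r -> nc v <= r -> v - u = t * u * v ->
  nc (v ^+ m.+1 - u ^+ m.+1) <= m.+1%:R * nc t * r ^+ m.+2.
Proof.
move=> ur vr e; have r0 : 0 <= r by apply: le_trans ur; exact: nc_ge0.
elim: m => [|m IH].
  rewrite !expr1 e !Normc.normcM mul1r -mulrA ler_wpM2l ?nc_ge0// expr2.
  by rewrite ler_pM ?nc_ge0.
have -> : v ^+ m.+2 - u ^+ m.+2 = v * (v ^+ m.+1 - u ^+ m.+1) + (v - u) * u ^+ m.+1.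
  by rewrite !exprS; ring.
apply: le_trans (ncD _ _) _.
have -> : m.+2%:R * nc t * r ^+ m.+3 =
    r * (m.+1%:R * nc t * r ^+ m.+2) + nc t * r * r * r ^+ m.+1 :> R.
  by rewrite !exprS -[m.+2]addn1 natrD; ring.
apply: lerD.
  by rewrite Normc.normcM ler_pM ?nc_ge0.
rewrite e !Normc.normcM ncX.
by rewrite !ler_pM ?mulr_ge0 ?exprn_ge0 ?nc_ge0// lerXn2r ?nnegrE ?nc_ge0.
Qed.

(** Second-order remainder: [m.+1%:R * u ^+ m.+2] is the derivative of 1 / (z - w)^(m+1) in w. The
    constant is not sharp; with k = m + 1 it closes the induction because k^2 + (k + 1) <= (k +
    1)^2. *)
Lemma pow_diff2_le (r : R) u v t m : nc u <= r -> nc v <= r -> v - u = t * u * v ->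
  nc (v ^+ m.+1 - u ^+ m.+1 - m.+1%:R * t * u ^+ m.+2) <=
  (m.+1%:R ^+ 2) * r ^+ m.+3 * nc t ^+ 2.
Proof.
move=> ur vr e; have r0 : 0 <= r by apply: le_trans ur; exact: nc_ge0.
elim: m => [|m IH].
  have -> : v ^+ 1 - u ^+ 1 - 1 * t * u ^+ 2 = t * u * (v - u).
    rewrite !expr1; have -> : v - u - 1 * t * u ^+ 2 = t * u * v - t * u * u.
      by rewrite -e expr2; ring.
    by ring.
  rewrite e !Normc.normcM expr1n mul1r.
  have -> : r ^+ 3 * nc t ^+ 2 = nc t * r * (nc t * r * r) by ring.
  by rewrite !ler_pM ?mulr_ge0 ?nc_ge0.
have -> : v ^+ m.+2 - u ^+ m.+2 - m.+2%:R * t * u ^+ m.+3 =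
   u * (v ^+ m.+1 - u ^+ m.+1 - m.+1%:R * t * u ^+ m.+2) +
   t * u * (v ^+ m.+2 - u ^+ m.+2).
  have E1 : v ^+ m.+2 = u * v ^+ m.+1 + t * u * v ^+ m.+2.
    have ve : v = u + t * u * v by rewrite -e addrC subrK.
    rewrite (exprS v m.+1); move: (v ^+ m.+1) => w.
    by transitivity ((u + t * u * v) * w); [rewrite -ve | ring].
  by rewrite [in LHS]E1 !exprS -[m.+2]addn1 natrD; ring.
apply: le_trans (ncD _ _) _.
apply: (@le_trans _ _ (r * (m.+1%:R ^+ 2 * r ^+ m.+3 * nc t ^+ 2) +
   nc t * r * (m.+2%:R * nc t * r ^+ m.+3))).
  apply: lerD.
    by rewrite Normc.normcM ler_pM ?nc_ge0.
  rewrite !Normc.normcM ler_pM ?mulr_ge0 ?nc_ge0//.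
    by rewrite ler_wpM2l ?nc_ge0.
  exact: pow_diff_le.
have -> : r * (m.+1%:R ^+ 2 * r ^+ m.+3 * nc t ^+ 2) +
   nc t * r * (m.+2%:R * nc t * r ^+ m.+3) =
   (m.+1%:R ^+ 2 + m.+2%:R) * (r ^+ m.+4 * nc t ^+ 2) by rewrite !exprS; ring.
rewrite -[leRHS]mulrA ler_wpM2r//.
  by rewrite (mulr_ge0 (exprn_ge0 _ _) (exprn_ge0 _ _)) ?nc_ge0.
by rewrite -[m.+2]addn1 natrD; have := ler0n R m.+1; nra.
Qed.

End PowerEstimates.

Section QuadraticDerivative.
Variable K : numFieldType.

(** Stated over any [numFieldType] so that the same remainder estimate yields real derivatives on
    the line (K = R) and complex derivatives of the extension (K = R[i]). *)
Lemma quadratic_is_derive (f : K -> K) (x l C d : K) : 0 < d ->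
  (forall h, `|h| < d -> `|f (h + x) - f x - h * l| <= C * `|h| ^+ 2) ->
  is_derive (x : K^o) (1 : K^o) (f : K^o -> K^o) l.
Proof.
move=> d0 H.
have C0 : 0 <= C.
  have d2 : 0 < d / 2 by rewrite divr_gt0.
  have := H (d / 2); rewrite gtr0_norm// gtr_pMr// invf_lt1// ltr1n => /(_ isT) H'.
  have := le_trans (normr_ge0 _) H'.
  by rewrite pmulr_lge0// exprn_gt0.
have cv : (fun h : K => h^-1 *: ((f : K^o ->
  K^o) (h *: (1 : K^o) + x) - f x)) @ 0^' --> (l : K^o).
  apply/cvgrPdist_le => e e0.
  have C1 : 0 < C + 1 by rewrite ltr_wpDl.
  near=> h.
  have h0 : h != 0 by near: h; exact: nbhs_dnbhs_neq.
  have hd : `|h| < d by near: h; apply: dnbhs0_lt.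
  have he : `|h| < e / (C + 1) by near: h; apply: dnbhs0_lt; rewrite divr_gt0.
  have -> : l - h^-1 *: ((f : K^o -> K^o) (h *: (1 : K^o) + x) - f x) =
      - (h^-1 * (f (h + x) - f x - h * l)).
    rewrite (_ : h *: (1 : K^o) = h); last by rewrite /GRing.scale /= mulr1.
    by rewrite [h^-1 *: _]/GRing.scale /=; field.
  rewrite normrN normrM normfV ler_pdivrMl ?normr_gt0//.
  apply: le_trans (H h hd) _; rewrite expr2 mulrCA ler_wpM2l//.
  move: he; rewrite ltr_pdivlMr// => /ltW; apply: le_trans.
  by rewrite mulrC ler_wpM2l// lerDl.
apply: DeriveDef; first by apply/cvg_ex; exists l.
exact: cvg_lim cv.
Unshelve. all: by end_near.
Qed.

End QuadraticDerivative.

(** * Cauchy transforms as elements of G *)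

Section Jets.
Variables (R : realType) (rho : R).
Implicit Types (w z c : R[i]) (a b : nat -> R[i] -> R[i]) (C : nat -> R).

(** The seminorms of the space of radius [rho] look at the derivatives on the real line and at the
    extension outside the disc; one estimate on this union serves both. *)
Definition jet_dom : set R[i] := [set w | complex.Im w = 0 \/ rho < nc w].

(* [a m] plays the part of the [m]-th derivative divided by [m!], as in
   [a m w = 1 / (z - w) ^ (m + 1)]. *)
Definition is_jet C a := forall m,
  (forall w, jet_dom w -> nc (a m w) <= C m) /\
  (forall w w', jet_dom w -> jet_dom w' ->
    nc (a m w' - a m w - m.+1%:R * (w' - w) * a m.+1 w) <= C m * nc (w' - w) ^+ 2).

Definition jet_fun a (x : R) : R[i] := a 0 x%:C.

Lemma real_jet_dom (x : R) : jet_dom x%:C. Proof. by left. Qed.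

Lemma is_jet_lin c C a C' b : is_jet C a -> is_jet C' b ->
  is_jet (fun m => nc c * C m + C' m) (fun m w => c * a m w + b m w).
Proof.
move=> ja jb m; have [a1 a2] := ja m; have [b1 b2] := jb m; split => [w Dw|w w' Dw Dw'].
  apply: le_trans (ncD _ _) _; rewrite lerD ?b1//.
  by rewrite Normc.normcM ler_wpM2l ?nc_ge0 ?a1.
have -> : c * a m w' + b m w' - (c * a m w + b m w) -
    m.+1%:R * (w' - w) * (c * a m.+1 w + b m.+1 w) =
  c * (a m w' - a m w - m.+1%:R * (w' - w) * a m.+1 w) +
  (b m w' - b m w - m.+1%:R * (w' - w) * b m.+1 w) by ring.
apply: le_trans (ncD _ _) _; rewrite mulrDl lerD ?b2//.
by rewrite Normc.normcM -[leRHS]mulrA ler_wpM2l ?nc_ge0 ?a2.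
Qed.

Lemma is_jet_cst c : is_jet (fun=> nc c) (fun m _ => if m is 0 then c else 0).
Proof.
by case=> [|m]; split=> [w _|w w' _ _];
  rewrite ?(subrr, mulr0, subr0) ?nc0 ?mulr_ge0 ?exprn_ge0 ?nc_ge0.
Qed.

Lemma is_jet_le C C' a : (forall m, C m <= C' m) -> is_jet C a -> is_jet C' a.
Proof.
move=> CC' ja m; have [a1 a2] := ja m; split=> [w Dw|w w' Dw Dw'].
  by apply: le_trans (CC' m); exact: a1.
by apply: le_trans (a2 _ _ Dw Dw') _; rewrite ler_wpM2r ?exprn_ge0 ?nc_ge0.
Qed.

Definition kernel_const (q : R) (m : nat) : R := m.+1%:R ^+ 2 * q^-1 ^+ m.+3.

(** This is [pow_diff2_le] with r = 1/q. The bound q <= 1 makes q^-(m+1) at most q^-(m+3), so that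
    one constant fits both clauses of [is_jet]. *)
Lemma is_jet_kernel c z (q : R) : 0 < q <= 1 ->
  (forall w, jet_dom w -> q <= nc (z - w)) ->
  is_jet (fun m => nc c * kernel_const q m) (fun m w => c * (z - w)^-1 ^+ m.+1).
Proof.
move=> /andP[q0 q1] qD m.
have uq w : jet_dom w -> nc (z - w)^-1 <= q^-1.
  move=> Dw; rewrite Normc.normcV lef_pV2 ?posrE ?qD//.
  exact: lt_le_trans q0 (qD _ Dw).
have zw w : jet_dom w -> z - w != 0.
  move=> Dw; apply: contraTneq (qD _ Dw) => ->; rewrite nc0 -ltNge//.
split=> [w Dw|w w' Dw Dw'].
  rewrite Normc.normcM ler_wpM2l ?nc_ge0// ncX.
  apply: (@le_trans _ _ (q^-1 ^+ m.+1)).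
    by rewrite lerXn2r ?nnegrE ?nc_ge0 ?invr_ge0 ?(ltW q0) ?uq.
  rewrite -[leLHS]mul1r ler_pM ?exprn_ge0 ?invr_ge0 ?(ltW q0)//.
    by rewrite -natrX ler1n.
  by apply: ler_weXn2l; [rewrite invf_ge1 | exact: leqW (leqnSn _)].
have -> : c * (z - w')^-1 ^+ m.+1 - c * (z - w)^-1 ^+ m.+1 -
  m.+1%:R * (w' - w) * (c * (z - w)^-1 ^+ m.+2) =
  c * ((z - w')^-1 ^+ m.+1 - (z - w)^-1 ^+ m.+1 -
  m.+1%:R * (w' - w) * (z - w)^-1 ^+ m.+2) by ring.
rewrite Normc.normcM -[leRHS]mulrA ler_wpM2l ?nc_ge0//.
apply: pow_diff2_le; rewrite ?uq//.
by field; rewrite !zw.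
Qed.

Lemma jet_fun_derive C a k (x : R) : is_jet C a ->
  is_derive (x : R^o) (1 : R^o)
    ((fun y : R => complex.Re (k`!%:R * a k y%:C)) : R^o -> R^o)
    (complex.Re ((k.+1)`!%:R * a k.+1 x%:C)) /\
  is_derive (x : R^o) (1 : R^o)
    ((fun y : R => complex.Im (k`!%:R * a k y%:C)) : R^o -> R^o)
    (complex.Im ((k.+1)`!%:R * a k.+1 x%:C)).
Proof.
move=> ja; have [_ a2] := ja k.
have est (h : R) : nc (k`!%:R * a k (h + x)%:C - k`!%:R * a k x%:C -
    h%:C * ((k.+1)`!%:R * a k.+1 x%:C)) <= k`!%:R * C k * `|h| ^+ 2.
  have := a2 x%:C (h + x)%:C (real_jet_dom _) (real_jet_dom _).
  rewrite -rmorphB /= addrK nc_real => H.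
  have -> : k`!%:R * a k (h + x)%:C - k`!%:R * a k x%:C -
    h%:C * ((k.+1)`!%:R * a k.+1 x%:C) =
    k`!%:R * (a k (h + x)%:C - a k x%:C - k.+1%:R * h%:C * a k.+1 x%:C).
    by rewrite factS natrM; ring.
  by rewrite Normc.normcM nc_nat -[leRHS]mulrA ler_wpM2l.
have estRI (h : R) :
    `|complex.Re (k`!%:R * a k (h + x)%:C) - complex.Re (k`!%:R * a k x%:C) -
      h * complex.Re ((k.+1)`!%:R * a k.+1 x%:C)| <= k`!%:R * C k * `|h| ^+ 2 /\
    `|complex.Im (k`!%:R * a k (h + x)%:C) - complex.Im (k`!%:R * a k x%:C) -
      h * complex.Im ((k.+1)`!%:R * a k.+1 x%:C)| <= k`!%:R * C k * `|h| ^+ 2.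
  by split; apply: le_trans (est h); rewrite -(cReMl, cImMl) -!(cReB, cImB) (Re_nc,
    Im_nc).
split; apply: (@quadratic_is_derive _ _ _ _ (k`!%:R * C k) 1) => // h _.
  exact: (estRI h).1.
exact: (estRI h).2.
Qed.

Lemma jet_derive1n C a k : is_jet C a ->
  derive1n k (ReF (jet_fun a)) = (fun x => complex.Re (k`!%:R * a k x%:C)) /\
  derive1n k (ImF (jet_fun a)) = (fun x => complex.Im (k`!%:R * a k x%:C)).
Proof.
move=> ja; elim: k => [|k [IH1 IH2]].
  by split; apply/funext => x; rewrite mul1r.
rewrite !derive1nS IH1 IH2; split; apply/funext => x; rewrite derive1E.
  by have [/@derive_val] := jet_fun_derive k x ja.
by have [_ /@derive_val] := jet_fun_derive k x ja.
Qed.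

Lemma jet_line_deriv C a k x : is_jet C a ->
  line_deriv k (jet_fun a) x = k`!%:R * a k x%:C.
Proof.
move=> ja; rewrite /line_deriv; have [-> ->] := jet_derive1n k ja.
by case: (_ * _).
Qed.

Lemma jet_smooth C a : is_jet C a -> smooth_line (jet_fun a).
Proof.
move=> ja k x; have [-> ->] := jet_derive1n k ja.
by have [[d1 _] [d2 _]] := jet_fun_derive k x ja.
Qed.

Lemma jet_holo C a : is_jet C a -> bounded_holo_ext rho (jet_fun a) (a 0).
Proof.
move=> ja; have [a1 a2] := ja 0; split=> [z||//].
- rewrite norm_nc ltcR => zr.
  have d0 : 0 < ((nc z - rho)%:C : R[i]) by rewrite ltcR subr_gt0.
  suff : is_derive (z : R[i]^o) (1 : R[i]^o) (a 0 : R[i]^o -> R[i]^o) (a 1%N z) by case.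
  apply: (@quadratic_is_derive _ _ _ _ (C 0)%:C _ d0) => h.
  rewrite !norm_nc ltcR => hd.
  have Dh : jet_dom (h + z).
    right; have : nc z <= nc (h + z) + nc h.
      by apply: le_trans (ncB _ _); rewrite addrAC subrr add0r.
    by move: hd; lra.
  rewrite -rmorphXn -rmorphM lecR.
  by have := a2 z (h + z) (or_intror zr) Dh; rewrite addrK mul1r.
- exists (C 0) => z; rewrite !norm_nc ltcR => zr; rewrite lecR a1//; by right.
Qed.

Lemma jet_G_of C a : is_jet C a -> G_of rho (jet_fun a).
Proof.
move=> ja; split; first exact: jet_smooth ja.
by exists (a 0); exact: jet_holo ja.
Qed.

(** Uniform convergence of each order on [jet_dom] gives the derivatives on the line (up to k!) and,
    at order 0, the sup norm of the extension. The constants of the approximants may depend on n,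
    since only their limit is estimated. *)
Lemma jet_cvg (Cn : nat -> nat -> R) (an : nat -> nat -> R[i] -> R[i]) C a :
  (forall n, is_jet (Cn n) (an n)) -> is_jet C a ->
  (forall m (e : R), 0 < e -> \forall n \near \oo,
     forall w, jet_dom w -> nc (an n m w - a m w) <= e) ->
  cvg_G_of rho (fun n => jet_fun (an n)) (jet_fun a).
Proof.
move=> jan ja cv; split.
- by move=> n; exact: jet_G_of (jan n).
- exact: jet_G_of ja.
- move=> k M e e0.
  have := cv k (e / k`!%:R); rewrite divr_gt0 ?ltr0n ?fact_gt0// => /(_ isT).
  apply: filterS => n H x _.
  rewrite (jet_line_deriv k x (jan n)) (jet_line_deriv k x ja) -mulrBr norm_nc lecR.
  rewrite Normc.normcM nc_nat mulrC -ler_pdivlMr ?ltr0n ?fact_gt0//.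
  exact/H/real_jet_dom.
- exists (fun n => an n 0), (a 0); split=> [n||e e0].
  + exact: jet_holo (jan n).
  + exact: jet_holo ja.
  + have := cv 0%N e e0; apply: filterS => n H z; rewrite !norm_nc ltcR => zr.
    by rewrite lecR H//; right.
Qed.

End Jets.

(** * Kernels weighted by a function that is flat on the real axis *)

Section WeightedKernel.
Variables (R : realType) (g : R[i] -> R[i]) (M : R) (Cg : nat -> R).
Implicit Types (z w : R[i]) (m N : nat) (e : R).

(** For |z| <= M this bounds from below the distance from z to all of [jet_dom (M + 1)]: the real
    axis is at |Im z|, the exterior region at least at 1. *)
Definition axis_dist z : R := Num.min `|complex.Im z| 1.

Hypothesis gM : forall z, M < nc z -> g z = 0.
Hypothesis gC : forall N z, nc (g z) <= Cg N * axis_dist z ^+ N.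

Local Notation D := (jet_dom (M + 1)).
Local Notation q := axis_dist.

Lemma axis_dist_ge0 z : 0 <= q z.
Proof. by rewrite le_min normr_ge0 ler01. Qed.

Lemma axis_dist_le1 z : q z <= 1.
Proof. by rewrite ge_min lexx orbT. Qed.

Lemma axis_dist_le z w : nc z <= M -> D w -> q z <= nc (z - w).
Proof.
move=> zM [w0|wM].
  rewrite ge_min; apply/orP; left; apply: le_trans (Im_nc _).
  by rewrite cImB w0 subr0.
rewrite ge_min; apply/orP; right.
have : nc w <= nc z + nc (z - w).
  by apply: le_trans (ncB _ _); rewrite opprB addrC subrK.
by move: zM wM; lra.
Qed.

Lemma weight_ge0 N : 0 <= Cg N.
Proof.
(* At ['i] the truncated distance is 1, so the bound there is [Cg N] itself. *)
have := gC N 'i; rewrite /q /= normr1 minxx expr1n mulr1.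
by apply: le_trans; exact: nc_ge0.
Qed.

Lemma weight0 z : q z = 0 -> g z = 0.
Proof.
move=> q0; apply: nc_eq0; apply/eqP; rewrite eq_le nc_ge0 andbT.
by apply: le_trans (gC 1 z) _; rewrite q0 expr1 mulr0.
Qed.

Lemma real_weight0 z : complex.Im z = 0 -> g z = 0.
Proof. by move=> z0; apply: weight0; rewrite /q z0 normr0 min_l. Qed.

Definition wkernel m z w : R[i] := g z * (z - w)^-1 ^+ m.+1.

Definition wkernel_const m : R := m.+1%:R ^+ 2 * Cg m.+3.

Lemma weight_pow_le N z : 0 < q z -> nc (g z) * (q z)^-1 ^+ N <= Cg N.
Proof.
move=> q0; rewrite exprVn ler_pdivrMr ?exprn_gt0//; exact: gC.
Qed.

(** What matters is that the constants are independent of z: vanishing of order m + 3 of [g] absorbs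
    the factor q^-(m+3) of [kernel_const]. *)
Lemma is_jet_wkernel z : is_jet (M + 1) wkernel_const (fun m w => wkernel m z w).
Proof.
have c0 m : 0 <= wkernel_const m by rewrite mulr_ge0 ?exprn_ge0 ?weight_ge0.
have [g0|gN0] := eqVneq (g z) 0.
  move=> m; rewrite /wkernel g0; split=> [w _|w w' _ _]; first by rewrite mul0r nc0.
  by rewrite !mul0r mulr0 !subr0 nc0 mulr_ge0 ?exprn_ge0 ?nc_ge0.
have zM : nc z <= M by rewrite leNgt; apply: contra gN0 => /gM ->.
have q0 : 0 < q z.
  by rewrite lt_neqAle axis_dist_ge0 andbT eq_sym; apply: contra gN0 => /eqP/weight0 ->.
apply: is_jet_le (is_jet_kernel (q := q z) (z := z) (g z) _ _).
- move=> m; rewrite /kernel_const mulrCA ler_wpM2l ?exprn_ge0//.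
  exact: weight_pow_le.
- by rewrite q0 axis_dist_le1.
- by move=> w; exact: axis_dist_le.
Qed.

Lemma wkernel_le m z w : D w -> nc (wkernel m z w) <= wkernel_const m.
Proof. exact: (is_jet_wkernel z m).1. Qed.

(* If [z'] is the point farther from the axis, and [q z'] its distance, then
   [|g z - g z'|] is at most [eta] as well as [2 C (q z')^(2m+2)]; the product of
   these bounds controls the square of [|g z - g z'| / (q z')^(m+1)]. *)
Lemma wkernel_equicont m e : 0 < e -> exists2 eta : R, 0 < eta &
  forall z z' w, nc z <= M -> nc z' <= M -> nc (z - z') <= eta ->
    nc (g z - g z') <= eta -> D w -> nc (wkernel m z w - wkernel m z' w) <= e.
Proof.
move=> e0.
pose a := m.+1%:R * Cg m.+2; pose b := 2 * Cg (m.+1 + m.+1).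
have a0 : 0 <= a by rewrite mulr_ge0 ?weight_ge0.
have b0 : 0 <= b by rewrite mulr_ge0 ?weight_ge0.
pose eta := Num.min (e / 2 / (a + 1)) ((e / 2) ^+ 2 / (b + 1)).
have a1 : 0 < a + 1 by rewrite ltr_wpDl.
have b1 : 0 < b + 1 by rewrite ltr_wpDl.
have eta0 : 0 < eta.
  by rewrite lt_min !divr_gt0 ?exprn_gt0 ?divr_gt0.
have aeta : a * eta <= e / 2.
  apply: (@le_trans _ _ ((a + 1) * eta)).
    by rewrite ler_wpM2r ?lerDl // ltW.
  by rewrite mulrC -ler_pdivlMr// ge_min lexx.
have beta : b * eta <= (e / 2) ^+ 2.
  apply: (@le_trans _ _ ((b + 1) * eta)).
    by rewrite ler_wpM2r ?lerDl // ltW.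
  by rewrite mulrC -ler_pdivlMr// ge_min lexx orbT.
exists eta => //.
suff main z z' w : q z <= q z' -> nc z <= M -> nc z' <= M -> nc (z - z') <= eta ->
    nc (g z - g z') <= eta -> D w -> nc (wkernel m z w - wkernel m z' w) <= e.
  move=> z z' w zM zM' zz gg Dw; have [qq|/ltW qq] := leP (q z) (q z').
    exact: main.
  by rewrite nc_distC; apply: main => //; rewrite nc_distC.
move=> qq zM zM' zz gg Dw.
have [q0|qN0] := eqVneq (q z') 0.
  have qz : q z = 0 by apply/eqP; rewrite eq_le axis_dist_ge0 andbT -q0.
  by rewrite /wkernel !weight0// !mul0r subr0 nc0 ltW.
have q'0 : 0 < q z' by rewrite lt_neqAle eq_sym qN0 axis_dist_ge0.
have u' : nc (z' - w)^-1 <= (q z')^-1.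
  rewrite Normc.normcV lef_pV2 ?posrE ?axis_dist_le//.
  exact: lt_le_trans q'0 (axis_dist_le zM' Dw).
have zw' : z' - w != 0.
  apply: contraTneq (axis_dist_le zM' Dw) => ->.
  by rewrite nc0 -ltNge.
have -> : wkernel m z w - wkernel m z' w =
  g z * ((z - w)^-1 ^+ m.+1 - (z' - w)^-1 ^+ m.+1) +
  (g z - g z') * (z' - w)^-1 ^+ m.+1 by rewrite /wkernel; ring.
rewrite (splitr e); apply: le_trans (ncD _ _) (lerD _ _).
  have [qz0|qzN0] := eqVneq (q z) 0.
    by rewrite (weight0 qz0) mul0r nc0 divr_ge0 ?ltW.
  have qz0 : 0 < q z by rewrite lt_neqAle eq_sym qzN0 axis_dist_ge0.
  have u : nc (z - w)^-1 <= (q z)^-1.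
    rewrite Normc.normcV lef_pV2 ?posrE ?axis_dist_le//.
    exact: lt_le_trans qz0 (axis_dist_le zM Dw).
  have zw : z - w != 0.
    apply: contraTneq (axis_dist_le zM Dw) => ->.
    by rewrite nc0 -ltNge.
  (* As z is the point nearer the axis, (q z)^-1 bounds both kernels; [pow_diff_le] then costs m + 2
     powers of it, which the vanishing of [g z] supplies. *)
  have u'' : nc (z' - w)^-1 <= (q z)^-1.
    by apply: le_trans u' _; rewrite lef_pV2.
  rewrite Normc.normcM; apply: le_trans _ aeta.
  have := @pow_diff_le R _ _ _ (z' - z) m u'' u.
  have -> : (z - w)^-1 - (z' - w)^-1 = (z' - z) * (z' - w)^-1 / (z - w).
    by field; rewrite zw zw'.
  move=> /(_ erefl) H.
  apply: le_trans (ler_wpM2l (nc_ge0 _) H) _.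
  have -> : nc (g z) * (m.+1%:R * nc (z' - z) * (q z)^-1 ^+ m.+2) =
    m.+1%:R * (nc (g z) * (q z)^-1 ^+ m.+2) * nc (z' - z) by ring.
  have p0 : 0 <= (q z)^-1 ^+ m.+2 by rewrite exprn_ge0// invr_ge0 ltW.
  apply: ler_pM; rewrite ?nc_ge0//.
    by rewrite (mulr_ge0 _ (mulr_ge0 (nc_ge0 _) p0)).
    by rewrite ler_wpM2l// weight_pow_le.
  by rewrite nc_distC.
rewrite Normc.normcM ncX.
have r0 : 0 <= (q z')^-1 by rewrite invr_ge0 ltW.
set X := _ * _.
have X0 : 0 <= X by rewrite (mulr_ge0 (nc_ge0 _))// exprn_ge0 ?nc_ge0.
suff XX : X ^+ 2 <= (e / 2) ^+ 2.
  by move: XX; rewrite ler_sqr// nnegrE divr_ge0 ?ltW.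
apply: le_trans _ beta; rewrite exprMn expr2.
apply: (@le_trans _ _ ((b * q z' ^+ (m.+1 + m.+1)) * eta * ((q z')^-1 ^+ (m.+1 + m.+1)))).
  rewrite ler_pM ?mulr_ge0 ?exprn_ge0 ?nc_ge0//.
    rewrite ler_pM ?nc_ge0//; apply: le_trans (ncB _ _) _.
    rewrite /b -mulrA mulr_natl mulr2n lerD//;
      apply: le_trans (gC (m.+1 + m.+1) _) _ => //.
    by rewrite ler_wpM2l ?weight_ge0// lerXn2r ?nnegrE ?axis_dist_ge0.
  by rewrite exprD -expr2 lerXn2r ?nnegrE ?exprn_ge0 ?nc_ge0// lerXn2r ?nnegrE ?nc_ge0.
by rewrite exprVn mulrAC mulfK ?expf_neq0.
Qed.

End WeightedKernel.

(** * Complex-valued integrals over the plane *)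

Section MeasurableComplex.
Context d (T : measurableType d) (R : realType).
Implicit Types (h k : T -> R[i]).

Definition mfunC h := measurable_fun [set: T] (ReF h) /\ measurable_fun [set: T] (ImF h).

Lemma mfunC_cst c : mfunC (fun=> c).
Proof. by split; exact: measurable_cst. Qed.

Lemma mfunCD h k : mfunC h -> mfunC k -> mfunC (fun p => h p + k p).
Proof.
move=> [h1 h2] [k1 k2]; split.
- rewrite (_ : ReF _ = ReF h \+ ReF k); first exact: measurable_funD.
  by apply/funext => p; rewrite /ReF cReD.
- rewrite (_ : ImF _ = ImF h \+ ImF k); first exact: measurable_funD.
  by apply/funext => p; rewrite /ImF cImD.
Qed.

Lemma mfunCM h k : mfunC h -> mfunC k -> mfunC (fun p => h p * k p).
Proof.
move=> [h1 h2] [k1 k2]; split.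
- rewrite (_ : ReF _ = (ReF h \* ReF k) \- (ImF h \* ImF k)).
    by apply: measurable_funB; exact: measurable_funM.
  by apply/funext => p; rewrite /ReF cReM.
- rewrite (_ : ImF _ = (ReF h \* ImF k) \+ (ImF h \* ReF k)).
    by apply: measurable_funD; exact: measurable_funM.
  by apply/funext => p; rewrite /ImF cImM.
Qed.

Lemma mfunCN h : mfunC h -> mfunC (fun p => - h p).
Proof.
move=> mh; rewrite (_ : (fun p => - h p) = (fun p => -1 * h p)).
  exact/mfunCM/mh/mfunC_cst.
by apply/funext => p; rewrite mulN1r.
Qed.

Lemma mfunCB h k : mfunC h -> mfunC k -> mfunC (fun p => h p - k p).
Proof. by move=> mh mk; apply: mfunCD => //; exact: mfunCN. Qed.

Lemma mfunCX h n : mfunC h -> mfunC (fun p => h p ^+ n).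
Proof.
move=> mh; elim: n => [|n IH]; first exact: mfunC_cst.
by under eq_fun do rewrite exprS; exact: mfunCM.
Qed.

Lemma mfunC_real (f : T -> R) : measurable_fun [set: T] f -> mfunC (fun p => (f p)%:C).
Proof. by move=> mf; split=> //; exact: measurable_cst. Qed.

(** The power function [powR] with exponent -1 is measurable and agrees with the inverse on
    nonnegative reals, including 0^-1 = 0. *)
Lemma mfun_inv_ge0 (f : T -> R) : (forall p, 0 <= f p) ->
  measurable_fun [set: T] f -> measurable_fun [set: T] (fun p => (f p)^-1).
Proof.
move=> f0 mf.
rewrite (_ : (fun p => _) = (@powR R ^~ (-1)) \o f).
  by apply: measurableT_comp mf; exact: measurable_powR.
by apply/funext => p /=; rewrite powR_inv1.
Qed.

(** With 0^-1 = 0, the formula conj h / |h|^2 is valid at the zeros of h as well; this covers the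
    kernel at its pole. *)
Lemma mfunC_inv h : mfunC h -> mfunC (fun p => (h p)^-1).
Proof.
move=> [h1 h2].
pose n2 p := ReF h p ^+ 2 + ImF h p ^+ 2.
have mn : measurable_fun [set: T] (fun p => (n2 p)^-1).
  apply: mfun_inv_ge0 => [p|]; first by rewrite addr_ge0 ?sqr_ge0.
  by apply: measurable_funD; exact: measurable_funX.
split.
- rewrite (_ : ReF _ = ReF h \* (fun p => (n2 p)^-1)); first exact: measurable_funM.
  by apply/funext => p; rewrite /n2 /ReF /ImF /=; case: (h p) => a b.
- rewrite (_ : ImF _ = \- (ImF h \* (fun p => (n2 p)^-1))).
    by apply: measurable_funN; exact: measurable_funM.
  by apply/funext => p; rewrite /n2 /ReF /ImF /=; case: (h p) => a b /=.
Qed.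

Lemma mfunC_nc h : mfunC h -> measurable_fun [set: T] (fun p => nc (h p)).
Proof.
move=> [h1 h2]; rewrite (_ : (fun p => _) =
   (@powR R ^~ (2^-1)) \o (fun p => ReF h p ^+ 2 + ImF h p ^+ 2)).
  apply: measurableT_comp; first exact: measurable_powR.
  by apply: measurable_funD; exact: measurable_funX.
apply/funext => p /=; rewrite powR12_sqrt ?addr_ge0 ?sqr_ge0//.
by rewrite /ReF /ImF; case: (h p).
Qed.

End MeasurableComplex.

Section PlaneIntegral.
Variable R : realType.
Local Notation R2 := (measurableTypeR R * measurableTypeR R)%type.
Local Notation mu := (lebesgue2 R).
Implicit Types (h k : R2 -> R[i]) (b : R2 -> R) (c : R[i]).

Lemma mfunC_toC : mfunC (@toC R : R2 -> R[i]).
Proof. by split; [exact: measurable_fst|exact: measurable_snd]. Qed.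

Definition intgC h := mu.-integrable setT (EFin \o ReF h) /\
  mu.-integrable setT (EFin \o ImF h).

Lemma mu_integrable_le (f b : R2 -> R) : measurable_fun [set: R2] f ->
  (forall p, `|f p| <= b p) -> mu.-integrable setT (EFin \o b) ->
  mu.-integrable setT (EFin \o f).
Proof.
move=> mf fb; apply: le_integrable => //; first exact/measurable_EFinP.
move=> p _ /=; rewrite lee_fin; apply: le_trans (fb p) _.
exact: ler_norm.
Qed.

Lemma intgC_dom h b : mfunC h -> (forall p, nc (h p) <= b p) ->
  mu.-integrable setT (EFin \o b) -> intgC h.
Proof.
move=> [h1 h2] hb ib; split; apply: mu_integrable_le ib => // p.
- exact: le_trans (Re_nc _) (hb p).
- exact: le_trans (Im_nc _) (hb p).
Qed.

(** The factor 2 comes from estimating the real and imaginary parts separately; every later choice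
    of constants leaves room for it. *)
Lemma integral2C_le h b : mfunC h -> (forall p, nc (h p) <= b p) ->
  mu.-integrable setT (EFin \o b) -> nc (integral2C h) <= 2 * \int[mu]_p b p.
Proof.
move=> mh hb ib; have [i1 i2] := intgC_dom mh hb ib.
apply: le_trans (nc_ReIm _) _; rewrite mulr_natl mulr2n /=; apply: lerD.
- apply: le_trans (le_normr_Rintegral _ i1) _ => //; apply: le_Rintegral => //.
    exact: integrable_norm.
  by move=> p _ ; apply: le_trans (Re_nc _) (hb p).
- apply: le_trans (le_normr_Rintegral _ i2) _ => //; apply: le_Rintegral => //.
    exact: integrable_norm.
  by move=> p _ ; apply: le_trans (Im_nc _) (hb p).
Qed.

Lemma intgCD h k : intgC h -> intgC k -> intgC (fun p => h p + k p).
Proof.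
move=> [h1 h2] [k1 k2]; split.
- rewrite (_ : _ \o _ = (EFin \o ReF h) \+ (EFin \o ReF k))%E; first exact: integrableD.
  by apply/funext => p /=; rewrite /ReF cReD.
- rewrite (_ : _ \o _ = (EFin \o ImF h) \+ (EFin \o ImF k))%E; first exact: integrableD.
  by apply/funext => p /=; rewrite /ImF cImD.
Qed.

Lemma integral2CD h k : intgC h -> intgC k ->
  integral2C (fun p => h p + k p) = integral2C h + integral2C k.
Proof.
move=> [h1 h2] [k1 k2]; apply: ReIm_eq => /=.
- rewrite -RintegralD//; congr Rintegral; apply/funext => p.
  by rewrite /ReF cReD.
- rewrite -RintegralD//; congr Rintegral; apply/funext => p.
  by rewrite /ImF cImD.
Qed.

Lemma RintegralZ (a : R) (f : R2 -> R) : mu.-integrable setT (EFin \o f) ->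
  mu.-integrable setT (EFin \o (fun p => a * f p)) /\
  \int[mu]_p (a * f p) = a * \int[mu]_p f p.
Proof.
move=> fi; split; last by rewrite RintegralZl.
rewrite (_ : _ \o _ = fun p => (a%:E * (EFin \o f) p)%E); first exact: integrableZl.
by apply/funext => p /=; rewrite EFinM.
Qed.

Lemma intgCZ c h : intgC h -> intgC (fun p => c * h p) /\
  integral2C (fun p => c * h p) = c * integral2C h.
Proof.
move=> [h1 h2].
have [r1 e1] := RintegralZ (complex.Re c) h1.
have [r2 e2] := RintegralZ (complex.Re c) h2.
have [r3 e3] := RintegralZ (complex.Im c) h1.
have [r4 e4] := RintegralZ (- complex.Im c) h2.
have eR : ReF (fun p => c * h p) =
   (fun p => complex.Re c * ReF h p + (- complex.Im c) * ImF h p).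
  by apply/funext => p; rewrite /ReF cReM mulNr.
have eI : ImF (fun p => c * h p) =
   (fun p => complex.Re c * ImF h p + complex.Im c * ReF h p).
  by apply/funext => p; rewrite /ImF cImM.
split.
  split; rewrite ?eR ?eI.
  - exact: (integrableD measurableT r1 r4).
  - exact: (integrableD measurableT r2 r3).
apply: ReIm_eq; rewrite ?cReM ?cImM /= ?eR ?eI RintegralD//.
- by rewrite e1 e4 mulNr.
- by rewrite e2 e3.
Qed.

Lemma intgCB h k : intgC h -> intgC k -> intgC (fun p => h p - k p) /\
  integral2C (fun p => h p - k p) = integral2C h - integral2C k.
Proof.
move=> ih ik; have [ik' ek'] := intgCZ (-1) ik.
have -> : (fun p => h p - k p) = (fun p => h p + -1 * k p).
  by apply/funext => p; rewrite mulN1r.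
by split; [exact: intgCD|rewrite integral2CD// ek' mulN1r].
Qed.

Lemma integral2C_cvg (hn : nat -> R2 -> R[i]) h b :
  (forall n, mfunC (hn n)) -> mfunC h -> (forall n p, nc (hn n p) <= b p) ->
  mu.-integrable setT (EFin \o b) ->
  (forall p e, 0 < e -> \forall n \near \oo, nc (hn n p - h p) <= e) ->
  forall e : R, 0 < e -> \forall n \near \oo,
    nc (integral2C (hn n) - integral2C h) <= e.
Proof.
move=> mhn mh hb ib cv.
have hbl p : nc (h p) <= b p.
  apply/ler_addgt0Pr => e e0; have [N _ /(_ N (leqnn N))] := cv p e e0.
  have := hb N p; have : nc (h p) <= nc (hn N p) + nc (hn N p - h p).
    by apply: le_trans (ncB _ _); rewrite opprB addrC subrK.
  lra.
have key (f : nat -> R2 -> R) (f0 : R2 -> R) :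
    (forall n, measurable_fun setT (f n)) -> measurable_fun setT f0 ->
    (forall n p, `|f n p - f0 p| <= nc (hn n p - h p)) ->
    (forall n p, `|f n p| <= b p) -> (forall p, `|f0 p| <= b p) ->
    forall e : R, 0 < e -> \forall n \near \oo,
      `|\int[mu]_p f n p - \int[mu]_p f0 p| <= e.
  move=> mf mf0 ff fb f0b e e0.
  have [] := @dominated_convergence _ _ _ mu setT measurableT
    (fun n => EFin \o f n) (EFin \o f0) (EFin \o b).
  - by move=> n; exact/measurable_EFinP.
  - exact/measurable_EFinP.
  - apply: aeW => p _; apply: cvg_EFin; first exact: nearW.
    apply/cvgrPdist_le => e' e'0; have := cv p e' e'0.
    by apply: filterS => n H /=; rewrite distrC; apply: le_trans (ff n p) H.
  - exact: ib.
  - by apply: aeW => p n _ /=; rewrite lee_fin.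
  move=> _ _ H.
  have i0 := mu_integrable_le mf0 f0b ib.
  have : (fine \o (fun n => \int[mu]_(x in setT) (EFin \o f n) x))%E @ \oo -->
      fine (\int[mu]_(x in setT) (EFin \o f0) x)%E.
    apply: fine_cvg; rewrite fineK//; exact: integrable_fin_num.
  move=> /cvgrPdist_le /(_ _ e0); apply: filterS => n.
  by rewrite distrC.
move=> e e0; have e2 : 0 < e / 2 by rewrite divr_gt0.
have k1 := key (fun n => ReF (hn n)) (ReF h) (fun n => (mhn n).1) mh.1.
have k2 := key (fun n => ImF (hn n)) (ImF h) (fun n => (mhn n).2) mh.2.
have : \forall n \near \oo, `|\int[mu]_p ReF (hn n) p - \int[mu]_p ReF h p| <= e / 2.
  apply: k1 => //.
  - by move=> n p; rewrite /ReF -cReB Re_nc.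
  - by move=> n p; apply: le_trans (Re_nc _) (hb n p).
  - by move=> p; apply: le_trans (Re_nc _) (hbl p).
have : \forall n \near \oo, `|\int[mu]_p ImF (hn n) p - \int[mu]_p ImF h p| <= e / 2.
  apply: k2 => //.
  - by move=> n p; rewrite /ImF -cImB Im_nc.
  - by move=> n p; apply: le_trans (Im_nc _) (hb n p).
  - by move=> p; apply: le_trans (Im_nc _) (hbl p).
apply: filterS2 => n I1 I2.
by apply: le_trans (nc_ReIm _) _; rewrite cReB cImB (splitr e) lerD.
Qed.

Definition disc (r : R) : set R2 := [set p | nc (toC p) <= r].

Lemma measurable_disc r : measurable (disc r).
Proof.
have mf : measurable_fun [set: R2] (fun p => nc (toC p) <= r).
  by apply: measurable_fun_ler; [exact: mfunC_nc mfunC_toC|exact: measurable_cst].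
rewrite (_ : disc r = [set: R2] `&` (fun p => nc (toC p) <= r) @^-1` [set true]).
  exact: mf.
by rewrite setTI; apply/seteqP; split.
Qed.

Definition box (r : R) : set R2 := `[- r, r]%classic `*` `[- r, r]%classic.

Lemma measurable_box r : measurable (box r).
Proof. by apply: measurableX; exact: measurable_itv. Qed.

Lemma mu_box_fin (r : R) : (mu (box r) < +oo)%E.
Proof.
have -> : mu (box r) = (lebesgue_measure `[(- r)%R, r]%classic *
    lebesgue_measure `[(- r)%R, r]%classic)%E.
  by apply: product_measure1E; exact: measurable_itv.
by rewrite !lebesgue_measure_itv; case: ifPn => _ //; rewrite ?mule0// -EFinB -EFinM ltry.
Qed.

Lemma mu_disc_fin r : (mu (disc r) < +oo)%E.
Proof.
apply: le_lt_trans (mu_box_fin r); apply: le_measure; rewrite ?inE.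
- exact: measurable_disc.
- exact: measurable_box.
move=> p pr; split => /=; rewrite in_itv /= -ler_norml; apply: le_trans pr.
  exact: (Re_nc (toC p)).
exact: (Im_nc (toC p)).
Qed.

Lemma integrable_indic_fin (A : set R2) (a : R) : measurable A -> (mu A < +oo)%E ->
  mu.-integrable setT (EFin \o (fun p => a * \1_A p)) /\
  \int[mu]_p (a * \1_A p) = a * fine (mu A).
Proof.
move=> mA fA; have iA : mu.-integrable setT (EFin \o (\1_A : R2 -> R)).
  apply/integrableP; split; first exact/measurable_EFinP/measurable_indic.
  under eq_integral do rewrite /= ger0_norm//.
  by rewrite integral_indic// setIT.
have [? ->] := RintegralZ a iA; split => //.
by rewrite /Rintegral integral_indic// setIT.
Qed.

End PlaneIntegral.

(** * Step functions *)

Section Labels.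
Context d (T : measurableType d) (R : realType).
Implicit Types (a : T -> R[i]) (Q : set T).

(** The fibres of [lab] are a finite measurable partition adapted to the closeness relation S.
    Labels rather than sets make it easy to meet two relations at once, by pairing. *)
Definition has_labels Q (S : T -> T -> R -> Prop) := forall eta : R, 0 < eta ->
  exists (L : finType) (lab : T -> L), (forall l, measurable (lab @^-1` [set l])) /\
    forall p p', Q p -> Q p' -> lab p = lab p' -> S p p' eta.

Lemma has_labels_real Q (a : T -> R) (b : R) : measurable_fun [set: T] a ->
  (forall p, Q p -> `|a p| <= b) ->
  has_labels Q (fun p p' eta => `|a p - a p'| <= eta).
Proof.
move=> ma ab eta eta0.
(* Enough thresholds i * eta - b to climb from -b past b; the label of p records on which side of
   each of them [a p] lies. *)
pose N := (Num.truncn (2 * b / eta)).+2.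
pose c (i : 'I_N) : R := i%:R * eta - b.
pose lab p : {ffun 'I_N -> bool} := [ffun i => a p <= c i].
exists {ffun 'I_N -> bool}, lab; split.
  move=> l; rewrite (_ : _ @^-1` _ =
      \bigcap_(i in [set: 'I_N]) ((fun p => a p <= c i) @^-1` [set l i])).
    apply: fin_bigcap_measurable => // i _.
    have mf : measurable_fun [set: T] (fun p => a p <= c i).
      by apply: measurable_fun_ler => //; exact: measurable_cst.
    by rewrite -[X in measurable X]setTI; exact: mf.
  apply/seteqP; split => p /=.
    by move=> <- i _ /=; rewrite ffunE.
  by move=> H; apply/ffunP => i; rewrite ffunE; exact: H.
suff main p p' : Q p -> Q p' -> lab p = lab p' -> a p' <= a p + eta.
  move=> p p' Qp Qp' e; rewrite ler_norml lerBrDr lerBlDr addrC.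
  by rewrite lerBlDr main//= addrC main.
move=> Qp Qp' /ffunP e.
have apb : 0 <= (a p + b) / eta.
  by rewrite divr_ge0// ?(ltW eta0)//; have := ab p Qp; rewrite ler_norml; lra.
(* The index of the first threshold strictly above [a p]. This threshold is at most a p + eta, and
   equality of labels puts [a p'] below it too. *)
have iN : ((Num.truncn ((a p + b) / eta)).+1 < N)%N.
  rewrite /N !ltnS; apply: le_truncn; rewrite ler_pM2r ?invr_gt0//.
  by have := ab p Qp; rewrite ler_norml; lra.
have /andP[t1 t2] := truncn_itv apb.
have := e (Ordinal iN); rewrite !ffunE /c /=.
have -> : a p <= (Num.truncn ((a p + b) / eta)).+1%:R * eta - b.
  by rewrite lerBrDr -ler_pdivrMr// ltW.
move/esym => H; apply: (le_trans H).
rewrite -natr1 mulrDl mul1r lerBlDr addrAC lerD2r.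
by rewrite -ler_pdivlMr.
Qed.

Lemma has_labels_and Q (S1 S2 : T -> T -> R -> Prop) :
  has_labels Q S1 -> has_labels Q S2 ->
  has_labels Q (fun p p' eta => S1 p p' eta /\ S2 p p' eta).
Proof.
move=> l1 l2 eta eta0.
have [L1 [lab1 [m1 s1]]] := l1 eta eta0.
have [L2 [lab2 [m2 s2]]] := l2 eta eta0.
exists (L1 * L2)%type, (fun p => (lab1 p, lab2 p)); split.
  move=> [i1 i2]; rewrite (_ : _ @^-1` _ = lab1 @^-1` [set i1] `&` lab2 @^-1` [set i2]).
    exact: measurableI.
  by apply/seteqP; split => p /= [-> ->].
by move=> p p' Qp Qp' [e1 e2]; split; [exact: s1|exact: s2].
Qed.

Lemma has_labels_complex Q a (b : R) : mfunC a -> (forall p, Q p -> nc (a p) <= b) ->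
  has_labels Q (fun p p' eta => nc (a p - a p') <= eta).
Proof.
move=> [m1 m2] ab eta eta0; have e2 : 0 < eta / 2 by rewrite divr_gt0.
have h1 := has_labels_real m1 (fun p Qp => le_trans (Re_nc _) (ab p Qp)).
have h2 := has_labels_real m2 (fun p Qp => le_trans (Im_nc _) (ab p Qp)).
have [L [lab [ml H]]] := has_labels_and h1 h2 e2.
exists L, lab; split => // p p' Qp Qp' e; have [r i] := H p p' Qp Qp' e.
apply: le_trans (nc_ReIm _) _; rewrite (splitr eta) cReB cImB.
by apply: lerD.
Qed.

End Labels.

Section StepFunctions.
Context d (T : measurableType d) (R : realType).
Variables (L : finType) (lab : T -> L) (Q : set T).

Definition cell (l : L) : set T := Q `&` lab @^-1` [set l].

Lemma step_sum (V : lmodType R[i]) (c : L -> V) p :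
  \sum_(l <- enum L) (\1_(cell l) p : R)%:C *: c l = (\1_Q p : R)%:C *: c (lab p).
Proof.
rewrite big_enum /= (bigD1 (lab p))//= big1 ?addr0.
  rewrite !indicE (_ : (p \in cell (lab p)) = (p \in Q))//.
  by apply/idP/idP; rewrite !inE => // -[].
move=> l lp; rewrite indicE memNset ?scale0r// => -[_ /= e].
by move: lp; rewrite e eqxx.
Qed.

End StepFunctions.

Section JetSum.
Variables (R : realType) (rho : R).

(** The constants are left existential: for a step function they grow with the number of cells, and
    [jet_cvg] accepts any. *)
Lemma is_jet_sum (I : Type) (r : seq I) (c : I -> R[i])
    (a : I -> nat -> R[i] -> R[i]) (C : nat -> R) :
  (forall i, is_jet rho C (a i)) ->
  exists C', is_jet rho C' (fun m w => \sum_(i <- r) c i * a i m w).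
Proof.
move=> ja; elim: r => [|i r [C' IH]].
  exists (fun=> nc (0 : R[i])); have := is_jet_cst rho (0 : R[i]); congr is_jet.
  by apply/funext => -[|m]; apply/funext => w; rewrite big_nil.
exists (fun m => nc (c i) * C m + C' m).
have := is_jet_lin (c i) (ja i) IH; congr is_jet.
by apply/funext => m; apply/funext => w; rewrite big_cons.
Qed.

End JetSum.

(** * The Cauchy transform of the weight and its Riemann sums *)

Section Transform.
Variables (R : realType) (g : R[i] -> R[i]) (M : R) (Cg : nat -> R).
Local Notation R2 := (measurableTypeR R * measurableTypeR R)%type.
Local Notation mu := (lebesgue2 R).
Hypothesis gM : forall z, M < nc z -> g z = 0.
Hypothesis gC : forall N z, nc (g z) <= Cg N * axis_dist z ^+ N.
Hypothesis mg : mfunC (g \o @toC R : R2 -> R[i]).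

Local Notation D := (jet_dom (M + 1)).
Local Notation Q := (disc M : set R2).

(** The coefficient H^(m) / m! of the Cauchy transform H, obtained formally by differentiating under
    the integral sign. *)
Definition ctrans m (w : R[i]) : R[i] :=
  integral2C (fun p : R2 => wkernel g m (toC p) w).

Lemma mfunC_wkernel m w : mfunC (fun p : R2 => wkernel g m (toC p) w).
Proof.
apply: mfunCM => //; apply: mfunCX; apply: mfunC_inv.
by apply: mfunCB; [exact: mfunC_toC|exact: mfunC_cst].
Qed.

Lemma dom_disc (h : R2 -> R[i]) (c : R) : (forall p, Q p -> nc (h p) <= c) ->
  (forall p, ~ Q p -> h p = 0) -> forall p, nc (h p) <= c * \1_Q p.
Proof.
move=> hc h0 p; rewrite indicE; have [pQ|pQ] := pselect (Q p).
  by rewrite mem_set// mulr1 hc.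
by rewrite memNset// mulr0 h0// nc0.
Qed.

Lemma integral2C_disc (h : R2 -> R[i]) (c : R) : mfunC h ->
  (forall p, Q p -> nc (h p) <= c) -> (forall p, ~ Q p -> h p = 0) ->
  intgC h /\ nc (integral2C h) <= 2 * (c * fine (mu Q)).
Proof.
move=> mh hc h0; have hb := dom_disc hc h0.
have [ib eb] := integrable_indic_fin c (measurable_disc M) (mu_disc_fin M).
by split; [exact: intgC_dom hb ib|rewrite -eb; exact: integral2C_le].
Qed.

Lemma wkernel_supp m w p : ~ Q p -> wkernel g m (toC p) w = 0.
Proof. by move=> /negP; rewrite -ltNge => /gM e; rewrite /wkernel e mul0r. Qed.

Lemma intgC_wkernel m w : D w -> intgC (fun p : R2 => wkernel g m (toC p) w) /\
  nc (ctrans m w) <= 2 * (wkernel_const Cg m * fine (mu Q)).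
Proof.
move=> Dw; apply: integral2C_disc.
- exact: mfunC_wkernel.
- by move=> p _; exact: wkernel_le gM gC _ _ _ Dw.
- exact: wkernel_supp.
Qed.

(** Differentiation under the integral: the quadratic remainder of the kernel has a constant uniform
    in z, so it may be integrated over the disc that carries [g]. *)
Lemma is_jet_ctrans :
  is_jet (M + 1) (fun m => 2 * (wkernel_const Cg m * fine (mu Q))) ctrans.
Proof.
move=> m; split=> [w Dw|w w' Dw Dw']; first exact: (intgC_wkernel m Dw).2.
have [i1 _] := intgC_wkernel m Dw; have [i2 _] := intgC_wkernel m Dw'.
have [i3 _] := intgC_wkernel m.+1 Dw.
have [i4 e4] := intgCB i2 i1; have [i5 e5] := intgCZ (m.+1%:R * (w' - w)) i3.
have [i6 e6] := intgCB i4 i5.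
rewrite -e4 -e5 -e6 -mulrA mulrAC.
apply: (integral2C_disc (c := wkernel_const Cg m * nc (w' - w) ^+ 2) _ _ _).2.
- apply: mfunCB; first by apply: mfunCB; exact: mfunC_wkernel.
  by apply: mfunCM; [exact: mfunC_cst|exact: mfunC_wkernel].
- by move=> p _; exact: (is_jet_wkernel gM gC (toC p) m).2.
- by move=> p Qp; rewrite !wkernel_supp// mulr0 !subrr.
Qed.

Section Step.
Variables (L : finType) (lab : R2 -> L) (zl : L -> R[i]).
Hypothesis mlab : forall l, measurable (lab @^-1` [set l]).

Lemma measurable_cell l : measurable (cell lab Q l).
Proof. by apply: measurableI => //; exact: measurable_disc. Qed.

Lemma mu_cell_fin l : (mu (cell lab Q l) < +oo)%E.
Proof.
apply: le_lt_trans (mu_disc_fin M); apply: le_measure; rewrite ?inE.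
- exact: measurable_cell.
- exact: measurable_disc.
- by move=> p [].
Qed.

Definition step_trans m w : R[i] :=
  \sum_(l <- enum L) (fine (mu (cell lab Q l)))%:C * wkernel g m (zl l) w.

Lemma is_jet_step_trans : exists C, is_jet (M + 1) C step_trans.
Proof. by apply: is_jet_sum => l; exact: is_jet_wkernel gM gC (zl l). Qed.

Lemma step_integral (c : L -> R[i]) (r : seq L) :
  let h p := \sum_(l <- r) (\1_(cell lab Q l) p : R)%:C * c l in
  [/\ intgC h, mfunC h &
    integral2C h = \sum_(l <- r) (fine (mu (cell lab Q l)))%:C * c l].
Proof.
elim: r => [|l r /= [IH1 IH2 IH3]] /=.
  under eq_fun do rewrite big_nil; rewrite big_nil.
  have m0 : mfunC (fun _ : R2 => 0 : R[i]) by exact: mfunC_cst.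
  have [i0 /= e0] := integral2C_disc (c := 0) m0 (fun _ _ =>
    ltac:(by rewrite nc0)) (fun _ _ => erefl).
  split=> //; apply: nc_eq0; apply/eqP; rewrite eq_le nc_ge0 andbT.
  by apply: le_trans e0 _; rewrite mul0r mulr0.
under eq_fun do rewrite big_cons; rewrite big_cons.
have [ib eb] := integrable_indic_fin 1 (measurable_cell l) (mu_cell_fin l).
have m1 : mfunC (fun p : R2 => (\1_(cell lab Q l) p : R)%:C).
  apply: mfunC_real; apply: measurable_indic; exact: measurable_cell.
have i1 : intgC (fun p : R2 => (\1_(cell lab Q l) p : R)%:C).
  by apply: (intgC_dom m1 _ ib) => p; rewrite nc_real mul1r ger0_norm.
have e1 : integral2C (fun p : R2 => (\1_(cell lab Q l) p : R)%:C) =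
    (fine (mu (cell lab Q l)))%:C.
  apply: ReIm_eq => /=; last by rewrite /ImF /= Rintegral_cst// mul0r.
  rewrite -[RHS]mul1r -eb; congr Rintegral; apply/funext => p.
  by rewrite /ReF /= mul1r.
have [i2 e2] := intgCZ (c l) i1.
have eC : (fun p : R2 => (\1_(cell lab Q l) p : R)%:C * c l) =
   (fun p => c l * (\1_(cell lab Q l) p : R)%:C).
  by apply/funext => p; rewrite mulrC.
have i3 : intgC (fun p : R2 => (\1_(cell lab Q l) p : R)%:C * c l) by rewrite eC.
split.
- exact: intgCD.
- by apply: mfunCD => //; apply: mfunCM => //; exact: mfunC_cst.
- by rewrite integral2CD// IH3 eC e2 e1 mulrC.
Qed.

Lemma step_trans_dist m w e : D w ->
  (forall p, Q p -> nc (wkernel g m (zl (lab p)) w - wkernel g m (toC p) w) <= e) ->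
  nc (step_trans m w - ctrans m w) <= 2 * (e * fine (mu Q)).
Proof.
move=> Dw He.
have [i1 m1 e1] := step_integral (fun l => wkernel g m (zl l) w) (enum L).
have [i2 _] := intgC_wkernel m Dw.
rewrite /step_trans -e1; have [i3 <-] := intgCB i1 i2.
have hE p : \sum_(l <- enum L) (\1_(cell lab Q l) p : R)%:C * wkernel g m (zl l) w =
   (\1_Q p : R)%:C * wkernel g m (zl (lab p)) w.
  exact: (step_sum lab Q (fun l => wkernel g m (zl l) w : R[i]^o)).
apply: (integral2C_disc _ _ _).2.
- by apply: mfunCB => //; exact: mfunC_wkernel.
- move=> p Qp; rewrite hE indicE mem_set// mul1r; exact: He.
- by move=> p Qp; rewrite hE indicE memNset// mul0r wkernel_supp// subrr.
Qed.

End Step.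

(** The labels record the position of z and the value [g z] together, because [wkernel_equicont]
    asks for both to be close. *)
Lemma step_exists eta : 0 < eta ->
  exists (L : finType) (lab : R2 -> L) (zl : L -> R[i]),
    (forall l, measurable (lab @^-1` [set l])) /\
    forall p, Q p -> [/\ nc (zl (lab p)) <= M, nc (zl (lab p) - toC p) <= eta &
      nc (g (zl (lab p)) - g (toC p)) <= eta].
Proof.
move=> eta0.
have h1 := has_labels_complex (@mfunC_toC R) (Q := Q) (b := M) (fun p Qp => Qp).
have gb p : Q p -> nc ((g \o @toC R) p) <= Cg 0.
  by move=> _; apply: le_trans (gC 0 _) _; rewrite expr0 mulr1.
have h2 := has_labels_complex mg gb.
have [L [lab [ml H]]] := has_labels_and h1 h2 eta0.
(* The default is taken only by labels that no point of the disc carries; their cells are empty. *)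
pose rep l : R2 := xget (0, 0) [set p | Q p /\ lab p = l].
exists L, lab, (fun l => toC (rep l)); split => // p Qp.
have [Qr er] : Q (rep (lab p)) /\ lab (rep (lab p)) = lab p.
  rewrite /rep; case: xgetP => [q -> //|/(_ p)/=]; tauto.
by have [? ?] := H _ _ Qr Qp er; split.
Qed.

End Transform.

(** * The resolvent and its Bochner integral *)

Section FunctionalCalculus.
Variables (R : realType) (B : completeNormedModType R[i]).
Variable Op : (R -> R[i]) -> B -> B.
Hypothesis Op_bounded : forall f, Gspace f -> bounded_op (Op f).
Hypothesis Op_linear : forall (a : R[i]) (f1 f2 : R -> R[i]),
  Gspace f1 -> Gspace f2 ->
  forall u, Op (fun x => a * f1 x + f2 x) u = a *: Op f1 u + Op f2 u.
Hypothesis Op_continuous : forall (fn : nat -> R -> R[i]) (f : R -> R[i]),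
  cvg_G fn f -> cvg_op (fun n => Op (fn n)) (Op f).
Hypothesis Op_mult : forall f1 f2 : R -> R[i], Gspace f1 -> Gspace f2 ->
  forall u, Op f1 (Op f2 u) = Op (fun x => f1 x * f2 x) u.
Hypothesis Op_dense : dense (span_of_test_ranges Op).
Implicit Types (f : R -> R[i]) (u v : B) (z w : R[i]).

Lemma Gspace_jet (rho : R) C a : 0 < rho -> is_jet rho C a -> Gspace (jet_fun a).
Proof. by move=> r0 /jet_G_of; exists rho. Qed.

Lemma Gspace_cst (c : R[i]) : Gspace (fun _ : R => c).
Proof. exact: Gspace_jet ltr01 (is_jet_cst 1 c). Qed.

Lemma Gspace_test f : test_line f -> Gspace f.
Proof.
move=> [sf [M fM]]; exists (Num.max M 1); first by rewrite lt_max ltr01 orbT.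
split=> //; exists (fun=> 0); split=> [z _||x].
- exact: derivable_cst.
- by exists 0 => z _; rewrite normr0.
- by rewrite gt_max => /andP[/fM -> _].
Qed.

Lemma Op0 u : Op (fun=> 0) u = 0.
Proof.
have := Op_linear 1 (Gspace_cst 0) (Gspace_cst 0) u.
rewrite (_ : (fun _ => 1 * 0 + 0) = (fun=> 0)); last first.
  by apply/funext => x; rewrite mulr0 addr0.
by rewrite scale1r => /eqP; rewrite -subr_eq0 opprD addrA subrr sub0r oppr_eq0 => /eqP.
Qed.

Lemma OpZ c f u : Gspace f -> Op (fun x => c * f x) u = c *: Op f u.
Proof.
move=> Gf; have := Op_linear c Gf (Gspace_cst 0) u.
by rewrite Op0 addr0 => <-; congr Op; apply/funext => x; rewrite addr0.
Qed.

(** By multiplicativity [Op 1] fixes each range of a test function, hence their span; the set of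
    vectors it moves is open, so by density it is empty. *)
Lemma Op1 u : Op (fun=> 1) u = u.
Proof.
have [T_lin T_cont] := Op_bounded (Gspace_cst 1).
set T := Op (fun=> 1) in T_lin T_cont *.
apply: contrapT => /eqP; rewrite -subr_eq0 => Tu.
have cont : continuous (fun v => T v - v).
  by move=> v; apply: cvgB; [exact: T_cont|exact: cvg_id].
have oU : open ((fun v => T v - v) @^-1` (~` [set 0])).
  by apply: open_comp => [v _|]; [exact:
    cont|exact/closed_openC/accessible_closed_set1/hausdorff_accessible/norm_hausdorff].
have nU : (fun v => T v - v) @^-1` (~` [set 0]) !=set0.
  by exists u => /= /eqP; apply/negP.
have [v [/= Tv [n [g [w [tg ve]]]]]] := Op_dense nU oU.
have TD v1 v2 : T (v1 + v2) = T v1 + T v2 by have := T_lin 1 v1 v2; rewrite !scale1r.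
have T0 : T 0 = 0 by have := T_lin (-1) 0 0; rewrite !scaleN1r oppr0 addr0 addNr.
apply: Tv; apply/eqP; rewrite subr_eq0 ve; apply/eqP.
rewrite (big_morph T TD T0); apply: eq_bigr => i _.
rewrite /T Op_mult; [|exact: Gspace_cst|exact/Gspace_test/tg].
by congr Op; apply/funext => x; rewrite mul1r.
Qed.

Lemma Op_cst c u : Op (fun=> c) u = c *: u.
Proof.
rewrite -{2}(Op1 u) -(OpZ c u (Gspace_cst 1)).
by congr Op; apply/funext => x; rewrite mulr1.
Qed.

Lemma Op_jet_sum (I : Type) (r : seq I) (rho : R) (C : nat -> R) (c : I -> R[i])
    (a : I -> nat -> R[i] -> R[i]) u : 0 < rho ->
  (forall i, is_jet rho C (a i)) ->
  Op (jet_fun (fun m w => \sum_(i <- r) c i * a i m w)) u =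
  \sum_(i <- r) c i *: Op (jet_fun (a i)) u.
Proof.
move=> r0 ja; elim: r => [|i r IH].
  rewrite big_nil -(Op0 u); congr Op; apply/funext => x.
  by rewrite /jet_fun big_nil.
rewrite big_cons -IH -Op_linear.
- by congr Op; apply/funext => x; rewrite /jet_fun big_cons.
- exact: Gspace_jet (ja i).
- by have [C' /Gspace_jet] := is_jet_sum r c ja; apply.
Qed.

Lemma Gspace_omega z : complex.Im z != 0 -> Gspace (omega z).
Proof.
move=> z0; have q0 : 0 < axis_dist z by rewrite lt_min normr_gt0 z0 ltr01.
have := @is_jet_kernel R (nc z + 1) 1 z (axis_dist z) _ _.
rewrite q0 axis_dist_le1 => /(_ isT (fun w => axis_dist_le (lexx _))) j.
have r0 : 0 < nc z + 1 by rewrite ltr_wpDl ?nc_ge0.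
have := Gspace_jet r0 j; congr Gspace; apply/funext => x.
by rewrite /jet_fun mul1r expr1.
Qed.

Lemma xomegaE z : complex.Im z != 0 -> xomega z = (fun x => z * omega z x + (-1)).
Proof.
move=> z0; apply/funext => x; rewrite /xomega /omega.
have zx : z - x%:C != 0.
  by apply: contra z0 => /eqP/(congr1 (@complex.Im R)); rewrite cImB /= subr0 => ->.
by apply: (mulIf zx); rewrite mulrDl !mulfVK//; ring.
Qed.

Lemma Gspace_xomega z : complex.Im z != 0 -> Gspace (xomega z).
Proof.
move=> z0; have q0 : 0 < axis_dist z by rewrite lt_min normr_gt0 z0 ltr01.
have := @is_jet_kernel R (nc z + 1) 1 z (axis_dist z) _ _.
rewrite q0 axis_dist_le1 => /(_ isT (fun w => axis_dist_le (lexx _))) j.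
have r0 : 0 < nc z + 1 by rewrite ltr_wpDl ?nc_ge0.
have := Gspace_jet r0 (is_jet_lin z j (is_jet_cst _ (-1))).
by rewrite (xomegaE z0); congr Gspace; apply/funext => x; rewrite /jet_fun mul1r expr1.
Qed.

Lemma Op_xomega z u : complex.Im z != 0 -> Op (xomega z) u = z *: Op (omega z) u - u.
Proof.
move=> z0; rewrite (xomegaE z0) Op_linear; [|exact: Gspace_omega|exact: Gspace_cst].
by rewrite Op_cst scaleN1r.
Qed.

(** A graph point over u = Op (omega z') v satisfies (z - P) u = Op ((z - z') omega_z' + 1) v. The
    left inverse property is then the resolvent identity omega_z ((z - z') omega_z' + 1) =
    omega_z'. *)
Lemma omega_is_resolvent z : complex.Im z != 0 ->
  is_resolvent (generated_op Op) z (Op (omega z)).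
Proof.
move=> z0; have Gz := Gspace_omega z0; split; first exact: Op_bounded.
  by move=> u; exists z, u; rewrite Op_xomega.
move=> u w [z' [v [z'0 [-> ->]]]].
have Gz' := Gspace_omega z'0; have Gx' := Gspace_xomega z'0.
rewrite Op_xomega//; have -> : z *: Op (omega z') v - (z' *: Op (omega z') v - v) =
    (z - z') *: Op (omega z') v + Op (fun=> 1) v.
  by rewrite Op1 scalerBl opprB addrA addrAC.
have Gd : Gspace (fun x => (z - z') * omega z' x + 1).
  have q0 : 0 < axis_dist z' by rewrite lt_min normr_gt0 z'0 ltr01.
  have := @is_jet_kernel R (nc z' + 1) 1 z' (axis_dist z') _ _.
  rewrite q0 axis_dist_le1 => /(_ isT (fun w => axis_dist_le (lexx _))) j.
  have r0 : 0 < nc z' + 1 by rewrite ltr_wpDl ?nc_ge0.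
  have := Gspace_jet r0 (is_jet_lin (z - z') j (is_jet_cst _ 1)).
  by congr Gspace; apply/funext => x; rewrite /jet_fun mul1r expr1.
rewrite -Op_linear//; last exact: Gspace_cst.
rewrite Op_mult//; congr Op; apply/funext => x; rewrite /omega.
have nz (y : R[i]) : complex.Im y != 0 -> y - x%:C != 0.
  by move=> y0; apply: contra y0 => /eqP/(congr1 (@complex.Im R));
    rewrite cImB /= subr0 => ->.
by field; rewrite !nz.
Qed.

(** Whichever operator [xget] selects is a right inverse of z - P, hence equal to the left inverse
    [Op (omega z)]. *)
Lemma resolventE z : complex.Im z != 0 -> resolvent (generated_op Op) z = Op (omega z).
Proof.
move=> z0; rewrite /resolvent; case: xgetP => [T -> [_ T1 T2]|/(_ (Op (omega z)))].
  apply/funext => u; have [_ _ H] := omega_is_resolvent z0.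
  by have := H _ _ (T1 u); rewrite opprB addrC subrK.
by have := omega_is_resolvent z0.
Qed.

Section Bochner.
Variables (g : R[i] -> R[i]) (M : R) (Cg : nat -> R).
Local Notation R2 := (measurableTypeR R * measurableTypeR R)%type.
Local Notation mu := (lebesgue2 R).
Hypothesis M0 : 0 <= M.
Hypothesis gM : forall z, M < nc z -> g z = 0.
Hypothesis gC : forall N z, nc (g z) <= Cg N * axis_dist z ^+ N.
Hypothesis mg : mfunC (g \o @toC R : R2 -> R[i]).
Local Notation D := (jet_dom (M + 1)).
Local Notation Q := (disc M : set R2).

Definition wfun z : R -> R[i] := jet_fun (fun m w => wkernel g m z w).

Let rho0 : 0 < M + 1. Proof. by rewrite ltr_wpDl. Qed.

Lemma Gspace_wfun z : Gspace (wfun z).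
Proof. exact: Gspace_jet rho0 (is_jet_wkernel gM gC z). Qed.

Lemma Op_wfun z u : Op (wfun z) u = g z *: resolvent (generated_op Op) z u.
Proof.
(* On the real axis the resolvent may be the default value of [xget], but its coefficient [g z]
   vanishes there. *)
have [z0|z0] := eqVneq (complex.Im z) 0.
  rewrite (real_weight0 gC z0) scale0r -(Op0 u); congr Op; apply/funext => x.
  by rewrite /wfun /jet_fun /wkernel (real_weight0 gC z0) mul0r.
by rewrite resolventE// -(OpZ _ _ (Gspace_omega z0)).
Qed.

(* A failure along a sequence would contradict the sequential continuity of [Op]. *)
Lemma Op_wfun_equicont (e : R) : 0 < e -> exists2 eta : R, 0 < eta &
  forall z z', nc z <= M -> nc z' <= M -> nc (z - z') <= eta ->
    nc (g z - g z') <= eta ->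
    forall u, `|Op (wfun z) u - Op (wfun z') u| <= e%:C * `|u|.
Proof.
move=> e0; apply: contrapT => H.
have bad n : exists zz : R[i] * R[i], [/\ nc zz.1 <= M, nc zz.2 <= M,
    nc (zz.1 - zz.2) <= n.+1%:R^-1 /\ nc (g zz.1 - g zz.2) <= n.+1%:R^-1 &
    ~ forall u, `|Op (wfun zz.1) u - Op (wfun zz.2) u| <= e%:C * `|u|].
  apply: contrapT => nex; apply: H; exists n.+1%:R^-1; first by rewrite invr_gt0.
  move=> z z' zM zM' zz gg; apply: contrapT => nb; apply: nex.
  by exists (z, z').
have [zz Hzz] := choice bad.
pose an n m w := -1 * wkernel g m (zz n).2 w + wkernel g m (zz n).1 w.
have jan n : is_jet (M + 1)
    (fun m => nc (-1 : R[i]) * wkernel_const Cg m + wkernel_const Cg m) (an n).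
  exact: is_jet_lin (is_jet_wkernel gM gC _) (is_jet_wkernel gM gC _).
(* The zero jet; both branches of the match in its later form are 0, the shape that [is_jet_cst]
   produces. *)
have j0 := is_jet_cst (M + 1) (0 : R[i]).
have cv : cvg_G (fun n => jet_fun (an n))
    (jet_fun (fun m _ => if m is 0 then 0 : R[i] else 0)).
  exists (M + 1) => //; apply: jet_cvg jan j0 _ => m e' e'0.
  have [eta eta0 Heta] := wkernel_equicont M gC m e'0.
  near=> n => w Dw.
  have neta : n.+1%:R^-1 <= eta.
    apply: ltW; near: n; exact: near_infty_natSinv_lt (PosNum eta0).
  have [z1 z2 [d1 d2] _] := Hzz n.
  rewrite (_ : an n m w - _ = wkernel g m (zz n).1 w - wkernel g m (zz n).2 w).
    by apply: Heta => //; exact: le_trans neta.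
  by rewrite /an mulN1r; case: m {Heta} => [|m]; rewrite subr0 addrC.
have [n _ /(_ n (leqnn n)) Hn] := Op_continuous cv e0.
have [_ _ _] := Hzz n; apply => u.
have := Hn u; rewrite [X in _ - X](_ : _ = 0); last first.
  by rewrite -(Op0 u); congr Op.
rewrite subr0 (Op_linear (-1) (Gspace_wfun _) (Gspace_wfun _)).
by rewrite scaleN1r addrC.
Unshelve. all: by end_near. Qed.

Definition ctrans_op : B -> B := Op (jet_fun (ctrans g)).

(** The same cells serve two estimates: [Op_wfun_equicont] bounds the pointwise error in operator
    norm, and [wkernel_equicont] makes the scalar step transforms converge in the function space. *)
Lemma bochner_ctrans :
  bochner_integral (fun z u => g z *: resolvent (generated_op Op) z u) ctrans_op.
Proof.
have muQ0 : 0 <= fine (mu Q) by rewrite fine_ge0.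
(* The mesh is also kept below 1/(n+1): the threshold in [wkernel_equicont] depends on the order m,
   and a mesh tending to 0 eventually passes all of them. *)
have etaP n : exists eta : R, [/\ 0 < eta, eta <= n.+1%:R^-1 &
    forall z z', nc z <= M -> nc z' <= M -> nc (z - z') <= eta ->
    nc (g z - g z') <= eta ->
    forall u, `|Op (wfun z) u - Op (wfun z') u| <= (n.+1%:R^-1)%:C * `|u|].
  have n0 : 0 < n.+1%:R^-1 :> R by rewrite invr_gt0.
  have [eta eta0 H] := Op_wfun_equicont n0.
  exists (Num.min eta n.+1%:R^-1); split; first by rewrite lt_min eta0.
    by rewrite ge_min lexx orbT.
  by move=> z z' zM zM'; rewrite !le_min => /andP[? _] /andP[? _]; exact: H.
have stepP n : exists s : {L : finType & (R2 -> L) * (L -> R[i])}%type,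
    (forall l, measurable ((projT2 s).1 @^-1` [set l])) /\
    forall p, Q p -> let z := (projT2 s).2 ((projT2 s).1 p) in
      [/\ nc z <= M, nc (z - toC p) <= n.+1%:R^-1, nc (g z - g (toC p)) <= n.+1%:R^-1 &
      forall u, `|Op (wfun (toC p)) u - Op (wfun z) u| <= (n.+1%:R^-1)%:C * `|u| ].
  have [eta [eta0 etan H]] := etaP n.
  have [L [lab [zl [ml Hl]]]] := step_exists M gC mg eta0.
  exists (existT _ L (lab, zl)); split => // p Qp /=.
  have [l1 l2 l3] := Hl p Qp; split=> //.
  - exact: le_trans etan.
  - exact: le_trans etan.
  - by apply: H => //; rewrite nc_distC.
have [s Hs] := choice stepP.
pose L n := projT1 (s n).
pose lab n : R2 -> L n := (projT2 (s n)).1.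
pose zl n : L n -> R[i] := (projT2 (s n)).2.
have ml n l : measurable (lab n @^-1` [set l]) := (Hs n).1 l.
pose S n : simple_op B := [seq (cell (lab n) Q l, Op (wfun (zl n l))) | l <- enum (L n)].
(* Off the disc both [g] and the simple function vanish, so the error needs a bound only on a set of
   finite measure. *)
pose h n (p : R2) : R := n.+1%:R^-1 * \1_Q p.
have cvV : (fun n => n.+1%:R^-1 : R) @ \oo --> (0 : R).
  exact: cvg_harmonic.
exists S, h; split.
- move=> n; rewrite /S; elim: (enum _) => //= l r IH; split=> //.
  + exact: measurable_cell.
  + exact: mu_cell_fin.
  + exact/Op_bounded/Gspace_wfun.
- move=> n; split.
    apply: (measurable_funM (f := cst n.+1%:R^-1) (g := \1_Q)) => //.
    by apply: measurable_indic; exact: measurable_disc.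
  by move=> p; rewrite mulr_ge0 ?invr_ge0.
- move=> n p u; rewrite -Op_wfun /simple_op_val /S big_map /=.
  rewrite (step_sum (lab n) Q (fun l => Op (wfun (zl n l)) u)) /h !indicE.
  have [Qp|Qp] := pselect (Q p).
    have [_ _ _ H] := (Hs n).2 p Qp.
    by rewrite mem_set// scale1r mulr1; exact: H.
  rewrite memNset// scale0r subr0 mulr0 mul0r Op_wfun gM ?scale0r ?normr0//.
  by rewrite ltNge; exact/negP.
- rewrite (_ : (fun n => _) = (fun n => (n.+1%:R^-1 * fine (mu Q))%:E)).
    apply: cvg_EFin; first exact: nearW.
    rewrite -(mul0r (fine (mu Q))); exact: cvgMl.
  apply/funext => n.
  have [i e] := integrable_indic_fin n.+1%:R^-1 (measurable_disc M) (mu_disc_fin M).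
  by rewrite -e fineK//; exact: integrable_fin_num.
- have jS n := is_jet_step_trans gM gC (lab n) (zl n).
  have [CS jCS] := choice jS.
  (* By finite linearity the integral of the simple function is [Op] of a scalar step transform, to
     which sequential continuity applies. *)
  have -> : (fun n => simple_op_int (S n)) =
     (fun n => Op (jet_fun (step_trans g M (lab n) (zl n)))).
    apply/funext => n; apply/funext => u.
    rewrite /simple_op_int /S big_map /step_trans.
    by rewrite (Op_jet_sum _ _ _ rho0 (fun l => is_jet_wkernel gM gC (zl n l))).
  apply: Op_continuous; exists (M + 1) => //.
  apply: jet_cvg jCS (is_jet_ctrans gM gC mg) _ => m e e0.
  pose e' := e / (2 * fine (mu Q) + 1).
  have q1 : 0 < 2 * fine (mu Q) + 1 by rewrite ltr_wpDl// mulr_ge0.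
  have e'0 : 0 < e' by rewrite divr_gt0.
  have [eta eta0 Heta] := wkernel_equicont M gC m e'0.
  near=> n => w Dw.
  have neta : n.+1%:R^-1 <= eta.
    apply: ltW; near: n; exact: near_infty_natSinv_lt (PosNum eta0).
  apply: le_trans (step_trans_dist gM gC mg (ml n) Dw (e := e') _) _.
    move=> p Qp; have [l1 l2 l3 _] := (Hs n).2 p Qp.
    by apply: Heta => //; exact: le_trans neta.
  rewrite mulrCA /e' mulrAC ler_pdivrMr// ler_wpM2l ?(ltW e0)//.
  by rewrite lerDl.
Unshelve. all: by end_near. Qed.

End Bochner.

End FunctionalCalculus.

(** * Smooth test functions *)

Section FlatExponential.
Variable R : realType.
Implicit Types (P : {poly R}) (t s : R).

(** Coefficientwise from s^i <= i! * exp s for s >= 0. *)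
Lemma horner_le_expR P : exists C : R, forall s, 0 <= s -> `|P.[s]| <= C * expR s.
Proof.
exists (\sum_(i < size P) `|P`_i| * i`!%:R) => s s0.
rewrite horner_coef mulr_suml; apply: le_trans (ler_norm_sum _ _ _) _.
apply: ler_sum => i _; rewrite normrM -mulrA ler_wpM2l//.
rewrite normrX ger0_norm// mulrC -ler_pdivrMr ?ltr0n ?fact_gt0//.
case: (i : nat) => [|n]; first by rewrite expr0 invr1 mulr1; have := @expR_ge1Dx R s; lra.
by apply: le_trans (expR_ge1Dxn n s0); rewrite lerDr.
Qed.

(* All derivatives of [exp(-1/t)] on [t > 0], extended by [0], have this form. *)
Definition flat_exp P t : R := if 0 < t then P.[t^-1] * expR (- t^-1) else 0.

(** In the variable s = 1/t one has d/dt = - s^2 d/ds, which turns P(s) exp(-s) into s^2 (P - P')(s)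
    exp(-s). *)
Lemma is_derive_flat_exp P t :
  is_derive (t : R^o) (1 : R^o) (flat_exp P : R^o ->
    R^o) (flat_exp ('X^2 * (P - P^`())) t).
Proof.
have [t0|t0|->] := ltgtP t 0.
- rewrite {2}/flat_exp ltNge (ltW t0) /=.
  apply: (near_eq_is_derive (f := cst 0)).
    near=> y; rewrite /flat_exp ltNge (_ : y <= 0)//.
    by apply: ltW; near: y; exact: (cvgr_lt t cvg_id).
- rewrite {2}/flat_exp t0.
  apply: (near_eq_is_derive (f := fun y : R => P.[y^-1] * expR (- y^-1))).
    near=> y; rewrite /flat_exp (_ : 0 < y)//.
    by near: y; exact: (cvgr_gt t cvg_id).
  have dV : is_derive t 1 (fun y : R => y^-1) (- t ^- 2).
    have := @is_deriveV R id t 1 1 (lt0r_neq0 t0) (is_derive_id _ _).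
    by rewrite /GRing.scale /= mulr1.
  have dP := is_derive1_comp (is_derive_poly P t^-1) dV.
  have dN : is_derive t 1 (fun y : R => - y^-1) (- (- t ^- 2)).
    exact: is_deriveN.
  have dE := @is_derive1_comp R expR (fun y => - y^-1) t _ _ (is_derive_expR _) dN.
  have dM : is_derive t 1 (fun y : R => P.[y^-1] * expR (- y^-1)) _ := is_deriveM dP dE.
  apply: is_derive_eq dM _.
  rewrite /GRing.scale /= !hornerE /= exprVn.
  by ring.
- rewrite {2}/flat_exp ltxx.
  (* At 0 the remainder bound |P(1/h)| exp(-1/h) <= C h^2 is, for s = 1/h, the bound s^2 |P(s)| <= C
     exp s. *)
  have [C HC] := horner_le_expR ('X^2 * P).
  apply: (@quadratic_is_derive _ _ _ _ C 1) => // h _.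
  rewrite addr0 mulr0 subr0 /flat_exp ltxx subr0.
  have C0 : 0 <= C.
    have := le_trans (normr_ge0 _) (HC 0 (lexx _)).
    by rewrite expR0 mulr1.
  case: ifPn => h0; last by rewrite normr0 mulr_ge0 ?exprn_ge0.
  rewrite normrM (ger0_norm (expR_ge0 _)) expRN.
  rewrite ler_pdivrMr ?expR_gt0// mulrAC -ler_pdivrMr ?exprn_gt0 ?normr_gt0 ?gt_eqF//.
  apply: le_trans (HC h^-1 _); last by rewrite invr_ge0 ltW.
  by rewrite !hornerE /= normrM normrX mulrC normfV exprVn.
Unshelve. all: by end_near. Qed.

Lemma flat_exp_le P : exists C : R, forall t, `|flat_exp P t| <= C.
Proof.
have [C HC] := horner_le_expR P; exists C => t.
have C0 : 0 <= C.
  have := le_trans (normr_ge0 _) (HC 0 (lexx _)).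
  by rewrite expR0 mulr1.
rewrite /flat_exp; case: ifPn => [t0|]; last by rewrite normr0.
rewrite normrM (ger0_norm (expR_ge0 _)) expRN ler_pdivrMr ?expR_gt0//.
by apply: HC; rewrite invr_ge0 ltW.
Qed.

End FlatExponential.

(** * A class of smooth functions of two real variables *)

Section SmoothPlane.
Variable R : realType.
Implicit Types (f h : R * R -> R) (p v : R * R).

(** A syntactic class of differentiable functions closed under directional derivatives, so that
    smoothness of all orders is an induction on the list of directions. Its constructors are the
    operations from which the test functions are built. *)
Inductive smooth2 : (R * R -> R) -> Prop :=
| smooth2_cst c : smooth2 (fun=> c)
| smooth2_fst : smooth2 fst
| smooth2_snd : smooth2 snd
| smooth2D f h : smooth2 f -> smooth2 h -> smooth2 (fun p => f p + h p)
| smooth2M f h : smooth2 f -> smooth2 h -> smooth2 (fun p => f p * h p)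
| smooth2V f : smooth2 f -> (forall p, f p != 0) -> smooth2 (fun p => (f p)^-1)
| smooth2_flat P f : smooth2 f -> smooth2 (fun p => flat_exp P (f p)).

Lemma differentiable_fst p : differentiable (fst : R * R -> R) p.
Proof. by apply: linear_differentiable => -[a b]; exact: cvg_fst. Qed.

Lemma differentiable_snd p : differentiable (snd : R * R -> R) p.
Proof. by apply: linear_differentiable => -[a b]; exact: cvg_snd. Qed.

Lemma derive_fst p v : 'D_v (fst : R * R -> R) p = v.1.
Proof.
rewrite deriveE; last exact: differentiable_fst.
by rewrite diff_lin// => -[a b]; exact: cvg_fst.
Qed.

Lemma derive_snd p v : 'D_v (snd : R * R -> R) p = v.2.
Proof.
rewrite deriveE; last exact: differentiable_snd.
by rewrite diff_lin// => -[a b]; exact: cvg_snd.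
Qed.

Lemma differentiable_flat P f p : differentiable f p ->
  differentiable (fun q => flat_exp P (f q)) p.
Proof.
move=> df; apply: (@differentiable_comp _ _ _ _ f (flat_exp P : R -> R)) => //.
by apply/derivable1_diffP; have [] := is_derive_flat_exp P (f p).
Qed.

Lemma derive_flat P f p v : differentiable f p ->
  'D_v (fun q => flat_exp P (f q)) p = flat_exp ('X^2 * (P - P^`())) (f p) * 'D_v f p.
Proof.
move=> df.
have db : differentiable (flat_exp P : R -> R) (f p).
  by apply/derivable1_diffP; have [] := is_derive_flat_exp P (f p).
rewrite deriveE; last exact: differentiable_flat.
rewrite (@diff_comp _ _ _ _ f (flat_exp P : R -> R))//= diff1E// derive1E.
have [_ ->] := is_derive_flat_exp P (f p).
by rewrite -deriveE// [_ *: _]mulrC.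
Qed.

Lemma smooth2_diff f : smooth2 f -> forall p, differentiable f p.
Proof.
elim=> {f} [c|||f h _ IHf _ IHh|f h _ IHf _ IHh|f _ IH f0|P f _ IH] p.
- exact: differentiable_cst.
- exact: differentiable_fst.
- exact: differentiable_snd.
- exact: differentiableD.
- exact: differentiableM.
- exact: differentiableV.
- exact: differentiable_flat.
Qed.

Lemma smooth2_deriveD f h p v : smooth2 f -> smooth2 h ->
  'D_v (fun q => f q + h q) p = 'D_v f p + 'D_v h p.
Proof.
move=> /smooth2_diff/(_ p) d1 /smooth2_diff/(_ p) d2.
by apply: deriveD; exact: diff_derivable.
Qed.

Lemma smooth2_deriveM f h p v : smooth2 f -> smooth2 h ->
  'D_v (fun q => f q * h q) p = f p * 'D_v h p + h p * 'D_v f p.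
Proof.
move=> /smooth2_diff/(_ p) d1 /smooth2_diff/(_ p) d2.
by apply: deriveM; exact: diff_derivable.
Qed.

Lemma smooth2_deriveV f p v : smooth2 f -> (forall q, f q != 0) ->
  'D_v (fun q => (f q)^-1) p = - ((f p)^-1 * (f p)^-1) * 'D_v f p.
Proof.
move=> /smooth2_diff/(_ p) d1 f0; have d2 := @diff_derivable _ _ _ _ _ v d1.
by rewrite deriveV// -expr2 -exprVn.
Qed.

Lemma smooth2_derive_flat P f p v : smooth2 f ->
  'D_v (fun q => flat_exp P (f q)) p = flat_exp ('X^2 * (P - P^`())) (f p) * 'D_v f p.
Proof. by move=> /smooth2_diff/(_ p); exact: derive_flat. Qed.

Lemma smooth2_derive f v : smooth2 f -> smooth2 ('D_v f).
Proof.
elim=> {f} [c|||f h sf IHf sh IHh|f h sf IHf sh IHh|f sf IH f0|P f sf IH].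
- rewrite (_ : 'D_v _ = fun=> 0); first exact: smooth2_cst.
  by apply/funext => p; rewrite derive_cst.
- rewrite (_ : 'D_v _ = fun=> v.1); first exact: smooth2_cst.
  by apply/funext => p; rewrite derive_fst.
- rewrite (_ : 'D_v _ = fun=> v.2); first exact: smooth2_cst.
  by apply/funext => p; rewrite derive_snd.
- rewrite (_ : 'D_v _ = fun p => 'D_v f p + 'D_v h p); first exact: smooth2D.
  by apply/funext => p; exact: smooth2_deriveD.
- rewrite (_ : 'D_v _ = fun p => f p * 'D_v h p + h p * 'D_v f p).
    by apply: smooth2D; exact: smooth2M.
  by apply/funext => p; exact: smooth2_deriveM.
- rewrite (_ : 'D_v _ = fun p => (-1 * ((f p)^-1 * (f p)^-1)) * 'D_v f p).
    apply: smooth2M => //; apply: smooth2M; first exact: smooth2_cst.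
    by apply: smooth2M; exact: smooth2V.
  by apply/funext => p; rewrite smooth2_deriveV// mulN1r.
- rewrite (_ : 'D_v _ = fun p => flat_exp ('X^2 * (P - P^`())) (f p) * 'D_v f p).
    by apply: smooth2M => //; exact: smooth2_flat.
  by apply/funext => p; exact: smooth2_derive_flat.
Qed.

Lemma smooth2_plane (phi : R * R -> R[i]) :
  smooth2 (ReF phi) -> smooth2 (ImF phi) -> smooth_plane phi.
Proof.
move=> s1 s2 vs p.
suff [t1 t2] : smooth2 (ReF (foldr (@plane_deriv R) phi vs)) /\
    smooth2 (ImF (foldr (@plane_deriv R) phi vs)).
  by split; exact: smooth2_diff.
by elim: vs => [//|v vs [IH1 IH2]] /=; split; exact: smooth2_derive.
Qed.

End SmoothPlane.

(** * An approximate identity *)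

Section ContinuousMeasurable.
Variable R : realType.
Local Notation R2 := (measurableTypeR R * measurableTypeR R)%type.

(** An open set is the union of the rational boxes it contains. This countable union links the
    product topology to the product sigma-algebra. *)
Lemma open_measurable2 (U : set (R * R)) : open U -> measurable (U : set R2).
Proof.
move=> oU.
pose rbox (q : (rat * rat) * (rat * rat)) : set R2 :=
  `]ratr q.1.1, ratr q.1.2[%classic `*` `]ratr q.2.1, ratr q.2.2[%classic.
have -> : U = \bigcup_(q in [set q | rbox q `<=` U]) rbox q.
  apply/seteqP; split => [[x y] Uxy|p [q /= qU] qp]; last exact: qU.
  have /= [[A1 A2] [/= nA1 nA2] AU] := open_nbhs_nbhs (conj oU Uxy).
  have itv (z : R) (A : set R) : nbhs z A ->
      exists q : rat * rat, `]ratr q.1, ratr q.2[%classic z /\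
        `]ratr q.1, ratr q.2[%classic `<=` A.
    move=> /nbhs_ballP[e /= e0 zA].
    have /rat_in_itvoo[q1 /[1!in_itv]/= /andP[q11 q12]] : z - e < z by lra.
    have /rat_in_itvoo[q2 /[1!in_itv]/= /andP[q21 q22]] : z < z + e by lra.
    exists (q1, q2) => /=; split; first by rewrite in_itv /= q12 q21.
    move=> t /=; rewrite in_itv /= => /andP[t1 t2]; apply: zA.
    by rewrite /ball /= ltr_norml; apply/andP; split; lra.
  have [q1 [xq1 q1A]] := itv _ _ nA1; have [q2 [yq2 q2A]] := itv _ _ nA2.
  exists (q1, q2) => //= -[t1 t2] [/= h1 h2].
  by apply: AU; split; [exact: q1A|exact: q2A].
rewrite bigcup_mkcond; apply: countable_bigcupT_measurable => // q.
case: ifP => // _.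
by apply: measurableX; exact: measurable_itv.
Qed.

Lemma continuous_measurable2 (f : R * R -> R) : continuous f ->
  measurable_fun [set: R2] (f : R2 -> R).
Proof.
move=> cf; apply: (measurability _ (RGenOpens.measurableE R)) => //.
move=> /= _ [_ [a [b ->]] <-]; rewrite setTI; apply: open_measurable2.
by apply: open_comp => [p _|]; [exact: cf|exact: interval_open].
Qed.

End ContinuousMeasurable.

(** * The total mass of the approximate identity *)

Section PlaneMass.
Variable R : realType.
Local Notation mu1 := (@lebesgue_measure R).
Local Notation R2 := (measurableTypeR R * measurableTypeR R)%type.

(** The fundamental theorem is applied on [0, +oo[ twice, the second time after x -> -x; so [l'] is
    the limit of F at -oo. *)
Lemma integralT_FTC (f F : R -> R) (l l' : R) : (forall x, 0 <= f x) ->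
  continuous f -> (forall x : R, is_derive x 1 F (f x)) ->
  F x @[x --> +oo] --> l -> F (- x) @[x --> +oo] --> l' ->
  (\int[mu1]_x (f x)%:E = (l - l')%:E)%E.
Proof.
move=> f0 cf dF Fl Fl'.
have mf : measurable_fun [set: R] f by exact: continuous_measurable_fun.
have cF : continuous F.
  by move=> x; apply/differentiable_continuous/derivable1_diffP; case: (dF x).
rewrite -(setUv [set x : R | 0 <= x]) ge0_integral_setU//=; last 5 first.
- by rewrite -set_itvcy.
- by rewrite -set_itvcy; exact: measurableC.
- by rewrite setUv; exact/measurable_EFinP.
- by move=> x _; rewrite lee_fin.
- exact/disj_setPCl.
rewrite -set_itvcy// setCitvr.
rewrite integral_itv_bndo_bndc; last exact/measurable_EFinP/measurable_funTS.
rewrite -{2}oppr0 ge0_integration_by_substitutionNy//; last exact: continuous_subspaceT.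
have -> : (\int[mu1]_(x in `[0%R, +oo[) (f x)%:E = l%:E - (F 0)%:E)%E.
  apply: ge0_continuous_FTC2y => //.
  - exact: continuous_subspaceT.
  - exact/cvg_at_right_filter/cF.
  - by move=> x _; rewrite derive1E; case: (dF x).
have dF' (x : R) : is_derive x 1 (fun y => - F (- y)) (f (- x)).
  have dN : is_derive x 1 (-%R : R -> R) (-1) by exact: is_deriveNid.
  have dM : is_derive x 1 (fun y => - F (- y)) _ :=
    is_deriveN (@is_derive1_comp R F -%R x _ _ (dF (- x)) dN).
  by apply: is_derive_eq dM _; rewrite mulrN1 opprK.
have cF' : continuous (fun y => - F (- y)).
  by move=> x; apply/differentiable_continuous/derivable1_diffP; case: (dF' x).
have -> : (\int[mu1]_(x in `[0%R, +oo[) ((f \o -%R) x)%:E =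
    (- l')%:E - (- F (- 0))%:E)%E.
  apply: (@ge0_continuous_FTC2y _ _ (fun y => - F (- y))) => //.
  - by move=> x _; exact: f0.
  - apply: continuous_subspaceT => x; apply: continuous_comp; last exact: cf.
    exact: opp_continuous.
  - exact: cvgN.
  - exact/cvg_at_right_filter/cF'.
  - by move=> x _; rewrite derive1E; case: (dF' x).
by rewrite oppr0 -!EFinB -EFinD; congr EFin; lra.
Qed.

Lemma cvg_pinfty_le (F : R -> R) (l C : R) :
  (forall x, 0 < x -> `|F x - l| <= C / x) -> F x @[x --> +oo] --> l.
Proof.
move=> H; apply/cvgrPdist_le => e e0; near=> x.
have x0 : 0 < x by near: x; exact: nbhs_pinfty_gt.
rewrite distrC; apply: le_trans (H x x0) _.
rewrite ler_pdivrMr// mulrC -ler_pdivrMr//.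
Unshelve. all: by end_near. Qed.

Lemma integral_inv_sqr (A : R) : 0 < A ->
  (\int[mu1]_y (((y ^+ 2 + A ^+ 2)^-1 ^+ 2)%:E) = (pi / 2 / A ^+ 3)%:E)%E.
Proof.
move=> A0; have A2 : 0 < A ^+ 2 by rewrite exprn_gt0.
have N0 y : 0 < y ^+ 2 + A ^+ 2 by rewrite ltr_wpDl ?sqr_ge0.
have dN (y : R) : is_derive y 1 (fun y : R => y ^+ 2 + A ^+ 2) (2 * y).
  have d1 : is_derive y 1 (fun y : R => y ^+ 2 + A ^+ 2) _ :=
    is_deriveD (is_deriveX 2 (is_derive_id y 1)) (is_derive_cst (A ^+ 2) y 1).
  by apply: is_derive_eq d1 _; rewrite addr0 /GRing.scale /= mulr1 expr1 mulr_natl.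
have dV (y : R) : is_derive y 1 (fun y : R => (y ^+ 2 + A ^+ 2)^-1)
    (- ((y ^+ 2 + A ^+ 2) ^- 2) * (2 * y)).
  exact: (@is_deriveV R (fun y : R => y ^+ 2 + A ^+ 2) y _ 1 (lt0r_neq0 (N0 y)) (dN y)).
have dA (y : R) : is_derive y 1 (fun y : R =>
  atan (y / A)) ((1 + (y / A) ^+ 2)^-1 * A^-1).
  have d1 : is_derive y 1 (fun y : R => y / A) A^-1.
    have d2 : is_derive y 1 (fun y : R => y / A) _ :=
      is_deriveM (is_derive_id y 1) (is_derive_cst A^-1 y 1).
    by apply: is_derive_eq d2 _; rewrite /GRing.scale /= mulr0 add0r mulr1.
  exact: (@is_derive1_comp R atan (fun y => y / A) y _ _ (is_derive1_atan _) d1).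
(* The classical antiderivative; being odd, it needs its limit at +oo only. *)
pose F y : R := (2 * A ^+ 2)^-1 * (y / (y ^+ 2 + A ^+ 2)) + (2 * A ^+ 3)^-1 * atan (y /
  A).
have dF (y : R) : is_derive y 1 F ((y ^+ 2 + A ^+ 2)^-1 ^+ 2).
  have d1 : is_derive y 1 F _ := is_deriveD
    (is_deriveZ (2 * A ^+ 2)^-1 (is_deriveM (is_derive_id y 1) (dV y)))
    (is_deriveZ (2 * A ^+ 3)^-1 (dA y)).
  apply: is_derive_eq d1 _; rewrite /GRing.scale /=.
  rewrite /= !mulr1; field.
  by rewrite !gt_eqF// addrC.
have cf : continuous (fun y : R => (y ^+ 2 + A ^+ 2)^-1 ^+ 2).
  move=> y; apply/differentiable_continuous/derivable1_diffP.
  by have [] := is_deriveX 2 (dV y).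
have FN y : F (- y) = - F y.
  by rewrite /F sqrrN !mulNr atanN !mulrN -opprD.
have cF : F x @[x --> +oo] --> pi / 4 / A ^+ 3.
  have -> : pi / 4 / A ^+ 3 = (2 * A ^+ 2)^-1 * 0 + (2 * A ^+ 3)^-1 * (pi / 2).
    by field; rewrite gt_eqF.
  apply: cvgD; apply: cvgMr.
    apply: (@cvg_pinfty_le _ _ 1) => x x0; rewrite subr0 ger0_norm.
      rewrite ler_pdivrMr//.
      have -> : 1 / x * (x ^+ 2 + A ^+ 2) = x + A ^+ 2 / x by field; rewrite gt_eqF.
      by rewrite lerDl divr_ge0// ltW.
    by rewrite divr_ge0// ltW.
  apply: (cvg_comp (fun y => y / A) atan); last exact: cvgy_atan.
  apply/cvgryPge => X; near=> y; rewrite ler_pdivlMr//.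
rewrite (@integralT_FTC _ F (pi / 4 / A ^+ 3) (- (pi / 4 / A ^+ 3)))//.
- by congr EFin; lra.
- by move=> y; rewrite sqr_ge0.
- by under eq_fun do rewrite FN; exact: cvgN.
Unshelve. all: by end_near. Qed.

Lemma cvg_div_sqrt (eps b : R) : 0 < eps ->
  (x + b) / Num.sqrt ((x + b) ^+ 2 + eps ^+ 2) @[x --> +oo] --> (1 : R).
Proof.
move=> e0; pose S t : R := t / Num.sqrt (t ^+ 2 + eps ^+ 2).
apply: (cvg_comp (fun x : R => x + b) S).
  by apply/cvgryPge => X; near=> y; rewrite -lerBlDr.
apply: (@cvg_pinfty_le _ _ eps) => t t0; rewrite /S.
have s0 : 0 < Num.sqrt (t ^+ 2 + eps ^+ 2) by rewrite sqrtr_gt0 addr_gt0 ?exprn_gt0.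
have ts : t <= Num.sqrt (t ^+ 2 + eps ^+ 2).
  by rewrite -[leLHS]gtr0_norm// -sqrtr_sqr ler_wsqrtr// lerDl sqr_ge0.
have st : Num.sqrt (t ^+ 2 + eps ^+ 2) <= t + eps.
  rewrite -[leRHS]gtr0_norm ?addr_gt0// -sqrtr_sqr ler_wsqrtr//.
  by rewrite sqrrD lerD2r lerDl mulrn_wge0// mulr_ge0// ltW.
move: (Num.sqrt _) s0 ts st => s s0 ts st.
rewrite distrC ger0_norm; last by rewrite subr_ge0 ler_pdivrMr// mul1r.
have -> : 1 - t / s = (s - t) / s by field; rewrite gt_eqF.
rewrite ler_pdivrMr// (@le_trans _ _ eps)//; first by lra.
by rewrite mulrAC ler_pdivlMr// ler_wpM2l// ltW.
Unshelve. all: by end_near. Qed.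

(* The zbar-derivative of [reg_cauchy eps a] below. *)
Definition approx_delta (eps a : R) (p : R * R) : R :=
  eps ^+ 2 * ((p.1 - a) ^+ 2 + p.2 ^+ 2 + eps ^+ 2)^-1 ^+ 2.

Lemma measurable_approx_delta eps a :
  measurable_fun [set: R2] (approx_delta eps a : R2 -> R).
Proof.
apply: (measurable_funM (f := cst _)) => //; apply: measurable_funX.
apply: mfun_inv_ge0 => [p|]; first by rewrite !addr_ge0 ?sqr_ge0.
apply: (measurable_funD (g := cst _)) => //; apply: measurable_funD.
  by apply: measurable_funX; apply: (measurable_funB (g := cst a)) => //;
    exact: measurable_fst.
by apply: measurable_funX; exact: measurable_snd.
Qed.

(** Tonelli in Cartesian coordinates: integrating out y leaves (pi/2) eps^2 / A^3, where A^2 = (x -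
    a)^2 + eps^2. An antiderivative of this is (pi/2) (x - a) / A, which runs from -pi/2 to pi/2. *)
Lemma approx_delta_mass eps a : 0 < eps ->
  (lebesgue2 R).-integrable setT (EFin \o approx_delta eps a) /\
  \int[lebesgue2 R]_p approx_delta eps a p = pi.
Proof.
move=> e0.
have D0 p : 0 <= approx_delta eps a p by rewrite mulr_ge0 ?sqr_ge0.
have mD : measurable_fun [set: R2] (EFin \o approx_delta eps a : R2 -> \bar R).
  by apply/measurable_EFinP; exact: measurable_approx_delta.
suff E : (\int[lebesgue2 R]_p (approx_delta eps a p)%:E = pi%:E)%E.
  split; last by rewrite /Rintegral E.
  apply/integrableP; split => //.
  under eq_integral do rewrite /= ger0_norm//.
  by rewrite E ltry.
have -> : (\int[lebesgue2 R]_p (approx_delta eps a p)%:E =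
   \int[mu1]_x \int[mu1]_y (approx_delta eps a (x, y))%:E)%E.
  exact: (fubini_tonelli1 _ mD).
pose A (x : R) := Num.sqrt ((x - a) ^+ 2 + eps ^+ 2).
have q0 (x : R) : 0 < (x - a) ^+ 2 + eps ^+ 2 by rewrite ltr_wpDl ?sqr_ge0 ?exprn_gt0.
have A0 x : 0 < A x by rewrite sqrtr_gt0.
have A2 x : A x ^+ 2 = (x - a) ^+ 2 + eps ^+ 2 by rewrite sqr_sqrtr// ltW.
have inner (x : R) : (\int[mu1]_y (approx_delta eps a (x, y))%:E =
    (pi / 2 * (eps ^+ 2 / A x ^+ 3))%:E)%E.
  have -> : (pi / 2 * (eps ^+ 2 / A x ^+ 3))%:E =
    ((eps ^+ 2)%:E * (pi / 2 / A x ^+ 3)%:E)%E.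
    by rewrite -EFinM; congr EFin; ring.
  rewrite -integral_inv_sqr// -ge0_integralZl_EFin//.
  - apply: eq_integral => y _; rewrite -EFinM; congr EFin.
    by rewrite /approx_delta /= A2 addrCA addrA.
  - by move=> y _; rewrite lee_fin sqr_ge0.
  - apply/measurable_EFinP; apply: measurable_funX; apply: mfun_inv_ge0.
      by move=> y; rewrite addr_ge0 ?sqr_ge0.
    by apply: (measurable_funD (g := cst _)) => //; exact: measurable_funX.
  - exact: sqr_ge0.
under eq_integral do rewrite inner.
have dq (x : R) : is_derive x 1 (fun x : R => (x - a) ^+ 2 + eps ^+ 2) (2 * (x - a)).
  have d1 : is_derive x 1 (fun x : R => (x - a) ^+ 2 + eps ^+ 2) _ :=
    is_deriveD (is_deriveX 2 (is_deriveB (is_derive_id x 1) (is_derive_cst a x 1)))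
      (is_derive_cst (eps ^+ 2) x 1).
  by apply: is_derive_eq d1 _; rewrite subr0 addr0 /GRing.scale /= mulr1 expr1 mulr_natl.
have dA (x : R) : is_derive x 1 A ((x - a) / A x).
  have d1 := @is_derive1_comp R Num.sqrt (fun x => (x - a) ^+ 2 + eps ^+ 2) x _ _
    (is_derive1_sqrt (q0 x)) (dq x).
  by apply: is_derive_eq d1 _; rewrite -/(A x); field; rewrite gt_eqF.
have dV (x : R) := @is_deriveV R A x _ 1 (lt0r_neq0 (A0 x)) (dA x).
pose F (x : R) : R := pi / 2 * ((x - a) / A x).
have dF (x : R) : is_derive x 1 F (pi / 2 * (eps ^+ 2 / A x ^+ 3)).
  have d1 : is_derive x 1 F _ := is_deriveZ (pi / 2)
    (is_deriveM (is_deriveB (is_derive_id x 1) (is_derive_cst a x 1)) (dV x)).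
  apply: is_derive_eq d1 _; rewrite /GRing.scale /= subr0 mulr1.
  have -> : eps ^+ 2 = A x ^+ 2 - (x - a) ^+ 2 by rewrite A2; ring.
  rewrite (_ : (id - cst a) x = x - a)//.
  by field; rewrite gt_eqF.
rewrite (@integralT_FTC _ F (pi / 2) (- (pi / 2)))//.
- by congr EFin; lra.
- move=> x; apply: mulr_ge0; first by rewrite divr_ge0 ?pi_ge0.
  by apply: divr_ge0; [exact: sqr_ge0|rewrite exprn_ge0// ltW].
- move=> x; apply/differentiable_continuous/derivable1_diffP.
  have d1 : is_derive x 1 (fun y => (pi / 2 * eps ^+ 2) * (A y)^-1 ^+ 3) _ :=
    is_deriveZ (pi / 2 * eps ^+ 2) (is_deriveX 3 (dV x)).
  have -> : (fun y => pi / 2 * (eps ^+ 2 / A y ^+ 3)) =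
      (fun y => (pi / 2 * eps ^+ 2) * (A y)^-1 ^+ 3).
    by apply/funext => y; rewrite mulrA exprVn.
  by case: d1.
- rewrite -[X in _ --> X]mulr1; apply: cvgMr.
  exact: cvg_div_sqrt.
- rewrite -[X in _ --> X]mulr1 mulNr -mulrN; apply: cvgMr.
  have -> : (fun x : R => (- x - a) / A (- x)) =
     (fun x => - ((x + a) / Num.sqrt ((x + a) ^+ 2 + eps ^+ 2))).
    by apply/funext => x; rewrite /A -opprD sqrrN mulNr.
  by apply: cvgN; exact: cvg_div_sqrt.
Qed.

End PlaneMass.

(** * The Cauchy-Pompeiu formula *)

Section RegularizedKernel.
Variables (R : realType).
Local Notation R2 := (measurableTypeR R * measurableTypeR R)%type.
Implicit Types (eps a b : R) (p : R * R).

(** Written with products instead of squares to match the constructors of [smooth2]. *)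
Definition reg_den eps a p : R := (p.1 - a) * (p.1 - a) + p.2 * p.2 + eps ^+ 2.

(* [conj (z - a) / (|z - a|^2 + eps^2)] at [z = toC p]. *)
Definition reg_cauchy eps a p : R[i] :=
  ((p.1 - a) * (reg_den eps a p)^-1) +i* (-1 * p.2 * (reg_den eps a p)^-1).

Lemma reg_den_gt0 eps a p : 0 < eps -> 0 < reg_den eps a p.
Proof.
by move=> e0; rewrite ltr_wpDl ?exprn_gt0// addr_ge0// -expr2 sqr_ge0.
Qed.

Lemma nc_sqr (z : R[i]) : nc z ^+ 2 = complex.Re z * complex.Re z + complex.Im z *
  complex.Im z.
Proof.
by case: z => x y; rewrite /Normc.normc sqr_sqrtr ?addr_ge0 ?sqr_ge0// -!expr2.
Qed.

Lemma reg_denE eps a p : reg_den eps a p = nc (toC p - a%:C) ^+ 2 + eps ^+ 2.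
Proof. by rewrite nc_sqr cReB cImB /= subr0. Qed.

Lemma reg_cauchyE eps a p : reg_cauchy eps a p =
  conjc (toC p - a%:C) * ((reg_den eps a p)^-1)%:C.
Proof.
rewrite /reg_cauchy; move: (reg_den _ _ _) => d.
apply: ReIm_eq; rewrite ?cReM ?cImM /=; case: p => x y /=; ring.
Qed.

Lemma nc_conj (z : R[i]) : nc (conjc z) = nc z.
Proof. by apply: complexI; rewrite -!norm_nc normcJ. Qed.

Lemma nc_reg_cauchy eps a p : 0 < eps -> nc (reg_cauchy eps a p) =
  nc (toC p - a%:C) / (nc (toC p - a%:C) ^+ 2 + eps ^+ 2).
Proof.
move=> e0; rewrite reg_cauchyE Normc.normcM nc_conj nc_real reg_denE.
by rewrite ger0_norm// invr_ge0 addr_ge0 ?sqr_ge0.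
Qed.

Lemma reg_cauchy_le eps a p : 0 < eps -> nc (reg_cauchy eps a p) <= eps^-1.
Proof.
move=> e0; rewrite nc_reg_cauchy//; have := nc_ge0 (toC p - a%:C).
move: (nc _) => r r0; rewrite ler_pdivrMr; last by rewrite ltr_wpDl ?sqr_ge0 ?exprn_gt0.
rewrite mulrC ler_pdivlMr//; nra.
Qed.

Lemma reg_cauchy_le_inv eps a p : 0 < eps -> 0 < nc (toC p - a%:C) ->
  nc (reg_cauchy eps a p) <= (nc (toC p - a%:C))^-1.
Proof.
move=> e0 r0; rewrite nc_reg_cauchy//; move: (nc _) r0 => r r0.
rewrite ler_pdivrMr; last by rewrite ltr_wpDl ?sqr_ge0 ?exprn_gt0.
by rewrite mulrC ler_pdivlMr// -expr2 lerDl sqr_ge0.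
Qed.

(** The exact error is - eps^2 / (r^2 + eps^2) times 1 / (z - a), with r = |z - a|. The bound serves
    both for fixed z and [eps] tending to 0, and for fixed [eps] and z tending to infinity. *)
Lemma reg_cauchy_dist eps a p : 0 < eps -> 0 < nc (toC p - a%:C) ->
  nc (reg_cauchy eps a p - (toC p - a%:C)^-1) <= eps ^+ 2 / nc (toC p - a%:C) ^+ 3.
Proof.
move=> e0; rewrite reg_cauchyE reg_denE; move: (toC p - a%:C) => z z0.
set r := nc z in z0 *; set d := r ^+ 2 + eps ^+ 2.
have d0 : 0 < d by rewrite ltr_wpDl ?sqr_ge0 ?exprn_gt0.
have zN0 : z != 0 by apply: contraTneq z0 => e; rewrite /r e nc0 ltxx.
have zz : z * conjc z = (r ^+ 2)%:C by rewrite -sqr_normc norm_nc rmorphXn.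
have -> : conjc z * (d^-1)%:C - z^-1 = - (eps ^+ 2 * d^-1)%:C * z^-1.
  apply: (mulfI zN0); rewrite mulrBr mulrA zz mulfV// mulrCA mulfV// mulr1.
  rewrite -rmorphM -[1]/(1%:C) -rmorphB -rmorphN; congr (_%:C) => /=.
  by rewrite /d; field; rewrite gt_eqF.
rewrite Normc.normcM ncN nc_real Normc.normcV -/r ger0_norm; last first.
  by rewrite mulr_ge0 ?sqr_ge0// invr_ge0 ltW.
rewrite -mulrA ler_wpM2l ?sqr_ge0// -invfM lef_pV2 ?posrE ?mulr_gt0 ?exprn_gt0//.
by rewrite exprSr ler_wpM2r ?(ltW z0)// lerDl sqr_ge0.
Qed.

Lemma smooth2_reg_den eps a : smooth2 (reg_den eps a).
Proof.
have s1 : smooth2 (fun p => p.1 - a) := smooth2D (smooth2_fst R) (smooth2_cst (- a)).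
exact: (smooth2D (smooth2D (smooth2M s1 s1) (smooth2M (smooth2_snd R) (smooth2_snd R)))
  (smooth2_cst (eps ^+ 2))).
Qed.

Lemma smooth2_reg_denV eps a : 0 < eps -> smooth2 (fun p => (reg_den eps a p)^-1).
Proof.
move=> e0; apply: smooth2V; first exact: smooth2_reg_den.
by move=> p; rewrite gt_eqF ?reg_den_gt0.
Qed.

Lemma smooth2_reg_Re eps a : 0 < eps -> smooth2 (ReF (reg_cauchy eps a)).
Proof.
move=> e0; have s1 : smooth2 (fun p => p.1 - a) :=
  smooth2D (smooth2_fst R) (smooth2_cst (- a)).
exact: (smooth2M s1 (smooth2_reg_denV a e0)).
Qed.

Lemma smooth2_reg_Im eps a : 0 < eps -> smooth2 (ImF (reg_cauchy eps a)).
Proof.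
move=> e0; exact: (smooth2M (smooth2M (smooth2_cst (-1)) (smooth2_snd R))
  (smooth2_reg_denV a e0)).
Qed.

Lemma derive_reg_den eps a p v :
  'D_v (reg_den eps a) p = 2 * (p.1 - a) * v.1 + 2 * p.2 * v.2.
Proof.
have s1 : smooth2 (fun p => p.1 - a) := smooth2D (smooth2_fst R) (smooth2_cst (- a)).
have e1 : 'D_v (fun p => p.1 - a) p = v.1.
  rewrite (smooth2_deriveD p v (smooth2_fst R) (smooth2_cst (- a))).
  by rewrite derive_fst derive_cst addr0.
rewrite (smooth2_deriveD p v (smooth2D (smooth2M s1 s1) (smooth2M (smooth2_snd R)
  (smooth2_snd R))) (smooth2_cst (eps ^+ 2))).
rewrite (smooth2_deriveD p v (smooth2M s1 s1) (smooth2M (smooth2_snd R) (smooth2_snd R))).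
rewrite (smooth2_deriveM p v s1 s1) (smooth2_deriveM p v (smooth2_snd R) (smooth2_snd R)).
by rewrite e1 derive_snd derive_cst; ring.
Qed.

Lemma derive_reg_Re eps a p v : 0 < eps ->
  'D_v (ReF (reg_cauchy eps a)) p = v.1 / reg_den eps a p -
   (p.1 - a) * (2 * (p.1 - a) * v.1 + 2 * p.2 * v.2) / reg_den eps a p ^+ 2.
Proof.
move=> e0; have s1 : smooth2 (fun p => p.1 - a) :=
  smooth2D (smooth2_fst R) (smooth2_cst (- a)).
have e1 : 'D_v (fun p => p.1 - a) p = v.1.
  rewrite (smooth2_deriveD p v (smooth2_fst R) (smooth2_cst (- a))).
  by rewrite derive_fst derive_cst addr0.
rewrite (smooth2_deriveM p v s1 (smooth2_reg_denV a e0)).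
rewrite smooth2_deriveV ?e1 ?derive_reg_den; last 2 first.
- exact: smooth2_reg_den.
- by move=> q; rewrite gt_eqF ?reg_den_gt0.
by field; rewrite gt_eqF ?reg_den_gt0.
Qed.

Lemma derive_reg_Im eps a p v : 0 < eps ->
  'D_v (ImF (reg_cauchy eps a)) p = - v.2 / reg_den eps a p +
   p.2 * (2 * (p.1 - a) * v.1 + 2 * p.2 * v.2) / reg_den eps a p ^+ 2.
Proof.
move=> e0; have s1 := smooth2M (smooth2_cst (-1)) (smooth2_snd R).
have e1 : 'D_v (fun p : R * R => -1 * p.2) p = - v.2.
  rewrite (smooth2_deriveM p v (smooth2_cst (-1)) (smooth2_snd R)).
  by rewrite derive_snd derive_cst; ring.
rewrite (smooth2_deriveM p v s1 (smooth2_reg_denV a e0)).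
rewrite smooth2_deriveV ?e1 ?derive_reg_den; last 2 first.
- exact: smooth2_reg_den.
- by move=> q; rewrite gt_eqF ?reg_den_gt0.
by field; rewrite gt_eqF ?reg_den_gt0.
Qed.

(** This is the real part of twice the zbar-derivative of E_a, and [reg_cauchy_dbar2] is the
    imaginary part. *)
Lemma reg_cauchy_dbar1 eps a p : 0 < eps ->
  'D_(1, 0) (ReF (reg_cauchy eps a)) p - 'D_(0, 1) (ImF (reg_cauchy eps a)) p =
  2 * approx_delta eps a p.
Proof.
move=> e0; rewrite derive_reg_Re// derive_reg_Im//= /approx_delta.
have := reg_den_gt0 a p e0; rewrite /reg_den -!expr2 => d0.
by field; rewrite gt_eqF.
Qed.

Lemma reg_cauchy_dbar2 eps a p : 0 < eps ->
  'D_(1, 0) (ImF (reg_cauchy eps a)) p + 'D_(0, 1) (ReF (reg_cauchy eps a)) p = 0.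
Proof.
move=> e0; rewrite derive_reg_Re// derive_reg_Im//=.
by field; rewrite gt_eqF ?reg_den_gt0.
Qed.

(* The cutoff is not locally constant near the origin; it only tends to the
   constant [flat_exp 1 1 = exp(-1)] as [n] grows, which is enough. *)
Definition cutoff_arg (n : nat) p : R :=
  1 + - (n.+1%:R ^- 2) * (p.1 * p.1 + p.2 * p.2).
Definition cutoff n p : R := flat_exp 1 (cutoff_arg n p).
(** The zbar-derivative of [cutoff n]: that of |z|^2 is z, and the polynomial is the one of
    [is_derive_flat_exp] for P = 1. *)
Definition cutoff_dbar n p : R[i] :=
  (- (n.+1%:R ^- 2) * flat_exp ('X^2 * (1 - 1^`())) (cutoff_arg n p))%:C * toC p.

Lemma smooth2_cutoff_arg n : smooth2 (cutoff_arg n).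
Proof.
exact: (smooth2D (smooth2_cst 1) (smooth2M (smooth2_cst _)
  (smooth2D (smooth2M (smooth2_fst R) (smooth2_fst R))
            (smooth2M (smooth2_snd R) (smooth2_snd R))))).
Qed.

Lemma smooth2_cutoff n : smooth2 (cutoff n).
Proof. exact/smooth2_flat/smooth2_cutoff_arg. Qed.

Lemma derive_cutoff n p v : 'D_v (cutoff n) p =
  flat_exp ('X^2 * (1 - 1^`())) (cutoff_arg n p) *
  (- (n.+1%:R ^- 2) * (2 * p.1 * v.1 + 2 * p.2 * v.2)).
Proof.
rewrite smooth2_derive_flat; last exact: smooth2_cutoff_arg.
congr (_ * _).
have s1 := smooth2M (smooth2_fst R) (smooth2_fst R).
have s2 := smooth2M (smooth2_snd R) (smooth2_snd R).
rewrite (smooth2_deriveD p v (smooth2_cst 1) (smooth2M (smooth2_cst _) (smooth2D s1 s2))).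
rewrite (smooth2_deriveM p v (smooth2_cst _) (smooth2D s1 s2)).
rewrite (smooth2_deriveD p v s1 s2).
rewrite (smooth2_deriveM p v (smooth2_fst R) (smooth2_fst R)).
rewrite (smooth2_deriveM p v (smooth2_snd R) (smooth2_snd R)).
by rewrite derive_fst derive_snd !derive_cst; ring.
Qed.

Lemma cutoff_arg_le0 n p : n.+1%:R <= nc (toC p) -> cutoff_arg n p <= 0.
Proof.
move=> np; rewrite /cutoff_arg mulNr subr_le0 mulrC ler_pdivlMr ?exprn_gt0// mul1r.
have := nc_sqr (toC p); rewrite /= => <-.
by rewrite lerXn2r ?nnegrE ?nc_ge0.
Qed.

Lemma cutoff_supp n p : n.+1%:R <= nc (toC p) -> cutoff n p = 0.
Proof. by move=> /cutoff_arg_le0; rewrite /cutoff /flat_exp leNgt => /negbTE ->. Qed.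

Lemma cutoff_dbar_supp n p : n.+1%:R <= nc (toC p) -> cutoff_dbar n p = 0.
Proof.
move=> /cutoff_arg_le0; rewrite /cutoff_dbar /flat_exp leNgt => /negbTE ->.
by rewrite mulr0 mul0r.
Qed.

Definition cut_kernel n eps a b p : R[i] :=
  (cutoff n p)%:C * (reg_cauchy eps a p - reg_cauchy eps b p).

Lemma cut_kernel_Re n eps a b : ReF (cut_kernel n eps a b) = fun p =>
  cutoff n p * (ReF (reg_cauchy eps a) p + -1 * ReF (reg_cauchy eps b) p).
Proof. by apply/funext => p; rewrite /ReF cReMl cReB mulN1r. Qed.

Lemma cut_kernel_Im n eps a b : ImF (cut_kernel n eps a b) = fun p =>
  cutoff n p * (ImF (reg_cauchy eps a) p + -1 * ImF (reg_cauchy eps b) p).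
Proof. by apply/funext => p; rewrite /ImF cImMl cImB mulN1r. Qed.

Lemma cut_kernel_test n eps a b : 0 < eps -> test_plane (cut_kernel n eps a b).
Proof.
move=> e0; split.
  apply: smooth2_plane; rewrite ?cut_kernel_Re ?cut_kernel_Im; apply: smooth2M;
    try exact: smooth2_cutoff.
  - apply: smooth2D; first exact: smooth2_reg_Re.
    by apply: smooth2M; [exact: smooth2_cst|exact: smooth2_reg_Re].
  - apply: smooth2D; first exact: smooth2_reg_Im.
    by apply: smooth2M; [exact: smooth2_cst|exact: smooth2_reg_Im].
exists n.+1%:R => p np; rewrite /cut_kernel cutoff_supp ?mul0r//.
apply: le_trans (ltW np) _; rewrite ge_max.
by rewrite (Re_nc (toC p)) (Im_nc (toC p)).
Qed.

Lemma cut_kernel_dbar n eps a b p : 0 < eps ->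
  dbar (cut_kernel n eps a b) p =
  (cutoff n p * (approx_delta eps a p - approx_delta eps b p))%:C +
  cutoff_dbar n p * (reg_cauchy eps a p - reg_cauchy eps b p).
Proof.
move=> e0; have sc := smooth2_cutoff n.
have sNR := smooth2M (smooth2_cst (-1)) (smooth2_reg_Re b e0).
have sNI := smooth2M (smooth2_cst (-1)) (smooth2_reg_Im b e0).
have sR := smooth2D (smooth2_reg_Re a e0) sNR.
have sI := smooth2D (smooth2_reg_Im a e0) sNI.
have DR v : 'D_v (ReF (cut_kernel n eps a b)) p =
    cutoff n p * ('D_v (ReF (reg_cauchy eps a)) p - 'D_v (ReF (reg_cauchy eps b)) p) +
    (ReF (reg_cauchy eps a) p - ReF (reg_cauchy eps b) p) * 'D_v (cutoff n) p.
  rewrite cut_kernel_Re (smooth2_deriveM p v sc sR).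
  rewrite (smooth2_deriveD p v (smooth2_reg_Re a e0) sNR).
  rewrite (smooth2_deriveM p v (smooth2_cst (-1)) (smooth2_reg_Re b e0)).
  by rewrite derive_cst; ring.
have DI v : 'D_v (ImF (cut_kernel n eps a b)) p =
    cutoff n p * ('D_v (ImF (reg_cauchy eps a)) p - 'D_v (ImF (reg_cauchy eps b)) p) +
    (ImF (reg_cauchy eps a) p - ImF (reg_cauchy eps b) p) * 'D_v (cutoff n) p.
  rewrite cut_kernel_Im (smooth2_deriveM p v sc sI).
  rewrite (smooth2_deriveD p v (smooth2_reg_Im a e0) sNI).
  rewrite (smooth2_deriveM p v (smooth2_cst (-1)) (smooth2_reg_Im b e0)).
  by rewrite derive_cst; ring.
have a1 := reg_cauchy_dbar1 a p e0; have a2 := reg_cauchy_dbar2 a p e0.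
have b1 := reg_cauchy_dbar1 b p e0; have b2 := reg_cauchy_dbar2 b p e0.
have h2 : (2^-1 : R[i]) = (2^-1 : R)%:C by rewrite fmorphV rmorph_nat.
have c1 := derive_cutoff n p (1, 0); have c2 := derive_cutoff n p (0, 1).
rewrite /= !(mulr1, mulr0, addr0, add0r) in c1 c2.
rewrite /dbar /plane_deriv !DR !DI h2 c1 c2 /cutoff_dbar.
(* What remains is algebra in the eight partial derivatives of the two kernels, generalized here and
   tied together by [a1], [a2], [b1], [b2]. *)
move: a1 a2 b1 b2.
move: ('D_(1, 0) (ReF (reg_cauchy eps a)) p) ('D_(0, 1) (ReF (reg_cauchy eps a)) p).
move=> aR1 aR2.
move: ('D_(1, 0) (ImF (reg_cauchy eps a)) p) ('D_(0, 1) (ImF (reg_cauchy eps a)) p).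
move=> aI1 aI2.
move: ('D_(1, 0) (ReF (reg_cauchy eps b)) p) ('D_(0, 1) (ReF (reg_cauchy eps b)) p).
move=> bR1 bR2.
move: ('D_(1, 0) (ImF (reg_cauchy eps b)) p) ('D_(0, 1) (ImF (reg_cauchy eps b)) p).
move=> bI1 bI2 a1 a2 b1 b2.
rewrite /ReF /ImF; move: (cutoff n p) (flat_exp _ _) (n.+1%:R ^- 2) => c0 c d.
have -> : aI1 = - aR2 by lra.
have -> : bI1 = - bR2 by lra.
have -> : approx_delta eps a p = (aR1 - aI2) / 2 by rewrite a1; field.
have -> : approx_delta eps b p = (bR1 - bI2) / 2 by rewrite b1; field.
case: (reg_cauchy eps a p) (reg_cauchy eps b p) => [A1 A2] [B1 B2].
by apply: ReIm_eq; rewrite !(cReM, cImM, cReD, cImD, cReB, cImB) /=; field.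
Qed.

End RegularizedKernel.

Section ContinuousComplex.
Variable R : realType.
Local Notation R2 := (measurableTypeR R * measurableTypeR R)%type.
Implicit Type ft : R[i]^o -> R[i]^o.

Lemma continuous_nc ft (z : R[i]) (e : R) : continuous ft -> 0 < e ->
  exists2 d : R, 0 < d & forall w : R[i], nc (w - z) < d -> nc (ft w - ft z) <= e.
Proof.
move=> cft e0; have e0C : 0 < (e%:C : R[i]) by rewrite ltcR.
have /cvgrPdist_le /(_ _ e0C) /nbhs_ballP[d /= d0 H] := cft z.
have dE : d = (complex.Re d)%:C by rewrite RRe_real// gtr0_real.
exists (complex.Re d); first by rewrite -ltcR -dE.
move=> w wz; have := H w; rewrite /ball /= !norm_nc dE ltcR lecR => H'.
by rewrite nc_distC; apply: H'; rewrite nc_distC.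
Qed.

Lemma mfunC_continuous ft : continuous ft -> mfunC (fun p : R2 => ft (toC p)).
Proof.
move=> cft.
have cfst : continuous (fst : R * R -> R) by case=> x y; exact: cvg_fst.
have csnd : continuous (snd : R * R -> R) by case=> x y; exact: cvg_snd.
have key (p : R * R) (e : R) : 0 < e ->
    \forall q \near p, nc (ft (toC q) - ft (toC p)) <= e.
  move=> e0; have [d d0 H] := continuous_nc (toC p) cft e0.
  have d2 : 0 < d / 2 by rewrite divr_gt0.
  have c1 := proj1 (cvgrPdist_lt _ _) (cfst p) _ d2.
  have c2 := proj1 (cvgrPdist_lt _ _) (csnd p) _ d2.
  near=> q; apply: H; apply: le_lt_trans (nc_ReIm _) _; rewrite cReB cImB /=.
  have q1 : `|q.1 - p.1| < d / 2.
    by rewrite distrC; near: q; exact: c1.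
  have q2 : `|q.2 - p.2| < d / 2.
    by rewrite distrC; near: q; exact: c2.
  by rewrite (splitr d) ltrD.
split; apply: continuous_measurable2 => p; apply/cvgrPdist_le => e e0;
  apply: filterS (key p e e0) => q; apply: le_trans; rewrite distrC.
- by rewrite /ReF -cReB Re_nc.
- by rewrite /ImF -cImB Im_nc.
Unshelve. all: by end_near. Qed.

End ContinuousComplex.

(** * Concentration of the approximate identity *)

Section ApproximateDelta.
Variables (R : realType) (ft : R[i]^o -> R[i]^o) (Mf : R).
Local Notation R2 := (measurableTypeR R * measurableTypeR R)%type.
Local Notation mu := (lebesgue2 R).
Hypothesis cft : continuous ft.
Hypothesis bft : forall z, nc (ft z) <= Mf.

Lemma Mf_ge0 : 0 <= Mf. Proof. exact: le_trans (nc_ge0 _) (bft 0). Qed.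

Lemma approx_delta_ge0 eps (a : R) p : 0 <= approx_delta eps a p.
Proof. by rewrite mulr_ge0 ?sqr_ge0. Qed.

Lemma mfunC_approx_delta eps (a : R) : mfunC (fun p : R2 => (approx_delta eps a p)%:C).
Proof. by apply: mfunC_real; exact: measurable_approx_delta. Qed.

Lemma intgC_approx_delta (k : R[i] -> R[i]) (C eps a : R) : 0 < eps ->
  mfunC (fun p : R2 => k (toC p)) -> (forall z, nc (k z) <= C) ->
  intgC (fun p : R2 => k (toC p) * (approx_delta eps a p)%:C).
Proof.
move=> e0 mk kC; have [i1 _] := approx_delta_mass a e0; have [i2 _] := RintegralZ C i1.
apply: intgC_dom i2.
  by apply: mfunCM => //; exact: mfunC_approx_delta.
move=> p; rewrite Normc.normcM nc_real ger0_norm ?approx_delta_ge0//.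
by rewrite ler_wpM2r ?approx_delta_ge0.
Qed.

(** Away from a the profile is at most a multiple eps^2 of the profile at scale 1, whose mass is
    known; the tail is thus O(eps^2) without a separate integral. *)
Lemma approx_delta_far eps (a d : R) p : 0 < eps -> 0 < d ->
  d <= nc (toC p - a%:C) ->
  approx_delta eps a p <= eps ^+ 2 * ((1 + d ^+ 2) / d ^+ 2) ^+ 2 * approx_delta 1 a p.
Proof.
move=> e0 d0 dp; rewrite /approx_delta expr1n mul1r -mulrA ler_wpM2l ?sqr_ge0//.
have -> : (p.1 - a) ^+ 2 + p.2 ^+ 2 = nc (toC p - a%:C) ^+ 2.
  by rewrite nc_sqr cReB cImB /= subr0 -!expr2.
move: (nc _) dp => r dr; have r0 : 0 < r by exact: lt_le_trans dr.
have r2 : d ^+ 2 <= r ^+ 2 by rewrite lerXn2r ?nnegrE ?(ltW d0) ?(ltW r0).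
have d2 : 0 < d ^+ 2 by rewrite exprn_gt0.
move: (r ^+ 2) (d ^+ 2) r2 d2 (exprn_gt0 2 e0) => s t ts t0 es.
have s0 : 0 < s by exact: lt_le_trans ts.
have base : (s + eps ^+ 2)^-1 <= (1 + t) / t * (s + 1)^-1.
  rewrite ler_pdivlMr ?addr_gt0// mulrC ler_pdivrMr ?addr_gt0//.
  by rewrite mulrAC ler_pdivlMr//; nra.
have l0 : 0 <= (s + eps ^+ 2)^-1 by rewrite invr_ge0 addr_ge0// ltW.
by rewrite -exprMn lerXn2r ?nnegrE// (le_trans l0 base).
Qed.

Lemma approx_delta_limit (a e : R) : 0 < e -> \forall n \near \oo,
  nc (integral2C (fun p : R2 => ft (toC p) * (approx_delta n.+1%:R^-1 a p)%:C) -
      pi%:C * ft a%:C) <= e.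
Proof.
move=> e0; have pi0 := pi_gt0 R.
(* The near part contributes [e1] and the far part K * eps^2 <= e1, each times the mass pi; the
   remaining factor 2 is that of [integral2C_le]. *)
pose e1 := e / (4 * pi); have e10 : 0 < e1 by rewrite divr_gt0 ?mulr_gt0.
have [d d0 Hd] := continuous_nc a%:C cft e10.
pose K := 2 * Mf * ((1 + d ^+ 2) / d ^+ 2) ^+ 2.
have K0 : 0 <= K.
  have q0 : 0 <= (1 + d ^+ 2) / d ^+ 2 by rewrite divr_ge0 ?addr_ge0 ?sqr_ge0.
  by apply: mulr_ge0; [rewrite mulr_ge0 ?Mf_ge0|exact: exprn_ge0].
have K1 : 0 < K + 1 by rewrite ltr_wpDl.
have eK : 0 < e1 / (K + 1) by rewrite divr_gt0.
near=> n.
set eps : R := n.+1%:R^-1.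
have eps0 : 0 < eps by rewrite invr_gt0.
have [i1 m1] := approx_delta_mass a eps0; have [i2 m2] := approx_delta_mass a (@ltr01 R).
have mft := mfunC_continuous cft.
have mcst (c : R[i]) : mfunC (fun _ : R2 => c) by exact: mfunC_cst.
have I1 := intgC_approx_delta a eps0 mft bft.
have I2 := intgC_approx_delta (k := fun=> ft a%:C) a eps0 (mcst _) (fun=> bft a%:C).
have E2 : integral2C (fun p : R2 => ft a%:C * (approx_delta eps a p)%:C) = pi%:C * ft
  a%:C.
  have n1 : nc (1 : R[i]) <= 1 by rewrite (nc_nat R 1).
  have I3 := intgC_approx_delta (k := fun=> 1) a eps0 (mcst _) (fun=> n1).
  have I4 : intgC (fun p : R2 => (approx_delta eps a p)%:C).
    by move: I3; under eq_fun do rewrite mul1r.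
  have [_ ->] := intgCZ (ft a%:C) I4; rewrite mulrC; congr (_ * _).
  apply: ReIm_eq => /=; first by rewrite -m1.
  by rewrite /ImF /= Rintegral_cst// mul0r.
rewrite -E2; have [I5 <-] := intgCB I1 I2.
have [j1 n1] := RintegralZ e1 i1; have [j2 n2] := RintegralZ (K * eps ^+ 2) i2.
pose bb p : R := e1 * approx_delta eps a p + K * eps ^+ 2 * approx_delta 1 a p.
have ib : mu.-integrable setT (EFin \o bb).
  exact: (integrableD measurableT j1 j2).
apply: le_trans (integral2C_le _ _ ib) _.
- apply: mfunCB; apply: mfunCM; first exact: mft.
  + exact: mfunC_approx_delta.
  + exact: mcst.
  + exact: mfunC_approx_delta.
- move=> p; rewrite -mulrBl Normc.normcM nc_real ger0_norm ?approx_delta_ge0//.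
  have [pd|pd] := ltP (nc (toC p - a%:C)) d.
    apply: (@le_trans _ _ (e1 * approx_delta eps a p)).
      by rewrite ler_wpM2r ?approx_delta_ge0 ?Hd.
    by rewrite lerDl (mulr_ge0 (mulr_ge0 K0 (sqr_ge0 _)) (approx_delta_ge0 _ _ _)).
  apply: (@le_trans _ _ (K * eps ^+ 2 * approx_delta 1 a p)); last first.
    by rewrite lerDr mulr_ge0 ?approx_delta_ge0 ?ltW.
  have -> : K * eps ^+ 2 * approx_delta 1 a p = (2 * Mf) *
     (eps ^+ 2 * ((1 + d ^+ 2) / d ^+ 2) ^+ 2 * approx_delta 1 a p).
    by rewrite /K; ring.
  apply: ler_pM; rewrite ?nc_ge0 ?approx_delta_ge0 ?approx_delta_far//.
  by apply: le_trans (ncB _ _) _; rewrite mulr_natl mulr2n lerD.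
have -> : \int[mu]_p bb p = (e1 + K * eps ^+ 2) * pi.
  by rewrite /bb RintegralD// n1 n2 m1 m2 mulrDl.
have : K * eps ^+ 2 <= e1.
  apply: (@le_trans _ _ (K * eps)).
    rewrite ler_wpM2l// expr2 -[leRHS]mulr1 ler_wpM2l ?(ltW eps0)//.
    by rewrite invf_le1 ?ler1n.
  apply: (@le_trans _ _ ((K + 1) * eps)); first by rewrite ler_wpM2r ?(ltW eps0) ?lerDl.
  rewrite mulrC -ler_pdivlMr//; apply: ltW; rewrite /eps.
  near: n; exact: near_infty_natSinv_lt (PosNum eK).
move=> Ke; rewrite mulrA -ler_pdivlMr//.
have -> : e / pi = 4 * e1 by rewrite /e1 invfM mulrCA mulVKf.
lra.
Unshelve. all: by end_near. Qed.

End ApproximateDelta.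

(** * Vanishing of the contribution of the cutoff *)

Section CutoffTerm.
Variable R : realType.
Local Notation R2 := (measurableTypeR R * measurableTypeR R)%type.
Local Notation mu := (lebesgue2 R).
Implicit Types (eps a b : R).

Lemma smooth2_measurable (f : R * R -> R) : smooth2 f ->
  measurable_fun [set: R2] (f : R2 -> R).
Proof.
move=> sf; apply: continuous_measurable2 => p.
exact/differentiable_continuous/smooth2_diff.
Qed.

Lemma mfunC_reg_cauchy eps a : 0 < eps -> mfunC (reg_cauchy eps a : R2 -> R[i]).
Proof.
by move=> e0; split; apply: smooth2_measurable;
  [exact: smooth2_reg_Re|exact: smooth2_reg_Im].
Qed.

Lemma mfunC_cutoff n : mfunC (fun p : R2 => (cutoff n p)%:C).
Proof. by apply: mfunC_real; apply: smooth2_measurable; exact: smooth2_cutoff. Qed.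

Lemma mfunC_cutoff_dbar n : mfunC (cutoff_dbar n : R2 -> R[i]).
Proof.
apply: mfunCM; last exact: mfunC_toC.
apply: mfunC_real; apply: smooth2_measurable.
by apply: smooth2M; [exact: smooth2_cst|exact/smooth2_flat/smooth2_cutoff_arg].
Qed.

Lemma mu_disc_le (r : R) : 0 <= r -> fine (mu (disc r)) <= 4 * r ^+ 2.
Proof.
move=> r0; have E : mu (box r) = (4 * r ^+ 2)%:E.
  have -> : mu (box r) = (lebesgue_measure `[(- r)%R, r]%classic *
    lebesgue_measure `[(- r)%R, r]%classic)%E.
    by apply: product_measure1E; exact: measurable_itv.
  rewrite !lebesgue_measure_itv /= lte_fin; case: ifPn => rr.
    by rewrite -EFinB -EFinM; congr EFin; ring.
  rewrite mule0; congr EFin.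
  have -> : r = 0 by apply/eqP; rewrite eq_le r0 andbT; move: rr; rewrite -leNgt; lra.
  by rewrite expr0n mulr0.
rewrite -lee_fin fineK; last by rewrite ge0_fin_numE// mu_disc_fin.
rewrite -E; apply: le_measure; rewrite ?inE.
- exact: measurable_disc.
- exact: measurable_box.
move=> p pr; split => /=; rewrite in_itv /= -ler_norml; apply: le_trans pr.
  exact: (Re_nc (toC p)).
exact: (Im_nc (toC p)).
Qed.

Lemma nc_sub_ge (z : R[i]) a : `|a| <= nc z / 2 -> nc z / 2 <= nc (z - a%:C).
Proof.
move=> az; have : nc z <= nc (z - a%:C) + nc a%:C.
  by apply: le_trans (ncD _ _); rewrite subrK.
by rewrite nc_real; lra.
Qed.

(** The leading terms 1/z cancel: 1/(z - a) - 1/(z - b) is O(|z|^-2) and both regularization errors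
    are O(|z|^-3). The extra factor |z| on the left is the one carried by [cutoff_dbar]. *)
Lemma reg_cauchy_decay eps a b : 0 < eps -> exists K r0 : R, [/\ 0 <= K, 1 <= r0 &
  forall p, r0 <= nc (toC p) ->
   nc (toC p) * nc (reg_cauchy eps a p - reg_cauchy eps b p) <= K / nc (toC p)].
Proof.
(* The radius ensures |z - a| and |z - b| are at least |z| / 2; the cube of this 2, for two error
   terms, gives the 16, and its square gives the 4. *)
move=> e0; exists (16 * eps ^+ 2 + 4 * `|a - b|), (2 * (`|a| + `|b|) + 1); split.
- by apply: addr_ge0; apply: mulr_ge0 => //; exact: sqr_ge0.
- by rewrite lerDr; apply: mulr_ge0 => //; exact: addr_ge0.
move=> p pr; set r := nc (toC p) in pr *.
have [na nb] : 0 <= `|a| /\ 0 <= `|b| by [].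
have za : r / 2 <= nc (toC p - a%:C) by apply: nc_sub_ge; rewrite -/r; lra.
have zb : r / 2 <= nc (toC p - b%:C) by apply: nc_sub_ge; rewrite -/r; lra.
have r1 : 1 <= r by lra.
have r0 : 0 < r by lra.
have h0 : 0 < r / 2 by lra.
have da := reg_cauchy_dist e0 (lt_le_trans h0 za).
have db := reg_cauchy_dist e0 (lt_le_trans h0 zb).
have cube (s : R) : r / 2 <= s -> eps ^+ 2 / s ^+ 3 <= 8 * eps ^+ 2 / r ^+ 3.
  move=> rs; have -> : 8 * eps ^+ 2 / r ^+ 3 = eps ^+ 2 / (r / 2) ^+ 3.
    by field; rewrite gt_eqF.
  rewrite ler_wpM2l ?sqr_ge0// lef_pV2 ?posrE ?exprn_gt0 ?(lt_le_trans h0 rs)//.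
  by rewrite lerXn2r ?nnegrE ?(ltW h0)// (le_trans (ltW h0) rs).
have mid : nc ((toC p - a%:C)^-1 - (toC p - b%:C)^-1) <= 4 * `|a - b| / r ^+ 2.
  have zn (c : R) : r / 2 <= nc (toC p - c%:C) -> toC p - c%:C != 0.
    by move=> h; apply: contraTneq (lt_le_trans h0 h) => ->; rewrite nc0 ltxx.
  have -> : (toC p - a%:C)^-1 - (toC p - b%:C)^-1 =
     (a - b)%:C * ((toC p - a%:C)^-1 * (toC p - b%:C)^-1).
    by rewrite rmorphB /=; field; rewrite !zn.
  rewrite !Normc.normcM nc_real !Normc.normcV.
  have -> : 4 * `|a - b| / r ^+ 2 = `|a - b| * ((r / 2)^-1 * (r / 2)^-1).
    by field; rewrite gt_eqF.
  rewrite ler_wpM2l// ler_pM ?invr_ge0 ?nc_ge0// lef_pV2 ?posrE//;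
    exact: lt_le_trans h0 _.
have dist : nc (reg_cauchy eps a p - reg_cauchy eps b p) <=
    8 * eps ^+ 2 / r ^+ 3 + 4 * `|a - b| / r ^+ 2 + 8 * eps ^+ 2 / r ^+ 3.
  have -> : reg_cauchy eps a p - reg_cauchy eps b p =
    (reg_cauchy eps a p - (toC p - a%:C)^-1) +
    ((toC p - a%:C)^-1 - (toC p - b%:C)^-1) -
    (reg_cauchy eps b p - (toC p - b%:C)^-1) by ring.
  apply: le_trans (ncB _ _) (lerD _ _); last exact: le_trans db (cube _ zb).
  by apply: le_trans (ncD _ _) (lerD _ mid); exact: le_trans da (cube _ za).
apply: le_trans (ler_wpM2l (ltW r0) dist) _.
have -> : r * (8 * eps ^+ 2 / r ^+ 3 + 4 * `|a - b| / r ^+ 2 + 8 * eps ^+ 2 / r ^+ 3) =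
   (16 * eps ^+ 2 / r + 4 * `|a - b|) / r by field; rewrite gt_eqF.
rewrite ler_wpM2r ?invr_ge0 ?(ltW r0)// lerD2r ler_pdivrMr// ler_peMr//.
by rewrite mulr_ge0 ?sqr_ge0.
Qed.

Variables (ft : R[i]^o -> R[i]^o) (Mf : R).
Hypothesis cft : continuous ft.
Hypothesis bft : forall z, nc (ft z) <= Mf.

(** The prefactor (n+1)^-2 only balances the area of the support. Smallness comes from |z| |E_a -
    E_b| <= eta outside a disc independent of n, while that disc itself contributes O(n^-2). *)
Lemma cutoff_term_small eps a b e : 0 < eps -> 0 < e -> \forall n \near \oo,
  nc (integral2C (fun p : R2 => ft (toC p) *
     (cutoff_dbar n p * (reg_cauchy eps a p - reg_cauchy eps b p)))) <= e.
Proof.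
move=> eps0 e0.
have [C2 HC2] := flat_exp_le ('X^2 * (1 - 1^`()) : {poly R}).
have C20 : 0 <= C2 := le_trans (normr_ge0 _) (HC2 0).
have Mf0 : 0 <= Mf := Mf_ge0 bft.
have [K [r0 [K0 r01 HK]]] := reg_cauchy_decay a b eps0.
pose c := Mf * C2; have c0 : 0 <= c by rewrite mulr_ge0.
have c1 : 0 < 16 * c + 1 by rewrite ltr_wpDl// mulr_ge0.
(* The outer region yields at most 2 * (4 * c * eta) <= e / 2, the square of side 2(n+1) accounting
   for the 4; the inner disc gets the other half of e. *)
pose eta := e / (16 * c + 1); have eta0 : 0 < eta by rewrite divr_gt0.
pose r1 := Num.max r0 (K / eta).
have r10 : 0 < r1 by rewrite lt_max (lt_le_trans _ r01).
pose C' := r1 * (eps^-1 + eps^-1).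
have C'0 : 0 <= C' by rewrite mulr_ge0 ?addr_ge0 ?invr_ge0 // ltW.
have decay p : nc (toC p) * nc (reg_cauchy eps a p - reg_cauchy eps b p) <=
    eta + C' * \1_(disc r1 : set R2) p.
  have [pr|pr] := pselect (disc r1 p).
    rewrite indicE mem_set// mulr1 ler_wpDl ?(ltW eta0)//.
    rewrite ler_pM ?nc_ge0//; apply: le_trans (ncB _ _) _.
    by rewrite lerD ?reg_cauchy_le.
  rewrite indicE memNset// mulr0 addr0.
  have rp : r1 < nc (toC p) by rewrite ltNge; exact/negP.
  have rp0 : 0 < nc (toC p) := lt_trans r10 rp.
  apply: le_trans (HK p _) _.
    by apply: le_trans (ltW rp); rewrite le_max lexx.
  rewrite ler_pdivrMr// mulrC -ler_pdivrMr//; apply: le_trans (ltW rp).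
  by rewrite le_max lexx orbT.
have mr1 : 0 <= fine (mu (disc r1)) by rewrite fine_ge0.
have kap1 : 0 <= 4 * c * (C' * fine (mu (disc r1))) / e.
  apply: divr_ge0 (ltW e0); apply: mulr_ge0; last exact: mulr_ge0.
  by rewrite mulr_ge0.
have kap0 : 0 < 4 * c * (C' * fine (mu (disc r1))) / e + 1 by rewrite ltr_wpDl.
have kapV : 0 < (4 * c * (C' * fine (mu (disc r1))) / e + 1)^-1 by rewrite invr_gt0.
near=> n.
set d : R := n.+1%:R ^- 2.
have n10 : 0 < n.+1%:R :> R by [].
have d0 : 0 < d by rewrite invr_gt0 exprn_gt0.
have [i1 m1] := integrable_indic_fin (c * d * eta) (measurable_disc n.+1%:R)
  (mu_disc_fin n.+1%:R).
have [i2 m2] := integrable_indic_fin (c * d * C') (measurable_disc r1) (mu_disc_fin r1).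
pose bb p : R := c * d * eta * \1_(disc n.+1%:R : set R2) p +
   c * d * C' * \1_(disc r1 : set R2) p.
have ib : mu.-integrable setT (EFin \o bb) := integrableD measurableT i1 i2.
apply: le_trans (integral2C_le _ _ ib) _.
- apply: mfunCM; first exact: mfunC_continuous.
  apply: mfunCM; first exact: mfunC_cutoff_dbar.
  by apply: mfunCB; exact: mfunC_reg_cauchy.
- move=> p; have cd0 : 0 <= c * d by rewrite mulr_ge0 ?(ltW d0).
  have [np|/ltW np] := leP (nc (toC p)) n.+1%:R; last first.
    rewrite cutoff_dbar_supp// mul0r mulr0 nc0 addr_ge0//.
      by rewrite mulr_ge0// mulr_ge0// ltW.
    by rewrite mulr_ge0// mulr_ge0.
  rewrite /bb [\1_(disc n.+1%:R) p]indicE mem_set// mulr1 -[c * d * C' * _]mulrA -mulrDr.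
  apply: le_trans (ler_wpM2l cd0 (decay p)).
  rewrite Normc.normcM (_ : c * d * _ = Mf * (C2 * d * (nc (toC p) *
    nc (reg_cauchy eps a p - reg_cauchy eps b p)))); last by rewrite /c; ring.
  rewrite ler_pM ?nc_ge0// Normc.normcM mulrA ler_wpM2r ?nc_ge0//.
  rewrite /cutoff_dbar Normc.normcM ler_wpM2r ?nc_ge0// nc_real normrM normrN.
  by rewrite (gtr0_norm d0) mulrC ler_wpM2r ?(ltW d0).
have -> : \int[mu]_p bb p = c * d * eta * fine (mu (disc n.+1%:R)) +
    c * d * C' * fine (mu (disc r1)).
  by rewrite /bb RintegralD// m1 m2.
have t1 : c * d * eta * fine (mu (disc n.+1%:R)) <= 4 * c * eta.
  apply: (@le_trans _ _ (c * d * eta * (4 * n.+1%:R ^+ 2))).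
    by rewrite ler_wpM2l ?mu_disc_le// mulr_ge0 ?(ltW eta0)// mulr_ge0 ?(ltW d0).
  have -> : c * d * eta * (4 * n.+1%:R ^+ 2) = 4 * c * eta * (n.+1%:R ^+ 2 * d) by ring.
  by rewrite mulfV ?mulr1// gt_eqF// exprn_gt0.
have t2 : 4 * (c * d * C' * fine (mu (disc r1))) <= e.
  have -> : 4 * (c * d * C' * fine (mu (disc r1))) =
    (4 * c * (C' * fine (mu (disc r1))) / e) * e * d by field; rewrite gt_eqF.
  set k := _ / e; have k0 : 0 <= k by exact: kap1.
  have dk : d <= (k + 1)^-1.
    apply: (@le_trans _ _ n.+1%:R^-1).
      rewrite /d -exprVn expr2 -[leRHS]mulr1 ler_wpM2l ?invr_ge0//.
      by rewrite invf_le1 ?ler1n.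
    apply: ltW; near: n; exact: near_infty_natSinv_lt (PosNum kapV).
  rewrite mulrAC -[leRHS]mul1r ler_wpM2r ?(ltW e0)//.
  apply: le_trans (ler_wpM2l k0 dk) _.
  by rewrite ler_pdivrMr ?ltr_wpDl// mul1r lerDl.
have t3 : 16 * c * eta <= e.
  rewrite /eta mulrA ler_pdivrMr// mulrC ler_wpM2l ?(ltW e0)//.
  by rewrite lerDl.
lra.
Unshelve. all: by end_near. Qed.

End CutoffTerm.

(** * Passage to the limit in the weak equation *)

Section CauchyPompeiu.
Variables (R : realType) (ft : R[i]^o -> R[i]^o) (Mf : R).
Variables (g : R[i] -> R[i]) (M : R) (Cg : nat -> R).
Local Notation R2 := (measurableTypeR R * measurableTypeR R)%type.
Local Notation mu := (lebesgue2 R).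
Hypothesis cft : continuous ft.
Hypothesis bft : forall z, nc (ft z) <= Mf.
Hypothesis gM : forall z, M < nc z -> g z = 0.
Hypothesis gC : forall N z, nc (g z) <= Cg N * axis_dist z ^+ N.
Hypothesis mg : mfunC (g \o @toC R : R2 -> R[i]).
Hypothesis ft_dbar : weak_dbar ft g.
Implicit Types (eps a b e : R).

Lemma nc_small (x : R) e : 0 < e -> (forall d : R, 0 < d -> x <= d * e) -> x <= 0.
Proof.
move=> e0 H; apply/ler_addgt0Pr => d d0; rewrite add0r.
by have := H (d / e) (divr_gt0 d0 e0); rewrite divfK ?gt_eqF.
Qed.

Lemma cutoff_cvg (p : R * R) e : 0 < e ->
  \forall n \near \oo, `|cutoff n p - flat_exp 1 1| <= e.
Proof.
move=> e0; have cF : {for (1 : R), continuous (flat_exp 1 : R -> R)}.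
  apply/differentiable_continuous/derivable1_diffP.
  by case: (is_derive_flat_exp 1 (1 : R)).
have /cvgrPdist_le /(_ e e0) /nbhs_ballP[d /= d0 H] := cF.
pose s := p.1 * p.1 + p.2 * p.2.
have s0 : 0 <= s by rewrite addr_ge0// -expr2 sqr_ge0.
have ds : 0 < d / (s + 1) by rewrite divr_gt0// ltr_wpDl.
near=> n; rewrite distrC; apply: H.
rewrite /ball /= /cutoff_arg mulNr opprD addrA subrr sub0r opprK ger0_norm; last first.
  by rewrite mulr_ge0// invr_ge0 sqr_ge0.
have nd : n.+1%:R^-1 < d / (s + 1).
  near: n; exact: near_infty_natSinv_lt (PosNum ds).
apply: (@le_lt_trans _ _ (n.+1%:R^-1 * s)).
  rewrite ler_wpM2r// -exprVn expr2 -[leRHS]mulr1 ler_wpM2l ?invr_ge0//.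
  by rewrite invf_le1 ?ler1n.
apply: (@le_lt_trans _ _ (n.+1%:R^-1 * (s + 1)));
  first by rewrite ler_wpM2l ?invr_ge0 ?lerDl.
by rewrite -ltr_pdivlMr// ltr_wpDl.
Unshelve. all: by end_near. Qed.

Lemma cutoff_scaled_cvg (z : R[i]) (p : R * R) e : 0 < e ->
  \forall n \near \oo, nc (z * (cutoff n p)%:C - z * (flat_exp 1 1)%:C) <= e.
Proof.
move=> e0; have z1 : 0 < nc z + 1 by rewrite ltr_wpDl ?nc_ge0.
have := cutoff_cvg p (divr_gt0 e0 z1); apply: filterS => n H.
rewrite -mulrBr -rmorphB Normc.normcM nc_real.
apply: le_trans (ler_wpM2l (nc_ge0 z) H) _.
rewrite mulrCA -[leRHS]mulr1 ler_wpM2l ?(ltW e0)// ler_pdivrMr// mul1r.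
by rewrite lerDl.
Qed.

Lemma cutoff_term_intg n eps a b : 0 < eps ->
  intgC (fun p : R2 => ft (toC p) *
     (cutoff_dbar n p * (reg_cauchy eps a p - reg_cauchy eps b p))).
Proof.
move=> eps0.
have [C2 HC2] := flat_exp_le ('X^2 * (1 - 1^`()) : {poly R}).
have C20 : 0 <= C2 := le_trans (normr_ge0 _) (HC2 0).
pose c := Mf * (n.+1%:R ^- 2 * C2 * n.+1%:R * (eps^-1 + eps^-1)).
have d0 : 0 <= n.+1%:R ^- 2 :> R by rewrite invr_ge0 sqr_ge0.
have [ib _] := integrable_indic_fin c (measurable_disc n.+1%:R) (mu_disc_fin n.+1%:R).
apply: intgC_dom ib.
  apply: mfunCM; first exact: mfunC_continuous.
  apply: mfunCM; first exact: mfunC_cutoff_dbar.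
  by apply: mfunCB; exact: mfunC_reg_cauchy.
apply: dom_disc => p; last first.
  by move=> /negP; rewrite -ltNge => /ltW np; rewrite cutoff_dbar_supp// mul0r mulr0.
move=> np; rewrite Normc.normcM ler_pM ?nc_ge0//.
rewrite Normc.normcM ler_pM ?nc_ge0//; last first.
  by apply: le_trans (ncB _ _) _; rewrite lerD ?reg_cauchy_le.
rewrite /cutoff_dbar Normc.normcM ler_pM ?nc_ge0// nc_real normrM normrN.
by rewrite (ger0_norm d0) ler_wpM2l.
Qed.

(** With [eps] fixed, the weak equation is tested against [cut_kernel n] and n tends to infinity by
    dominated convergence. Both surviving integrals acquire the factor k > 0, the limit of the
    cutoffs, which is then divided out. *)
Lemma regularized_identity eps a b : 0 < eps ->
  integral2C (fun p : R2 => ft (toC p) * (approx_delta eps a p - approx_delta eps b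
    p)%:C) =
  - integral2C (fun p : R2 => g (toC p) * (reg_cauchy eps a p - reg_cauchy eps b p)).
Proof.
move=> eps0.
have [ia _] := approx_delta_mass a eps0; have [ib _] := approx_delta_mass b eps0.
have [C1 HC1] := flat_exp_le (1 : {poly R}).
have C10 : 0 <= C1 := le_trans (normr_ge0 _) (HC1 0).
have Mf0 : 0 <= Mf := Mf_ge0 bft.
set k : R := flat_exp 1 1.
have k0 : 0 < k by rewrite /k /flat_exp ltr01 hornerC mul1r expR_gt0.
pose pd p := approx_delta eps a p - approx_delta eps b p.
pose rc p := reg_cauchy eps a p - reg_cauchy eps b p.
pose P n p := (ft (toC p) * (pd p)%:C) * (cutoff n p)%:C.
pose S n p := (g (toC p) * rc p) * (cutoff n p)%:C.
have mft := mfunC_continuous cft.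
have mpd : mfunC (fun p : R2 => (pd p)%:C).
  by apply: mfunC_real; apply: measurable_funB; exact: measurable_approx_delta.
have mrc : mfunC (rc : R2 -> R[i]) by apply: mfunCB; exact: mfunC_reg_cauchy.
have mcst (c : R[i]) : mfunC (fun _ : R2 => c) by exact: mfunC_cst.
pose bp p : R := Mf * C1 * (approx_delta eps a p + approx_delta eps b p).
have ibp : mu.-integrable setT (EFin \o bp).
  exact: (RintegralZ (Mf * C1) (integrableD measurableT ia ib)).1.
have kC1 : `|k| <= C1 by exact: HC1.
have Pb (x : R) p : `|x| <= C1 -> nc ((ft (toC p) * (pd p)%:C) * x%:C) <= bp p.
  move=> xC; rewrite !Normc.normcM !nc_real /bp -mulrA [leRHS]mulrAC.
  rewrite -[leRHS]mulrA ler_pM ?nc_ge0 ?mulr_ge0// ler_pM//.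
  by apply: le_trans (ler_normB _ _) _; rewrite !ger0_norm ?approx_delta_ge0.
pose Q : set R2 := disc M.
pose cS := Cg 0 * (eps^-1 + eps^-1) * C1.
have [iS _] := integrable_indic_fin cS (measurable_disc M) (mu_disc_fin M).
have Sb (x : R) p : `|x| <= C1 -> nc ((g (toC p) * rc p) * x%:C) <= cS * \1_Q p.
  move=> xC; rewrite indicE; have [pQ|pQ] := pselect (Q p); last first.
    rewrite memNset// mulr0 gM ?mul0r ?nc0//.
    by rewrite ltNge; exact/negP.
  rewrite mem_set// mulr1 !Normc.normcM nc_real.
  rewrite ler_pM ?mulr_ge0 ?nc_ge0// ler_pM ?nc_ge0//.
    by have := gC 0 (toC p); rewrite expr0 mulr1.
  by apply: le_trans (ncB _ _) _; rewrite lerD ?reg_cauchy_le.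
have mP n : mfunC (P n : R2 -> R[i]).
  by apply: mfunCM; [exact: mfunCM|exact: mfunC_cutoff].
have mS n : mfunC (S n : R2 -> R[i]).
  by apply: mfunCM; [exact: mfunCM|exact: mfunC_cutoff].
have mPk : mfunC (fun p : R2 => (ft (toC p) * (pd p)%:C) * k%:C).
  by apply: mfunCM => //; exact: mfunCM.
have mSk : mfunC (fun p : R2 => (g (toC p) * rc p) * k%:C).
  by apply: mfunCM => //; exact: mfunCM.
set A := integral2C _; set G := integral2C _.
have eA : integral2C (fun p : R2 => (ft (toC p) * (pd p)%:C) * k%:C) = k%:C * A.
  have i0 : intgC (fun p : R2 => ft (toC p) * (pd p)%:C).
    have [i1 _] := RintegralZ Mf (integrableD measurableT ia ib).
    apply: intgC_dom i1; first exact: mfunCM.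
    move=> p; rewrite Normc.normcM nc_real ler_pM ?nc_ge0//.
    by apply: le_trans (ler_normB _ _) _; rewrite !ger0_norm ?approx_delta_ge0.
  rewrite -(intgCZ k%:C i0).2; congr integral2C; apply/funext => p.
  by rewrite mulrC.
have eG : integral2C (fun p : R2 => (g (toC p) * rc p) * k%:C) = k%:C * G.
  have [i1 _] := integrable_indic_fin (Cg 0 * (eps^-1 + eps^-1)) (measurable_disc M)
    (mu_disc_fin M).
  have i0 : intgC (fun p : R2 => g (toC p) * rc p).
    apply: intgC_dom i1; first exact: mfunCM.
    apply: dom_disc => p pQ; last first.
      by rewrite gM ?mul0r// ltNge; exact/negP.
    rewrite Normc.normcM ler_pM ?nc_ge0//.
      by have := gC 0 (toC p); rewrite expr0 mulr1.
    by apply: le_trans (ncB _ _) _; rewrite lerD ?reg_cauchy_le.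
  rewrite -(intgCZ k%:C i0).2; congr integral2C; apply/funext => p.
  by rewrite mulrC.
have weak n : integral2C (P n) + integral2C (fun p : R2 => ft (toC p) *
     (cutoff_dbar n p * rc p)) = - integral2C (S n).
  rewrite -integral2CD; last exact: cutoff_term_intg.
    have := ft_dbar (cut_kernel_test n a b eps0).
    have -> : (fun p => g (toC p) * cut_kernel n eps a b p) = S n.
      by apply/funext => p; rewrite /S /cut_kernel /rc; ring.
    move=> <-; congr integral2C; apply/funext => p.
    by rewrite cut_kernel_dbar// /P rmorphM /= /pd /rc; ring.
  by apply: intgC_dom ibp => // p; apply: Pb; exact: HC1.
suff : nc (A + G) <= 0.
  move=> AG; have : A + G = 0 by apply: nc_eq0; apply/eqP; rewrite eq_le AG nc_ge0.
  by move/eqP; rewrite addr_eq0 => /eqP.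
(* Three errors of size e, for the mass term, the source term and the cutoff term, all divided by
   k. *)
apply: (@nc_small _ (3 / k)); first by rewrite divr_gt0.
move=> e e0.
have nP : \forall n \near \oo, nc (integral2C (P n) -
    integral2C (fun p : R2 => (ft (toC p) * (pd p)%:C) * k%:C)) <= e.
  apply: (integral2C_cvg mP mPk _ ibp _ e0) => [n p|p e' e'0]; first exact/Pb/HC1.
  exact: cutoff_scaled_cvg.
have nS : \forall n \near \oo, nc (integral2C (S n) -
    integral2C (fun p : R2 => (g (toC p) * rc p) * k%:C)) <= e.
  apply: (integral2C_cvg mS mSk _ iS _ e0) => [n p|p e' e'0]; first exact/Sb/HC1.
  exact: cutoff_scaled_cvg.
have nQ := cutoff_term_small cft bft a b eps0 e0.
have [n [[n1 n2] n3]] := filter_ex (filterI (filterI nP nS) nQ).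
rewrite mulrA ler_pdivlMr// mulrC.
have -> : k * nc (A + G) = nc (k%:C * (A + G)) by rewrite Normc.normcM nc_real gtr0_norm.
rewrite eA in n1; rewrite eG in n2.
have -> : k%:C * (A + G) = - (integral2C (P n) - k%:C * A) -
  (integral2C (S n) - k%:C * G) - integral2C (fun p : R2 =>
    ft (toC p) * (cutoff_dbar n p * rc p)).
  have := weak n; move: (integral2C (P n)) (integral2C (S n)) => x y.
  by move: (integral2C _) => q /eqP; rewrite -subr_eq0 opprK => /eqP w;
    apply/eqP; rewrite -subr_eq0 -w; apply/eqP; ring.
have -> : e * 3 = e + e + e by ring.
apply: le_trans (ncB _ _) (lerD _ n3); apply: le_trans (ncB _ _) (lerD _ n2).
by rewrite ncN.
Qed.

(** Dominated convergence despite the real pole: |E_a| <= 1 / |z - a| <= 1 / axis_dist z on the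
    disc, and one order of vanishing of [g] bounds the product by [Cg 1]. *)
Lemma reg_ctrans_cvg a e : 0 < e -> \forall n \near \oo,
  nc (integral2C (fun p : R2 => g (toC p) * reg_cauchy n.+1%:R^-1 a p) -
      ctrans g 0 a%:C) <= e.
Proof.
have e1 (n : nat) : 0 < n.+1%:R^-1 :> R by rewrite invr_gt0.
have [ib _] := integrable_indic_fin (Cg 1) (measurable_disc M) (mu_disc_fin M).
have gnz (z : R[i]) : g z != 0 -> 0 < axis_dist z.
  move=> gz; rewrite lt_neqAle axis_dist_ge0 andbT eq_sym.
  by apply: contra gz => /eqP/(weight0 gC) ->.
have Da : jet_dom (M + 1) a%:C by exact: real_jet_dom.
apply: (integral2C_cvg _ _ _ ib).
- by move=> n; apply: mfunCM => //; exact: mfunC_reg_cauchy.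
- exact: mfunC_wkernel.
- move=> n; apply: dom_disc => p pQ; last first.
    by rewrite gM ?mul0r// ltNge; exact/negP.
  have [->|/gnz q0] := eqVneq (g (toC p)) 0; first by rewrite mul0r nc0 (weight_ge0 gC).
  have ap := axis_dist_le pQ Da.
  rewrite Normc.normcM; apply: le_trans (weight_pow_le gC 1 q0).
  rewrite expr1 ler_wpM2l ?nc_ge0//.
  apply: le_trans (reg_cauchy_le_inv (e1 n) (lt_le_trans q0 ap)) _.
  by rewrite lef_pV2 ?posrE// (lt_le_trans q0 ap).
- move=> p e' e'0.
  have [g0|gz] := eqVneq (g (toC p)) 0.
    by apply: nearW => n; rewrite /wkernel g0 !mul0r subr0 nc0 ltW.
  have pQ : nc (toC p) <= M by rewrite leNgt; apply: contra gz => /gM ->.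
  have z0 := lt_le_trans (gnz _ gz) (axis_dist_le pQ Da).
  set r := nc (toC p - a%:C) in z0.
  have g0 : 0 < nc (g (toC p)) + 1 by rewrite ltr_wpDl ?nc_ge0.
  have c0 : 0 < e' * r ^+ 3 / (nc (g (toC p)) + 1) by rewrite divr_gt0 ?mulr_gt0
    ?exprn_gt0.
  near=> n; rewrite /wkernel expr1 -mulrBr Normc.normcM.
  apply: le_trans (ler_wpM2l (nc_ge0 _) (reg_cauchy_dist (e1 n) z0)) _.
  rewrite -/r mulrA ler_pdivrMr ?exprn_gt0//.
  apply: (@le_trans _ _ ((nc (g (toC p)) + 1) * n.+1%:R^-1)).
    rewrite ler_pM ?nc_ge0 ?sqr_ge0 ?lerDl// expr2 -[leRHS]mulr1 ler_wpM2l ?invr_ge0//.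
    by rewrite invf_le1 ?ler1n.
  rewrite mulrC -ler_pdivlMr//; apply: ltW.
  near: n; exact: near_infty_natSinv_lt (PosNum c0).
Unshelve. all: by end_near. Qed.

Lemma cauchy_pompeiu a b :
  pi%:C * (ft a%:C - ft b%:C) = - (ctrans g 0 a%:C - ctrans g 0 b%:C).
Proof.
pose V := pi%:C * (ft a%:C - ft b%:C) + (ctrans g 0 a%:C - ctrans g 0 b%:C).
suff : nc V <= 0.
  move=> V0; have : V = 0 by apply: nc_eq0; apply/eqP; rewrite eq_le V0 nc_ge0.
  by move/eqP; rewrite addr_eq0 => /eqP.
(* Four limits are taken at a common n: the mass integral and the transform, at a and at b. *)
apply: (@nc_small _ 4) => // e e0.
have pa := approx_delta_limit cft bft a e0; have pb := approx_delta_limit cft bft b e0.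
have ra := reg_ctrans_cvg a e0; have rb := reg_ctrans_cvg b e0.
pose pI n (c : R) := integral2C (fun p : R2 =>
  ft (toC p) * (approx_delta n.+1%:R^-1 c p)%:C).
pose rI n (c : R) := integral2C (fun p : R2 => g (toC p) * reg_cauchy n.+1%:R^-1 c p).
have [n [[n1 n2] [n3 n4]]] := filter_ex (filterI (filterI pa pb) (filterI ra rb)).
rewrite -/(pI n a) in n1; rewrite -/(pI n b) in n2.
rewrite -/(rI n a) in n3; rewrite -/(rI n b) in n4.
have eps0 : 0 < n.+1%:R^-1 :> R by rewrite invr_gt0.
have mft := mfunC_continuous cft.
have ipI c := intgC_approx_delta c eps0 mft bft.
have irI c : intgC (fun p : R2 => g (toC p) * reg_cauchy n.+1%:R^-1 c p).
  have [i1 _] := integrable_indic_fin (Cg 0 * n.+1%:R^-1^-1) (measurable_disc M)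
    (mu_disc_fin M).
  apply: intgC_dom i1.
    by apply: mfunCM => //; exact: mfunC_reg_cauchy.
  apply: dom_disc => p pQ; last first.
    by rewrite gM ?mul0r// ltNge; exact/negP.
  rewrite Normc.normcM ler_pM ?nc_ge0 ?reg_cauchy_le//.
  by have := gC 0 (toC p); rewrite expr0 mulr1.
have E := regularized_identity a b eps0.
have E1 : pI n a - pI n b = - (rI n a - rI n b).
  rewrite -(intgCB (ipI a) (ipI b)).2 -(intgCB (irI a) (irI b)).2.
  transitivity (integral2C (fun p : R2 => ft (toC p) *
     (approx_delta n.+1%:R^-1 a p - approx_delta n.+1%:R^-1 b p)%:C)).
    by congr integral2C; apply/funext => p; rewrite rmorphB mulrBr.
  by rewrite E; congr (- integral2C _); apply/funext => p; rewrite mulrBr.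
have -> : V = - (pI n a - pi%:C * ft a%:C) + (pI n b - pi%:C * ft b%:C) -
    (rI n a - ctrans g 0 a%:C) + (rI n b - ctrans g 0 b%:C).
  move/eqP: E1; rewrite -subr_eq0 opprK => /eqP E1.
  by apply/eqP; rewrite -subr_eq0 -E1 /V; apply/eqP; ring.
set x1 := pI n a - _ in n1 *; set x2 := pI n b - _ in n2 *.
set x3 := rI n a - _ in n3 *; set x4 := rI n b - _ in n4 *.
have -> : e * 4 = e + e + e + e by ring.
apply: le_trans (ncD _ _) (lerD _ n4); apply: le_trans (ncB _ _) (lerD _ n3).
by apply: le_trans (ncD _ _) (lerD _ n2); rewrite ncN.
Qed.

End CauchyPompeiu.

(** * Conclusion *)

Section LimitAtInfinity.
Variable R : realType.

Instance abs_pinfty_filter : ProperFilter (@abs_pinfty R).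
Proof.
apply: Build_ProperFilter_ex; last first.
  split; first by exists 0.
    move=> A1 A2 [M1 H1] [M2 H2]; exists (Num.max M1 M2) => x.
    by rewrite gt_max => /andP[x1 x2]; split; [exact: H1|exact: H2].
  by move=> A1 A2 A12 [M1 H1]; exists M1 => x /H1; exact: A12.
move=> A [M HM]; exists (`|M| + 1); apply: HM.
by rewrite ger0_norm ?addr_ge0// (le_lt_trans (ler_norm _))// ltrDl.
Qed.

Lemma lim_at_infty_eq (f : R -> R[i]) (c : R[i]) :
  (forall e : R, 0 < e -> exists M : R, forall x : R, M < `|x| -> nc (c - f x) <= e) ->
  lim_at_infty f = c.
Proof.
move=> H; rewrite /lim_at_infty; apply: (@cvg_lim R[i]^o); first exact: norm_hausdorff.
apply/cvgrPdist_le => e e0.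
have eE : e = (complex.Re e)%:C by rewrite RRe_real// gtr0_real.
have [|M HM] := H (complex.Re e); first by rewrite -ltcR -eE.
by exists M => x /HM; rewrite norm_nc [in X in _ -> X]eE lecR.
Qed.

End LimitAtInfinity.

Section Decay.
Variables (R : realType) (g : R[i] -> R[i]) (M : R) (Cg : nat -> R).
Local Notation R2 := (measurableTypeR R * measurableTypeR R)%type.
Local Notation mu := (lebesgue2 R).
Hypothesis gM : forall z, M < nc z -> g z = 0.
Hypothesis gC : forall N z, nc (g z) <= Cg N * axis_dist z ^+ N.
Hypothesis mg : mfunC (g \o @toC R : R2 -> R[i]).

Lemma ctrans_far (x : R) : M < `|x| ->
  nc (ctrans g 0 x%:C) <= 2 * (Cg 0 / (`|x| - M) * fine (mu (disc M))).
Proof.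
move=> Mx; apply: (integral2C_disc _ _ _).2.
- exact: mfunC_wkernel.
- move=> p pQ; rewrite /wkernel expr1 Normc.normcM ler_pM ?nc_ge0//.
    by have := gC 0 (toC p); rewrite expr0 mulr1.
  have px : `|x| - M <= nc (toC p - x%:C).
    have : nc x%:C <= nc (toC p) + nc (toC p - x%:C).
      by apply: le_trans (ncB _ _); rewrite opprB addrC subrK.
    by move: pQ; rewrite nc_real /disc /=; lra.
  have xM : 0 < `|x| - M by rewrite subr_gt0.
  by rewrite Normc.normcV lef_pV2 ?posrE// (lt_le_trans xM px).
- by move=> p; exact: wkernel_supp.
Qed.

Lemma ctrans_infty (e : R) : 0 < e ->
  exists N : R, forall x : R, N < `|x| -> nc (ctrans g 0 x%:C) <= e.
Proof.
move=> e0; exists (M + 2 * (Cg 0 * fine (mu (disc M))) / e) => x Nx.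
have k0 : 0 <= 2 * (Cg 0 * fine (mu (disc M))).
  by rewrite mulr_ge0// mulr_ge0 ?(weight_ge0 gC)// fine_ge0.
have Mx : M < `|x|.
  by apply: le_lt_trans Nx; rewrite lerDl divr_ge0// ltW.
apply: le_trans (ctrans_far Mx) _.
have -> : 2 * (Cg 0 / (`|x| - M) * fine (mu (disc M))) =
  2 * (Cg 0 * fine (mu (disc M))) / (`|x| - M) by ring.
move: Nx; rewrite ler_pdivrMr ?subr_gt0// -ltrBrDl ltr_pdivrMr// => /ltW.
by rewrite [leRHS]mulrC.
Qed.

End Decay.

Theorem proposition11p4 (R : realType) (B : completeNormedModType R[i])
  (Op : (R -> R[i]) -> B -> B)
  (Op_bounded : forall f, Gspace f -> bounded_op (Op f))
  (Op_linear : forall (a : R[i]) (f1 f2 : R -> R[i]),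
     Gspace f1 -> Gspace f2 ->
     forall u, Op (fun x => a * f1 x + f2 x) u = a *: Op f1 u + Op f2 u)
  (Op_continuous : forall (fn : nat -> R -> R[i]) (f : R -> R[i]),
     cvg_G fn f -> cvg_op (fun n => Op (fn n)) (Op f))
  (Op_mult : forall f1 f2 : R -> R[i], Gspace f1 -> Gspace f2 ->
     forall u, Op f1 (Op f2 u) = Op (fun x => f1 x * f2 x) u)
  (Op_dense : dense (span_of_test_ranges Op))
  (Op_null : forall u, (forall g, test_line g -> Op g u = 0) -> u = 0) :
  forall f, Gspace f -> is_functional_calculus (generated_op Op) f (Op f).
Proof.
move=> f _ ft g [cft [Mf bft'] ftf ft_dbar [mg' [M' gM'] gC']].
have bft z : nc (ft z) <= Mf by rewrite -lecR; exact: bft'.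
(* The maximum makes M + 1 an admissible, positive radius. *)
pose M := Num.max M' 0.
have M0 : 0 <= M by rewrite le_max lexx orbT.
have gM z : M < nc z -> g z = 0.
  by rewrite gt_max => /andP[zM _]; apply: gM'; rewrite norm_nc ltcR.
have [Cs HCs] := choice gC'.
(* The bound of order N is used where |Im z| <= 1; elsewhere [axis_dist] is 1 and the bound of order
   0 takes over. *)
pose Cg N := Num.max (Cs N) (Cs 0).
have gC N z : nc (g z) <= Cg N * axis_dist z ^+ N.
  rewrite /axis_dist; have [z1|z1] := leP `|complex.Im z| 1.
    apply: (@le_trans _ _ (Cs N * `|complex.Im z| ^+ N)).
      by have := HCs N z; rewrite norm_nc lecR.
    by rewrite ler_wpM2r ?exprn_ge0// le_max lexx.
  rewrite expr1n mulr1; have := HCs 0%N z.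
  rewrite norm_nc lecR expr0 mulr1 => /le_trans; apply.
  by rewrite le_max lexx orbT.
have mg : mfunC (g \o @toC R : (measurableTypeR R * measurableTypeR R)%type -> R[i]).
  exact: mg'.
exists (ctrans_op Op g).
  exact: (bochner_ctrans Op_bounded Op_linear Op_continuous Op_mult Op_dense M0 gM gC mg).
(* Cauchy-Pompeiu with second point 0 determines f up to this constant, which the decay of the
   transform then identifies as the limit at infinity. *)
move=> u; pose c := f 0 + (pi^-1)%:C * ctrans g 0 0.
have piN0 : (pi : R) != 0 by rewrite gt_eqF// pi_gt0.
have fE x : f x = - (pi^-1)%:C * jet_fun (ctrans g) x + c.
  have := cauchy_pompeiu cft bft gM gC mg ft_dbar x 0.
  rewrite !ftf => /(congr1 (fun w => (pi^-1)%:C * w)).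
  rewrite mulrA -rmorphM mulVf//= mul1r => /eqP; rewrite subr_eq => /eqP ->.
  by rewrite /c /jet_fun; ring.
have limf : lim_at_infty f = c.
  apply: lim_at_infty_eq => e e0.
  have e1 : 0 < pi * e by rewrite mulr_gt0 ?pi_gt0.
  have [N HN] := ctrans_infty gM gC mg e1.
  exists N => x /HN xN; rewrite fE opprD addrCA subrr addr0 mulNr opprK.
  rewrite Normc.normcM nc_real ger0_norm ?invr_ge0 ?pi_ge0//.
  by rewrite mulrC ler_pdivrMr ?pi_gt0// mulrC.
have Gc : Gspace (fun _ : R => c) := Gspace_cst c.
have r0 : 0 < M + 1 by rewrite ltr_wpDl.
have Gt := Gspace_jet r0 (is_jet_ctrans gM gC mg).
rewrite limf (_ : f = fun x => - (pi^-1)%:C * jet_fun (ctrans g) x + c);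
  last exact/funext.
rewrite Op_linear// (Op_cst Op_bounded Op_linear Op_mult Op_dense).
by rewrite addrC scaleNr.
Qed.
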